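(* Let $(R,\mathfrak m)$ be a $d$-dimensional ($d>0$) Cohen-Macaulay local ring with infinite residue field, and assume that $R$ admits a canonical module $K$. The following conditions are equivalent: (i) $R$ has minimal multiplicity. (ii) $\Omega^1(K)$ is Ulrich. (iii) There exist a natural number $t$ and an exact sequence $0\to R\to K^{t}\to D\to 0$ such that $D$ is a maximal Cohen-Macaulay Ulrich module. When this is the case, $t=\mathrm r(R)$.
   Context: ''Local ring'' means commutative Noetherian local ring and all modules are finitely generated. For an $R$-module $M$, $\mu(M)$ is its minimal number of generators and $\mathrm e^0_{\mathfrak m}(M)$ is its multiplicity with respect to $\mathfrak m$ (normalized by $\dim M$). $M$ is Ulrich if $M$ is Cohen-Macaulay and $\mu(M)=\mathrm e^0_{\mathfrak m}(M)$. $\Omega^1(K)$ is the first syzygy of $K$ in its minimal free resolution. $\mathrm r(R)$ is the Cohen-Macaulay type of $R$, $\mathrm r(R)=\dim_{R/\mathfrak m}\operatorname{Ext}^{d}_R(R/\mathfrak m,R)$. A Cohen-Macaulay local ring $R$ has minimal multiplicity if $\mathrm e^0_{\mathfrak m}(R)=\mu(\mathfrak m)-\dim R+1$ (for non-regular $R$ of positive dimension with infinite residue field, equivalently $\mathrm e^0_{\mathfrak m}(R)=\mathrm r(R)+1$).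
   Formalization: Adds the hypothesis that R is not Gorenstein: for Gorenstein R one has Ω^1(K)=0 and the equivalence fails, at k[[t^3,t^4]] if 0 counts as Ulrich and at k[[x,y]]/(xy) if it does not. *)

(* Defs.v *)
From mathcomp Require Import all_boot all_order all_algebra.
From mathcomp Require Import boolp classical_sets functions cardinality.
Set Implicit Arguments.
Unset Strict Implicit.
Unset Printing Implicit Defensive.
Import Order.TTheory GRing.Theory Num.Theory.
Local Open Scope classical_set_scope.
Local Open Scope ring_scope.

(* Numerical invariants (dimension, depth, length, multiplicity, type, ...) are
   functional relations "has_... x n", read "the invariant of x is the natural
   number n"; in particular they do not hold for any n when the invariant is
   infinite or undefined. *)

Definition chain (T : Type) (P : set T -> Prop) (n : nat) : Prop :=
  exists c : nat -> set T,
    (forall i, (i <= n)%N -> P (c i)) /\ (forall i, (i < n)%N -> c i `<` c i.+1).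

Definition longest_chain (T : Type) (P : set T -> Prop) (n : nat) : Prop :=
  chain P n /\ forall k, chain P k -> (k <= n)%N.

Section Submodules.
Variables (R : comNzRingType) (M : lmodType R).
Implicit Types (N S : set M) (I : set R).

Definition submodule N : Prop :=
  N 0 /\ forall (a : R) x y, N x -> N y -> N (a *: x + y).

Definition span S : set M :=
  [set x | exists (n : nat) (a : 'I_n -> R) (v : 'I_n -> M),
     (forall i, S (v i)) /\ x = \sum_i a i *: v i].

Definition generated_by N (n : nat) : Prop :=
  exists v : 'I_n -> M, N = span (range v).

(* mu(N) *)
Definition has_min_gens N (n : nat) : Prop :=
  generated_by N n /\ forall k, generated_by N k -> (n <= k)%N.

(* the submodule I N *)
Definition smul I N : set M := span [set a *: x | a in I & x in N].

Definition ann : set R := [set a | forall x : M, a *: x = 0].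

(* the length of M / N, its submodules being the L / N with N <= L <= M *)
Definition has_colength N (n : nat) : Prop :=
  longest_chain (fun L => submodule L /\ N `<=` L) n.

End Submodules.

Definition fin_gen (R : comNzRingType) (M : lmodType R) : Prop :=
  exists n, generated_by [set: M] n.

Section Rings.
Variable R : comNzRingType.
Implicit Types (I m : set R).

Definition ideal I : Prop := @submodule R R^o I.

Definition prime_ideal I : Prop :=
  [/\ ideal I, ~ I 1 & forall a b, I (a * b) -> I a \/ I b].

Definition maximal_ideal I : Prop :=
  [/\ ideal I, ~ I 1 & forall J, ideal J -> ~ J 1 -> I `<=` J -> J = I].

Definition noetherian : Prop :=
  forall I, ideal I -> exists n, @generated_by R R^o I n.

Definition noetherian_local m : Prop :=
  [/\ noetherian, maximal_ideal m & forall n, maximal_ideal n -> n = m].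

Definition ideal_pow I (k : nat) : set R :=
  iter k (@smul R R^o I) [set: R].

(* the set of cosets R / I *)
Definition cosets I : set (set R) :=
  [set [set y | I (y - x)] | x in [set: R]].

End Rings.

Section Invariants.
Variables (R : comNzRingType) (m : set R).

(* Krull dimension of R / ann M *)
Definition has_dim (M : lmodType R) (s : nat) : Prop :=
  longest_chain (fun P : set R => prime_ideal P /\ @ann R M `<=` P) s.

Definition regular_seq (M : lmodType R) (x : seq R) : Prop :=
  let xM i := @smul R M [set a | a \in take i x] [set: M] in
  [/\ forall a, a \in x -> m a,
      forall i (y : M), (i < size x)%N -> xM i (x`_i *: y) -> xM i y
    & xM (size x) <> [set: M] ].

Definition has_depth (M : lmodType R) (s : nat) : Prop :=
  (exists2 x, regular_seq M x & size x = s) /\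
  (forall x, regular_seq M x -> (size x <= s)%N).

Definition cohen_macaulay (M : lmodType R) : Prop :=
  [/\ fin_gen M, exists x : M, x != 0
    & exists2 s, has_dim M s & has_depth M s].

Definition max_cohen_macaulay (M : lmodType R) : Prop :=
  cohen_macaulay M /\ exists2 s, has_dim M s & has_dim R^o s.

(* e^0_m(M) = s! * (leading coefficient of the Hilbert-Samuel polynomial P),
   where P has degree s = dim M and l(M / m^(k+1) M) = P(k) for k >> 0 *)
Definition has_multiplicity (M : lmodType R) (e : nat) : Prop :=
  exists (s : nat) (P : {poly rat}),
    [/\ has_dim M s, size P = s.+1,
        exists k0, forall k, (k0 <= k)%N ->
          exists2 l, has_colength (smul (ideal_pow m k.+1) [set: M]) l
                   & P.[k%:R] = l%:R
      & e%:R = s`!%:R * lead_coef P].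

Definition ulrich (M : lmodType R) : Prop :=
  cohen_macaulay M /\
  exists2 n, has_min_gens [set: M] n & has_multiplicity M n.

(* the equation e^0_m(R) = mu(m) - dim R + 1 *)
Definition minimal_multiplicity : Prop :=
  exists e n d : nat,
    [/\ has_multiplicity R^o e, @has_min_gens R R^o m n, has_dim R^o d
      & e%:Z = n%:Z - d%:Z + 1].

(* A resolution ... -> R^(b 1) -> R^(b 0) -> R/m -> 0 by row vectors, where the
   augmentation R^(b 0) -> R/m is the class mod m of u |-> u *m eps (every
   linear map R^(b 0) -> R/m has this form). *)
Definition residue_resolution (b : nat -> nat) (eps : 'cV[R]_(b 0%N))
    (D : forall i, 'M[R]_(b i.+1, b i)) : Prop :=
  [/\ exists u : 'rV_(b 0%N), m ((u *m eps) 0 0 - 1),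
      forall u : 'rV_(b 0%N),
        m ((u *m eps) 0 0) <-> exists v : 'rV_(b 1%N), u = v *m D 0%N
    & forall i (u : 'rV_(b i.+1)),
        u *m D i = 0 <-> exists v : 'rV_(b i.+2), u = v *m D i.+1].

(* the map Hom(R^q, M) -> Hom(R^p, M) induced by u |-> u *m A, where
   Hom(R^q, M) is identified with M^q through the values on the basis *)
Definition hom_map (M : lmodType R) (p q : nat) (A : 'M[R]_(p, q))
    (w : {ffun 'I_q -> M}) : {ffun 'I_p -> M} :=
  [ffun l => \sum_j A l j *: w j].

Definition cocycles (M : lmodType R) (b : nat -> nat)
    (D : forall i, 'M[R]_(b i.+1, b i)) (i : nat) : set {ffun 'I_(b i) -> M} :=
  [set w | hom_map (D i) w = 0].

Definition coboundaries (M : lmodType R) (b : nat -> nat)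
    (D : forall i, 'M[R]_(b i.+1, b i)) (i : nat) : set {ffun 'I_(b i) -> M} :=
  match i return set {ffun 'I_(b i) -> M} with
  | 0%N => [set 0]
  | j.+1 => range (@hom_map M _ _ (D j))
  end.

(* the classes of the v i form an R/m-basis of Z / B (used when m Z <= B) *)
Definition has_residue_dim (N : lmodType R) (Z B : set N) (n : nat) : Prop :=
  exists v : 'I_n -> N,
    [/\ forall i, Z (v i),
        forall z, Z z -> exists a : 'I_n -> R, B (z - \sum_i a i *: v i)
      & forall a : 'I_n -> R, B (\sum_i a i *: v i) -> forall i, m (a i)].

(* dim_{R/m} Ext^i_R(R/m, M) *)
Definition has_ext_dim (i : nat) (M : lmodType R) (n : nat) : Prop :=
  exists (b : nat -> nat) (eps : 'cV[R]_(b 0%N))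
         (D : forall i, 'M[R]_(b i.+1, b i)),
    residue_resolution eps D /\
    has_residue_dim (@cocycles M b D i) (@coboundaries M b D i) n.

Definition has_cm_type (M : lmodType R) (r : nat) : Prop :=
  exists2 s, has_dim M s & has_ext_dim s M r.

End Invariants.

Section Homological.
Variable R : comNzRingType.

Definition short_exact (A B C : lmodType R)
    (f : {linear A -> B}) (g : {linear B -> C}) : Prop :=
  [/\ injective f, set_surj setT setT g
    & forall y, g y = 0 <-> exists x, f x = y].

Definition injective_module (E : lmodType R) : Prop :=
  forall (A B : lmodType R) (f : {linear A -> B}) (g : {linear A -> E}),
    injective f -> exists h : {linear B -> E}, forall x, h (f x) = g x.

Definition finite_injdim (M : lmodType R) : Prop :=
  exists (n : nat) (E : nat -> lmodType R) (eta : {linear M -> E 0%N})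
         (D : forall i, {linear E i -> E i.+1}),
    [/\ forall i, injective_module (E i),
        forall i, (n < i)%N -> forall x : E i, x = 0,
        injective eta,
        forall y, D 0%N y = 0 <-> exists x, eta x = y
      & forall i y, D i.+1 y = 0 <-> exists x, D i x = y].

(* The theorem excludes Gorenstein rings: there K = R and Omega^1(K) = 0, so
   "Omega^1(K) is Ulrich" is the same for every such R (true or false, as the
   convention on the zero module goes), whereas k[[x,y]]/(xy) has minimal
   multiplicity and k[[t^3,t^4]] does not.  For regular R there is moreover
   0 -> R -> K^t -> R^(t-1) -> 0 for every t. *)
Definition gorenstein : Prop := finite_injdim R^o.

Definition canonical_module (m : set R) (K : lmodType R) : Prop :=
  [/\ max_cohen_macaulay m K, has_cm_type m K 1 & finite_injdim K].

(* L is the kernel of the first map R^n -> K of a minimal free resolution *)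
Definition first_syzygy (m : set R) (K L : lmodType R) : Prop :=
  exists (n : nat) (i : {linear L -> 'rV[R]_n}) (p : {linear 'rV[R]_n -> K}),
    short_exact i p /\ [set u | p u = 0] `<=` smul m [set: 'rV[R]_n].

Definition ulrich_cokernel (m : set R) (K : lmodType R) (t : nat) : Prop :=
  exists (D : lmodType R) (f : {linear R^o -> {ffun 'I_t -> K}})
         (g : {linear {ffun 'I_t -> K} -> D}),
    [/\ short_exact f g, max_cohen_macaulay m D & ulrich m D].

End Homological.

(* Main.v *)
Require Import Defs.
From HB Require Import structures.
From mathcomp Require Import all_boot all_order all_algebra.
From mathcomp Require Import boolp classical_sets functions cardinality.
From mathcomp Require Import ring lra zify.
Set Implicit Arguments.
Unset Strict Implicit.
Unset Printing Implicit Defensive.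
Import Order.TTheory GRing.Theory Num.Theory.
Local Open Scope classical_set_scope.
Local Open Scope ring_scope.

(* As the residue field is infinite, there is a sequence x of d generic elements
   of m that is regular on all the maximal Cohen-Macaulay modules at hand,
   generates a reduction J of m, and is part of a minimal system of generators of
   m.  Multiplicities of maximal Cohen-Macaulay modules M are then lengths of
   M / JM, so that M is Ulrich iff mM = JM, and R has minimal multiplicity iff
   m^2 <= J.
   Let l be the length of R / J and r > 1 that of its socle; r is the type of R,
   m^2 <= J iff l = r + 1, and l > r in any case.  K / JK is the injective hull of
   the residue field over R / J: it is faithful of length l, with a socle of
   length one and r generators.  This duality is read off a finite injective
   resolution E of K: going through x one element at a time, the complex
   Hom(R / J, E) is seen to have K / JK, in degree d, as its only cohomology.
   Everything else is counting lengths.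
   - For 0 -> O -> V -> K -> 0 with V = R^r, the module O is contained in mV, and
     m^2 <= J gives mO <= JV, that is, mO = JO.  Conversely mO = JO makes
     (O + JV) / JV, of length (r - 1) l, a proper part of the socle of V / JV, of
     length r^2; hence l <= r + 1.
   - For 0 -> R -> K^t -> D -> 0 with D Ulrich, m K^t is properly contained in
     R + J K^t, which gives t (l - r) < l, while the socle of R / J embeds into
     that of K^t / J K^t, which gives r <= t; hence t = r and l = r + 1.
     Conversely a map R -> K^r given by generators of K is injective modulo J by
     faithfulness, and if l = r + 1, comparing lengths shows m K^r <= R + J K^r. *)

(** * Identities in modules, by reflection *)

(** A multiplicity includes the existence of a Hilbert polynomial, and none is constructed for a
    general module. If one exists, comparing powers of m with powers of J determines its leading
    coefficient; it is exhibited only where the Hilbert function is explicit, namely for mM = JM and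
    for R with m^2 <= J. Reductions with d generators come from counting instead of from the
    dimension of the fiber cone: if more than d generators could not be shortened, their powers
    would have colengths outgrowing a bound of degree d. A quotient M / N is nearly always handled
    through the submodule N of M. Lengths are those of composition series between two submodules,
    Ext is cocycles modulo coboundaries in powers of M, and connecting maps are linear relations.
    That R is not Gorenstein enters through r > 1: a cyclic K would be isomorphic to R. The strict
    inequality r > 1 is what makes the length counts conclusive. The sequence x must be regular on D
    as well, and D is only known once it is given; so for each D a new sequence is chosen, generic
    for the product of K and D. *)

Inductive mexp (R : Type) : Type :=
| MVar of nat | MZero | MAdd of mexp R & mexp R | MOpp of mexp R
| MScale of R & mexp R.
Arguments MZero {R}.
Arguments MVar {R} n.

Section ModuleReflection.
Variables (R : comNzRingType) (M : lmodType R).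

Fixpoint mexp_eval (env : seq M) (e : mexp R) : M :=
  match e with
  | MVar n => nth 0 env n
  | MZero => 0
  | MAdd e1 e2 => mexp_eval env e1 + mexp_eval env e2
  | MOpp e1 => - mexp_eval env e1
  | MScale a e1 => a *: mexp_eval env e1
  end.

Fixpoint mexp_coef (e : mexp R) (i : nat) : R :=
  match e with
  | MVar n => if Nat.eqb n i then 1 else 0
  | MZero => 0
  | MAdd e1 e2 => mexp_coef e1 i + mexp_coef e2 i
  | MOpp e1 => - mexp_coef e1 i
  | MScale a e1 => a * mexp_coef e1 i
  end.

Lemma mexp_evalE env e :
  mexp_eval env e = \sum_(i < size env) mexp_coef e i *: nth 0 env i.
Proof.
elim: e => [n||e1 IH1 e2 IH2|e1 IH1|a e1 IH1] /=.
- have [lt_n|ge_n] := ltnP n (size env).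
    rewrite (bigD1 (Ordinal lt_n)) //= PeanoNat.Nat.eqb_refl scale1r.
    rewrite big1 ?addr0 // => i /eqP ne; case: PeanoNat.Nat.eqb_spec => [E|_].
      by case: ne; apply: val_inj.
    by rewrite scale0r.
  rewrite nth_default // big1 // => i _; case: PeanoNat.Nat.eqb_spec => [E|_].
    by move: (ltn_ord i); rewrite -E ltnNge ge_n.
  by rewrite scale0r.
- by rewrite big1 // => i _; rewrite scale0r.
- by rewrite IH1 IH2 -big_split; apply: eq_bigr => i _; rewrite scalerDl.
- by rewrite IH1 -sumrN; apply: eq_bigr => i _; rewrite scaleNr.
- by rewrite IH1 scaler_sumr; apply: eq_bigr => i _; rewrite scalerA.
Qed.

(** A recursive conjunction rather than a quantified statement, so that it computes to one ring
    identity per atom. *)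
Fixpoint mexp_coefs_eq (e1 e2 : mexp R) (k : nat) : Prop :=
  match k with
  | 0 => True
  | k'.+1 => mexp_coef e1 k' = mexp_coef e2 k' /\ mexp_coefs_eq e1 e2 k'
  end.

Lemma mexp_eq env e1 e2 : mexp_coefs_eq e1 e2 (size env) ->
  mexp_eval env e1 = mexp_eval env e2.
Proof.
move=> eq12; rewrite !mexp_evalE; apply: eq_bigr => i _; congr (_ *: _).
elim: (size env) eq12 i => [|k IH] /= => [_ []//|[eqk eqk'] i].
case: (ltnP i k) => [lt_ik|le_ki]; first exact: (IH eqk' (Ordinal lt_ik)).
suff -> : val i = k by [].
by apply/eqP; rewrite eqn_leq le_ki -ltnS ltn_ord.
Qed.

End ModuleReflection.

(* Atoms are compared up to conversion: the same vector may be displayed through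
   different structure instances. *)
Ltac mexp_mem x l :=
  lazymatch l with
  | nil => constr:(false)
  | ?y :: ?l' =>
    match constr:(Set) with
    | _ => let _ := match constr:(Set) with _ => unify x y end in constr:(true)
    | _ => mexp_mem x l'
    end
  end.

Ltac mexp_index x l :=
  lazymatch l with
  | ?y :: ?l' =>
    match constr:(Set) with
    | _ => let _ := match constr:(Set) with _ => unify x y end in constr:(0%N)
    | _ => let n := mexp_index x l' in constr:(S n)
    end
  end.

Ltac mexp_atoms e l :=
  match e with
  | @GRing.add _ ?a ?b => let l1 := mexp_atoms a l in mexp_atoms b l1
  | @GRing.opp _ ?a => mexp_atoms a l
  | @GRing.scale _ _ _ ?a => mexp_atoms a l
  | @GRing.zero _ => l
  | _ => match mexp_mem e l with
         | true => l
         | false => constr:(e :: l)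
         end
  end.

Ltac mexp_reify R e l :=
  match e with
  | @GRing.add _ ?a ?b =>
      let ea := mexp_reify R a l in let eb := mexp_reify R b l in
      constr:(@MAdd R ea eb)
  | @GRing.opp _ ?a => let ea := mexp_reify R a l in constr:(@MOpp R ea)
  | @GRing.scale _ _ ?c ?a =>
      let ea := mexp_reify R a l in constr:(@MScale R c ea)
  | @GRing.zero _ => constr:(@MZero R)
  | _ => let n := mexp_index e l in constr:(@MVar R n)
  end.

(* Proves an equality of linear combinations by comparing, with [ring], the
   coefficients of each atom. *)
Ltac module_eq R M :=
  match goal with
  | |- @eq _ ?x ?y =>
    let l0 := mexp_atoms x (@nil (GRing.Lmodule.sort M)) in
    let l := mexp_atoms y l0 in
    let ex := mexp_reify (GRing.ComNzRing.sort R) x l in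
    let ey := mexp_reify (GRing.ComNzRing.sort R) y l in
    change (mexp_eval (M := M) l ex = mexp_eval (M := M) l ey);
    apply: mexp_eq; cbn [mexp_coefs_eq mexp_coef size Nat.eqb]; repeat split; ring
  end.

(** * Submodules *)

Section SubmoduleTheory.
Variables (R : comNzRingType) (M : lmodType R).
Implicit Types (N L A B X S : set M) (I J : set R).
Local Ltac meq := module_eq R M.

(** Replaces a membership by a known one and an identity between the two elements, which [module_eq]
    or [ring] then settles. *)
Lemma eqmem (T : Type) (N : set T) x y : N x -> x = y -> N y.
Proof. by move=> Nx <-. Qed.

Lemma subm0 N : submodule N -> N 0.
Proof. by case. Qed.

Lemma submZ N a x : submodule N -> N x -> N (a *: x).
Proof. by case=> N0 NS Nx; rewrite -[_ *: x]addr0; exact: NS. Qed.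

Lemma submD N x y : submodule N -> N x -> N y -> N (x + y).
Proof. by case=> _ NS Nx Ny; rewrite -[x]scale1r; exact: NS. Qed.

Lemma submN N x : submodule N -> N x -> N (- x).
Proof. by move=> sN Nx; rewrite -scaleN1r; exact: submZ. Qed.

Lemma submB N x y : submodule N -> N x -> N y -> N (x - y).
Proof. by move=> sN Nx Ny; apply: submD => //; exact: submN. Qed.

Lemma subm_sum N (I : Type) (r : seq I) (P : pred I) (F : I -> M) :
  submodule N -> (forall i, P i -> N (F i)) -> N (\sum_(i <- r | P i) F i).
Proof.
by move=> sN NF; elim/big_rec: _ => [|i x Pi Nx]; [exact: subm0|exact: submD (NF _ Pi) Nx].
Qed.

Lemma submBr N x y : submodule N -> N x -> N (x - y) -> N y.
Proof. by move=> sN Nx Nxy; apply: eqmem (submB sN Nx Nxy) _; meq. Qed.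

Lemma submBl N x y : submodule N -> N y -> N (x - y) -> N x.
Proof. by move=> sN Nx Nxy; apply: eqmem (submD sN Nx Nxy) _; meq. Qed.

Lemma submBC N x y : submodule N -> N (x - y) -> N (y - x).
Proof. by move=> sN Nxy; apply: eqmem (submN sN Nxy) _; meq. Qed.

Lemma submodule_setI A B : submodule A -> submodule B -> submodule (A `&` B).
Proof.
move=> [A0 AS] [B0 BS]; split=> // a x y [Ax Bx] [Ay By].
by split; [exact: AS|exact: BS].
Qed.

Lemma submodule_setT : submodule [set: M].
Proof. by []. Qed.

Lemma submodule_set0 : submodule [set (0 : M)].
Proof. by split=> // a x y -> ->; rewrite scaler0 addr0. Qed.

Definition adj N b : set M := [set y | exists a, N (y - a *: b)].

Lemma submodule_adj N b : submodule N -> submodule (adj N b).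
Proof.
move=> sN; split; first by exists 0; rewrite scale0r subr0; exact: subm0.
move=> c x y [a Na] [a' Na']; exists (c * a + a').
by apply: eqmem (submD sN (submZ c sN Na) Na') _; meq.
Qed.

Lemma sub_adj N b : N `<=` adj N b.
Proof. by move=> y Ny; exists 0; rewrite scale0r subr0. Qed.

Lemma mem_adj N b : submodule N -> adj N b b.
Proof. by move=> sN; exists 1; rewrite scale1r subrr; exact: subm0. Qed.

Lemma adj_min N b X : submodule X -> N `<=` X -> X b -> adj N b `<=` X.
Proof.
move=> sX NX Xb y [a Na]; apply: submBl (NX _ Na) => //; exact: submZ.
Qed.

Definition addm N L : set M := [set y | exists2 u, L u & N (y - u)].

Lemma submodule_addm N L : submodule N -> submodule L -> submodule (addm N L).
Proof.
move=> sN sL; split; first by exists 0; rewrite ?subr0; exact: subm0.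
move=> c x y [u Lu Nu] [v Lv Nv]; exists (c *: u + v).
  by apply: submD => //; exact: submZ.
by apply: eqmem (submD sN (submZ c sN Nu) Nv) _; meq.
Qed.

Lemma sub_addml N L : submodule L -> N `<=` addm N L.
Proof. by move=> sL y Ny; exists 0; [exact: subm0|rewrite subr0]. Qed.

Lemma sub_addmr N L : submodule N -> L `<=` addm N L.
Proof. by move=> sN y Ly; exists y => //; rewrite subrr; exact: subm0. Qed.

Lemma addm_min N L X : submodule X -> N `<=` X -> L `<=` X -> addm N L `<=` X.
Proof. by move=> sX NX LX y [u Lu Nu]; apply: submBl (NX _ Nu) => //; exact: LX. Qed.

Lemma addm_mono N L N' L' : N `<=` N' -> L `<=` L' -> addm N L `<=` addm N' L'.
Proof. by move=> NN LL y [u Lu Nu]; exists u; [exact: LL|exact: NN]. Qed.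

Lemma addm_absorb N L : submodule N -> submodule L -> L `<=` N -> addm N L = N.
Proof.
by move=> sN sL LN; apply/seteqP; split; [exact: addm_min|exact: sub_addml].
Qed.

Fixpoint spans (s : seq M) : set M :=
  if s is v :: s' then adj (spans s') v else [set 0].

Lemma submodule_spans s : submodule (spans s).
Proof.
by elim: s => [|v s IH] /=; [exact: submodule_set0|exact: submodule_adj].
Qed.

Lemma mem_spans (s : seq M) v : v \in s -> spans s v.
Proof.
elim: s => [//|w s IH] /=; rewrite in_cons => /orP[/eqP ->|/IH].
  exact/mem_adj/submodule_spans.
exact: sub_adj.
Qed.

Lemma spans_min (s : seq M) X : submodule X -> (forall v, v \in s -> X v) ->
  spans s `<=` X.
Proof.
move=> sX; elim: s => [|w s IH] /= Xs; first by move=> _ ->; exact: subm0.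
apply: adj_min => //; last by apply: Xs; rewrite mem_head.
by apply: IH => v vs; apply: Xs; rewrite in_cons vs orbT.
Qed.

Lemma spansS (s t : seq M) : {subset s <= t} -> spans s `<=` spans t.
Proof.
move=> st; apply: spans_min; first exact: submodule_spans.
by move=> v /st; exact: mem_spans.
Qed.

Lemma submodule_span S : submodule (Defs.span S).
Proof.
split.
  by exists 0%N, (fun=> 0), (fun=> 0); split; [case|rewrite big_ord0].
move=> c x y [n [a [v [Sv ->]]]] [n' [a' [v' [Sv' ->]]]].
exists (n + n')%N, (fun i => match fintype.split i with inl j => c * a j | inr j => a' j end).
exists (fun i => match fintype.split i with inl j => v j | inr j => v' j end).
split; first by move=> i; case: (fintype.split i).
rewrite big_split_ord /= scaler_sumr; congr (_ + _); apply: eq_bigr => i _.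
  by rewrite (unsplitK (inl i)) scalerA.
by rewrite (unsplitK (inr i)).
Qed.

Lemma mem_span S v : S v -> Defs.span S v.
Proof.
move=> Sv; exists 1%N, (fun=> 1), (fun=> v); split=> //.
by rewrite big_ord1 scale1r.
Qed.

Lemma span_min S X : submodule X -> S `<=` X -> Defs.span S `<=` X.
Proof.
move=> sX SX _ [n [a [v [Sv ->]]]]; apply: subm_sum => // i _.
by apply: submZ => //; exact: SX.
Qed.

Lemma generated_byP N n :
  generated_by N n <-> exists2 s, size s = n & N = spans s.
Proof.
have gen_eq (m : nat) (v : 'I_m -> M) : Defs.span (range v) = spans [seq v i | i <- enum 'I_m].
  apply/seteqP; split.
    apply: span_min; first exact: submodule_spans.
    by move=> _ [i _ <-]; apply: mem_spans; apply: map_f; rewrite mem_enum.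
  apply: spans_min; first exact: submodule_span.
  by move=> _ /mapP[i _ ->]; apply: mem_span; exists i.
split=> [[v ->]|[s <- ->]].
  exists [seq v i | i <- enum 'I_n]; first by rewrite size_map size_enum_ord.
  exact: gen_eq.
exists (fun i => nth 0 s i); rewrite gen_eq; congr spans.
rewrite -[LHS](mkseq_nth 0) /mkseq -val_enum_ord -map_comp.
exact: eq_map.
Qed.

(** The submodule [s_1 L + ... + s_k L]. *)
Fixpoint msq (s : seq R) L : set M :=
  if s is a :: s' then [set y | exists2 u, L u & msq s' L (y - a *: u)]
  else [set 0].

Lemma submodule_msq s L : submodule L -> submodule (msq s L).
Proof.
move=> sL; elim: s => [|a s IH] /=; first exact: submodule_set0.
split; first by exists 0; rewrite ?scaler0 ?subr0; exact: subm0.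
move=> c x y [u Lu Nu] [v Lv Nv]; exists (c *: u + v).
  by apply: submD => //; exact: submZ.
by apply: eqmem (submD IH (submZ c IH Nu) Nv) _; meq.
Qed.

Lemma mem_msq (s : seq R) L a y : submodule L -> a \in s -> L y -> msq s L (a *: y).
Proof.
move=> sL; elim: s => [//|b s IH] /=; rewrite in_cons => /orP[/eqP ->|/IH sy] Ly.
  by exists y => //; rewrite subrr; apply: subm0; exact: submodule_msq.
exists 0; first exact: subm0.
  by rewrite scaler0 subr0; exact: sy.
Qed.

Lemma msq_min (s : seq R) L X : submodule X ->
  (forall a y, a \in s -> L y -> X (a *: y)) -> msq s L `<=` X.
Proof.
move=> sX; elim: s => [|a s IH] /= Xs; first by move=> _ ->; exact: subm0.
move=> y [u Lu yu]; apply: submBl (IH _ _ yu) => //.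
  by apply: Xs => //; rewrite mem_head.
by move=> b z bs; apply: Xs; rewrite in_cons bs orbT.
Qed.

Lemma msqS (s t : seq R) L L' : submodule L' -> {subset s <= t} -> L `<=` L' ->
  msq s L `<=` msq t L'.
Proof.
move=> sL' st LL; apply: msq_min; first exact: submodule_msq.
by move=> a y /st at_ /LL; exact: mem_msq.
Qed.

Lemma msq_sub (s : seq R) L : submodule L -> msq s L `<=` L.
Proof. by move=> sL; apply: msq_min => // a y _; exact: submZ. Qed.

Lemma submodule_smul I L : submodule (smul I L).
Proof. exact: submodule_span. Qed.

Lemma mem_smul I L a y : I a -> L y -> smul I L (a *: y).
Proof. by move=> Ia Ly; apply: mem_span; exists a => //; exists y. Qed.

Lemma smul_min I L X : submodule X -> (forall a y, I a -> L y -> X (a *: y)) ->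
  smul I L `<=` X.
Proof. by move=> sX XIL; apply: span_min => // _ [a Ia [y Ly <-]]; exact: XIL. Qed.

Lemma smulS I J L L' : I `<=` J -> L `<=` L' -> smul I L `<=` smul J L'.
Proof.
move=> IJ LL; apply: smul_min; first exact: submodule_smul.
by move=> a y /IJ Ja /LL; exact: mem_smul.
Qed.

Lemma smul_sub I L : submodule L -> smul I L `<=` L.
Proof. by move=> sL; apply: smul_min => // a y _; exact: submZ. Qed.

Lemma smul_seq (s : seq R) L : submodule L -> smul [set a | a \in s] L = msq s L.
Proof.
move=> sL; apply/seteqP; split.
  by apply: smul_min => [|a y]; [exact: submodule_msq|exact: mem_msq].
by apply: msq_min => [|a y]; [exact: submodule_smul|exact: mem_smul].
Qed.

End SubmoduleTheory.

(** * Noetherian modules and Nakayama's lemma *)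

Definition noeth (R : comNzRingType) (M : lmodType R) : Prop :=
  forall N : set M, submodule N -> exists s : seq M, N = spans s.

Section Noetherian.
Variables (R : comNzRingType) (M : lmodType R).
Implicit Types (N L A B X S : set M) (I J : set R).
Local Ltac meq := module_eq R M.

Lemma noetherian_noeth : noetherian R -> noeth R^o.
Proof.
by move=> nR N /nR [n /generated_byP [s _ ->]]; exists s.
Qed.

Lemma spans_cat (s t : seq M) x y : spans s x -> spans t y -> spans (s ++ t) (x + y).
Proof.
move=> sx ty; apply: submD; first exact: submodule_spans.
  by apply: (@spansS _ _ s) sx => z zs; rewrite mem_cat zs.
by apply: (@spansS _ _ t) ty => z zs; rewrite mem_cat zs orbT.
Qed.

(** Induction on the generators: the coefficients at [v] of the elements of N form an ideal. Lifts
    to N of generators of this ideal, together with generators of the part of N inside the span of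
    the remaining vectors, generate N. *)
Lemma spans_noeth (s : seq M) N : noetherian R -> submodule N -> N `<=` spans s ->
  exists t, N = spans t.
Proof.
move=> nR; elim: s N => [|v s IH] N sN Ns.
  exists [::]; apply/seteqP; split=> //= y ->; exact: subm0.
pose I : set R^o := [set a | exists2 y, N y & spans s (y - a *: v)].
have ss := submodule_spans s.
have sI : submodule I.
  split; first by exists 0; rewrite ?scale0r ?subr0; exact: subm0.
  move=> c a b [y Ny ya] [z Nz zb]; exists (c *: y + z).
    by apply: submD => //; exact: submZ.
  apply: eqmem (submD ss (submZ c ss ya) zb) _.
  rewrite -[c *: (a : R^o)]/(c * a : R); meq.
have [l Il] := noetherian_noeth nR sI.
have Il' a : a \in l -> I a by rewrite Il; exact: mem_spans.
have [ys ysN ysP] : exists2 ys : seq M, (forall y, y \in ys -> N y) &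
    forall a, spans l a -> exists2 y, spans ys y & spans s (y - a *: v).
  elim: (l) Il' => [|a l' IHl] Il'.
    exists [::] => // _ ->; exists 0 => //; rewrite scale0r subr0; exact: subm0.
  have [|ys ysN ysP] := IHl; first by move=> b bl; apply: Il'; rewrite inE bl orbT.
  have [y Ny ya] := Il' a (mem_head _ _).
  exists (y :: ys) => [z|b [c /ysP [z ysz bz]]].
    by rewrite inE => /orP[/eqP -> //|]; exact: ysN.
  exists (c *: y + z).
    by exists c; apply: eqmem ysz _; meq.
  apply: eqmem (submD ss (submZ c ss ya) bz) _.
  rewrite -[c *: (a : R^o)]/(c * a : R); meq.
have [||t Nt] := IH (N `&` spans s); first exact: submodule_setI.
  by move=> y [].
exists (ys ++ t); apply/seteqP; split=> [y Ny|].
  have [a ya] := Ns y Ny.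
  have [|z ysz za] := ysP a; first by rewrite -Il; exists y.
  have Nz : N z by apply: (spans_min sN) ysz.
  rewrite -[y](subrK z) addrC; apply: spans_cat => //; rewrite -Nt; split.
    exact: submB.
  by apply: eqmem (submB ss ya za) _; meq.
apply: spans_min => // y; rewrite mem_cat => /orP[/ysN //|/mem_spans].
by rewrite -Nt => -[].
Qed.

Lemma fin_genP : fin_gen M <-> exists s : seq M, spans s = setT.
Proof.
split=> [[n /generated_byP [s _ Es]]|[s sT]]; first by exists s.
by exists (size s); apply/generated_byP; exists s.
Qed.

Lemma fin_gen_noeth : noetherian R -> fin_gen M -> noeth M.
Proof.
move=> nR /fin_genP [s sT] N sN.
by apply: (@spans_noeth s) => // y _; rewrite sT.
Qed.

(** Otherwise choice gives a strictly ascending sequence of members of F above [X0]. Its union is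
    finitely generated, hence equal to one of its terms. *)
Lemma noeth_max (F : set M -> Prop) X0 : noeth M ->
  (forall X, F X -> submodule X) -> F X0 ->
  exists X, [/\ F X, X0 `<=` X & forall Y, F Y -> X `<=` Y -> Y = X].
Proof.
move=> nM sF F0; apply: contrapT => noX.
have [f fP] : {f : set M -> set M & forall X, F X -> X0 `<=` X ->
    [/\ F (f X), X `<=` f X & f X <> X]}.
  apply: (@choice _ _ (fun X Y => F X -> X0 `<=` X -> [/\ F Y, X `<=` Y & Y <> X])).
  move=> X; have [[FX X0X]|nFX] := pselect (F X /\ X0 `<=` X); last first.
    by exists X => FX X0X; case: nFX.
  apply: contrapT => noY; apply: noX; exists X; split=> // Y FY XY.
  by apply: contrapT => YX; apply: noY; exists Y.
pose c i := iter i f X0.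
have cP i : F (c i) /\ X0 `<=` c i.
  elim: i => [|i [Fc Xc]] /=; first by split.
  by have [Ff cf _] := fP _ Fc Xc; split=> //; exact: subset_trans cf.
have cS i : c i `<=` c i.+1 by have [Fc Xc] := cP i; have [] := fP _ Fc Xc.
have cM i j : (i <= j)%N -> c i `<=` c j.
  move=> /subnK <-; elim: (j - i)%N => [//|k IH].
  by apply: subset_trans IH _; exact: cS.
pose U : set M := [set y | exists i, c i y].
have sU : submodule U.
  split; first by exists 0%N; apply: subm0; exact: sF.
  move=> a x y [i ci] [j cj]; exists (i + j)%N.
  have sc := sF _ (cP (i + j)%N).1.
  apply: submD => //; first by apply: submZ => //; apply: cM ci; exact: leq_addr.
  by apply: cM cj; exact: leq_addl.
have [s Us] := nM U sU.
have [k ck] : exists k, forall y, y \in s -> c k y.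
  have : forall y, y \in s -> U y by rewrite Us; exact: mem_spans.
  elim: (s) => [|v s' IH] sU'; first by exists 0%N.
  have [k ck] := IH (fun y ys => sU' y (etrans (in_cons _ _ _) (introT orP (or_intror ys)))).
  have [j cj] := sU' v (mem_head _ _).
  exists (j + k)%N => y; rewrite inE => /orP[/eqP ->|/ck cy].
    by apply: cM cj; exact: leq_addr.
  by apply: cM cy; exact: leq_addl.
have [Fc Xc] := cP k; have [_ _] := fP _ Fc Xc; apply.
apply/seteqP; split; last exact: cS.
have : U `<=` c k by rewrite Us; apply: spans_min => //; exact: sF.
by move=> Uk y ?; apply: Uk; exists k.+1.
Qed.

End Noetherian.

Section LocalRing.
Variables (R : comNzRingType) (m : set R).
Hypothesis locR : noetherian_local m.

Lemma noeth_ring : noeth R^o.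
Proof. by apply: noetherian_noeth; case: locR. Qed.

Lemma ideal_max : @submodule R R^o m.
Proof. by case: locR => _ []. Qed.

Lemma max_not1 : ~ m 1.
Proof. by case: locR => _ []. Qed.

Lemma ideal_sub_max (I : set R) : @submodule R R^o I -> ~ I 1 -> I `<=` m.
Proof.
move=> sI I1; have [X [[sX X1] IX Xmax]] := @noeth_max _ R^o
  (fun X => @submodule R R^o X /\ ~ X 1) I noeth_ring (fun X => @proj1 _ _) (conj sI I1).
have XE : X = m.
  by case: locR => _ _; apply; split=> // Y sY Y1 /(Xmax _ (conj sY Y1)).
by rewrite -XE.
Qed.

Lemma max_unit (a : R) : ~ m a -> exists b, b * a = 1.
Proof.
move=> ma; apply: contrapT => noinv; apply: ma.
apply: (@ideal_sub_max (@adj R R^o [set 0] a)).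
- exact/submodule_adj/submodule_set0.
- by move=> [b /eqP]; rewrite subr_eq0 => /eqP E; apply: noinv; exists b.
- exact/mem_adj/submodule_set0.
Qed.

Lemma max_unit1B (a : R) : m a -> exists b, b * (1 - a) = 1.
Proof.
move=> ma; apply: max_unit => m1a; apply: max_not1.
by apply: eqmem (submD ideal_max m1a ma) _; rewrite subrK.
Qed.

Lemma max_mul (a b : R) : m b -> m (a * b).
Proof. exact: (submZ a ideal_max). Qed.

Section Nakayama.
Variable M : lmodType R.
Implicit Types (N L A B X S : set M) (I J : set R).
Local Ltac meq := module_eq R M.

Lemma submZ_unit N a x : submodule N -> ~ m a -> N (a *: x) -> N x.
Proof.
move=> sN /max_unit [b ba] /(submZ b sN).
by rewrite scalerA ba scale1r.
Qed.

(** If L is not inside N, take X maximal among the submodules containing the intersection of N and L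
    but not L. Maximality and the invertibility of 1 - a for a in m force mL <= X, and then L <= N +
    mL puts L inside X. *)
Lemma Nakayama N L : noeth M -> submodule N -> submodule L ->
  L `<=` addm N (smul m L) -> L `<=` N.
Proof.
move=> nM sN sL Lm; apply: contrapT => LN.
have [y Ly Ny] : exists2 y, L y & ~ N y.
  by apply: contrapT => noy; apply: LN => y Ly; apply: contrapT => Ny; apply: noy; exists y.
pose F X := [/\ submodule X, N `&` L `<=` X & exists2 z, L z & ~ X z].
have F0 : F (N `&` L).
  by split; [exact: submodule_setI| |exists y => // -[]].
have [X [[sX XL X1] NX Xmax]] := noeth_max nM (fun X (h : F X) => let: And3 sX _ _ := h in sX) F0.
have mLX a z : m a -> L z -> X (a *: z).
  move=> ma Lz; apply: contrapT => Xaz.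
  have adjL w : L w -> adj X (a *: z) w.
    move=> Lw; apply: contrapT => nw; apply: Xaz.
    rewrite -(Xmax (adj X (a *: z))); first exact: mem_adj.
      split; [exact: submodule_adj|by apply: subset_trans XL _; exact: sub_adj|].
      by exists w.
    exact: sub_adj.
  have [c] := adjL z Lz; rewrite scalerA => Xz; apply: Xaz.
  apply: submZ => //.
  have [b bE] := max_unit1B (max_mul c ma).
  by apply: eqmem (submZ b sX Xz) _; rewrite -[RHS]scale1r -bE; meq.
have [z Lz Xz] := X1; apply: Xz; have [u Lu Nzu] := Lm z Lz.
have Xu : (X `&` L) u.
  have sXL := submodule_setI sX sL.
  by apply: smul_min Lu => // a w ma Lw; split; [exact: mLX|exact: submZ].
by apply: submBl Xu.1 _ => //; apply: XL; split=> //; exact: submB Xu.2.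
Qed.

(** The element is found in the last of the modules L, mL, m^2 L, ... that is not contained in X. *)
Lemma socle_exists L X k : submodule L -> submodule X ->
  iter k (smul m) L `<=` X -> ~ (L `<=` X) ->
  exists b, [/\ L b, ~ X b & forall a, m a -> X (a *: b)].
Proof.
move=> + sX; elim: k L => [|k IH] L sL //; rewrite iterSr => Xk LX.
have [mLX|mLX] := pselect (smul m L `<=` X).
  have [b Lb Xb] : exists2 y, L y & ~ X y.
    by apply: contrapT => noy; apply: LX => y Ly; apply: contrapT => Xy; apply: noy; exists y.
  by exists b; split=> // a ma; apply: mLX; exact: mem_smul.
have [b [Lb Xb mb]] := IH _ (submodule_smul _ _) Xk mLX; exists b; split=> //.
exact: smul_sub Lb.
Qed.

End Nakayama.
End LocalRing.

(** * Length *)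

Section Length.
Variables (R : comNzRingType) (m : set R).
Hypothesis locR : noetherian_local m.

Section OneModule.
Variable M : lmodType R.
Implicit Types (N L A B X P Q : set M).
Local Ltac meq := module_eq R M.

(** Says that L / N is isomorphic to R / m, generated by the class of [b]; [clen] below chains such
    steps into composition series. *)
Definition step N L : Prop :=
  exists b, [/\ submodule N, ~ N b, forall a, m a -> N (a *: b) & L = adj N b].

Fixpoint clen N L (n : nat) : Prop :=
  if n is n'.+1 then exists2 N', step N N' & clen N' L n'
  else submodule N /\ N = L.

Lemma clen_submod N L n : clen N L n -> [/\ submodule N, submodule L & N `<=` L].
Proof.
elim: n N => [|n IH] N /= => [[sN <-]|[_ [b [sN _ _ ->]] /IH [_ sL NL]]].
  by split.
by split=> //; apply: subset_trans NL; exact: sub_adj.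
Qed.

Lemma clen_cat N L P p q : clen N L p -> clen L P q -> clen N P (p + q).
Proof.
elim: p N => [|p IH] N /= => [[_ <-] //|[N' NN' N'L] LP].
by exists N' => //; exact: IH.
Qed.

Lemma clen1 N L : step N L -> clen N L 1.
Proof.
by move=> NL; exists L => //; case: NL => b [sN _ _ ->]; split=> //; exact: submodule_adj.
Qed.

Lemma clen_rcons N L L' n : clen N L n -> step L L' -> clen N L' n.+1.
Proof. by move=> NL /clen1 LL'; rewrite -addn1; exact: clen_cat LL'. Qed.

Lemma step_neq N L : step N L -> N <> L.
Proof. by move=> [b [sN Nb _ LE]] NL; apply: Nb; rewrite NL LE; exact: mem_adj. Qed.

Lemma clen_neq N L n : clen N L n.+1 -> N <> L.
Proof.
move=> [N' [b [sN Nb _ ->]] /clen_submod [_ _ NL]] E; apply: Nb; rewrite E.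
by apply: NL; exact: mem_adj.
Qed.

End OneModule.

Section Transport.
Variables (M M' : lmodType R) (f : {linear M -> M'}).
Implicit Types (A B X : set M) (N P Q : set M').

Lemma submodule_image A : submodule A -> submodule (f @` A).
Proof.
move=> sA; split; first by exists 0; [exact: subm0|rewrite linear0].
move=> a _ _ [x Ax <-] [y Ay <-]; exists (a *: x + y); last by rewrite linearP.
by apply: submD => //; exact: submZ.
Qed.

Lemma submodule_preimage P : submodule P -> submodule (f @^-1` P).
Proof.
move=> sP; split=> [|a x y Px Py]; rewrite /preimage /=; first by rewrite linear0; exact: subm0.
by rewrite linearP; apply: submD => //; exact: submZ.
Qed.

Lemma clen_image A B X N n : submodule N -> submodule X -> B `<=` X ->
  X `&` f @^-1` N `<=` A -> clen A B n ->
  clen (addm N (f @` A)) (addm N (f @` B)) n.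
Proof.
move=> sN sX BX; elim: n A => [|n IH] A XA /= => [[sA <-]|[_ [b [sA Ab mb ->]] AB]].
  by split=> //; apply: submodule_addm => //; exact: submodule_image.
have [sA' sB A'B] := clen_submod AB.
have sfA := submodule_image sA; have sNA := submodule_addm sN sfA.
exists (addm N (f @` adj A b)); last first.
  by apply: IH => //; apply: subset_trans XA _; exact: sub_adj.
have Xb : X b by apply/BX/A'B; exact: mem_adj.
have AX : A `<=` X by apply: subset_trans BX; apply: subset_trans A'B; exact: sub_adj.
exists (f b); split=> //.
- move=> [_ [a Aa <-] Nba]; apply: Ab; rewrite -[b](subrK a); apply: submD => //.
  by apply: XA; split; [apply: submB => //; exact: AX|rewrite /preimage /= linearB].
- move=> a /mb Aab; apply: sub_addmr => //.
  by exists (a *: b) => //; rewrite linearZ.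
apply/seteqP; split.
  apply: addm_min.
  - by apply: submodule_adj.
  - by move=> y Ny; apply: sub_adj; apply: sub_addml.
  - move=> _ [y [a ya] <-]; exists a; rewrite -linearZ -linearB.
    by apply: sub_addmr => //; exists (y - a *: b).
apply: adj_min.
- by apply: submodule_addm => //; apply: submodule_image.
- by apply: addm_mono => // _ [y Ay <-]; exists y => //; exact: sub_adj.
- by apply: sub_addmr => //; exists b => //; exact: mem_adj.
Qed.

(** Every class of Q / P has a representative in the image of X, so each generator of a simple
    factor can be lifted to X. *)
Lemma clen_preimage P Q X n : submodule X -> Q `<=` addm P (f @` X) ->
  clen P Q n -> clen (X `&` f @^-1` P) (X `&` f @^-1` Q) n.
Proof.
move=> sX; elim: n P => [|n IH] P QX /= => [[sP <-]|[_ [b [sP Pb mb ->]] PQ]].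
  by split=> //; apply: submodule_setI => //; exact: submodule_preimage.
have [sP' sQ P'Q] := clen_submod PQ.
have Qb : Q b by apply/P'Q/mem_adj.
have [_ [x Xx <-] Pbx] := QX _ Qb.
exists (X `&` f @^-1` (adj P b)); last first.
  apply: IH => //; apply: subset_trans QX _; apply: addm_mono => //; exact: sub_adj.
have sXP : submodule (X `&` f @^-1` P).
  by apply: submodule_setI => //; exact: submodule_preimage.
have adjE a y : P (y - a *: b) <-> P (y - a *: f x).
  have -> : y - a *: f x = (y - a *: b) + a *: (b - f x) by module_eq R M'.
  split=> [Py|Py]; first by apply: submD => //; exact: submZ.
  by rewrite -[_ - _](addrK (a *: (b - f x))); apply: submB => //; exact: submZ.
exists x; split=> //.
- by move=> [_ Pfx]; apply: Pb; exact: submBl sP Pfx Pbx.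
- move=> a ma; split; first exact: submZ.
  rewrite /preimage /= linearZZ; have := (adjE a 0).1; rewrite !sub0r => h.
  rewrite -[_ *: _]opprK; apply: submN => //; apply: h; apply: submN => //; exact: mb.
apply/seteqP; split=> [y [Xy [a /adjE Pya]]|y [a [Xya Pya]]].
  exists a; split; first by apply: submB => //; exact: submZ.
  by rewrite /preimage /= linearB linearZ.
split; first by rewrite -[y](subrK (a *: x)); apply: submD => //; exact: submZ.
by exists a; apply/adjE; rewrite -linearZ -linearB.
Qed.

End Transport.

Section LengthTheory.
Variable M : lmodType R.
Implicit Types (N L A B X P Q : set M).
Local Ltac meq := module_eq R M.

Lemma clen_setI P Q X n : submodule X -> Q `<=` addm P X -> clen P Q n ->
  clen (X `&` P) (X `&` Q) n.
Proof.
move=> sX QX /(clen_preimage (f := idfun) sX).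
by rewrite image_id; exact.
Qed.

(** If the first generator [b] lies in X, it starts the part below X. Otherwise X meets N + Rb in N
    only: the rest of the series is split at X + Rb, its lower part is intersected with X, and X <=
    X + Rb is a step of the upper part. *)
Lemma clen_split N L X n : clen N L n -> submodule X -> N `<=` X -> X `<=` L ->
  exists p q, [/\ (p + q)%N = n, clen N X p & clen X L q].
Proof.
elim: n N X => [|n IH] N X /=.
  move=> [sN <-] sX NX XN; exists 0%N, 0%N; split=> //=.
    by split=> //; apply/seteqP; split.
  by split=> //; apply/seteqP; split.
move=> [_ [b [sN Nb mb ->]] N'L] sX NX XL.
have sN' := submodule_adj b sN.
have [Xb|Xb] := pselect (X b).
  have [|p [q [<- N'X XL']]] := IH _ X N'L sX _ XL; first exact: adj_min.
  exists p.+1, q; split=> //.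
  by exists (adj N b) => //; exists b.
have [_ sL N'L'] := clen_submod N'L.
have sX' := submodule_adj b sX.
have [|||p [q [<- N'X XL']]] := IH _ (adj X b) N'L; first by [].
- by apply: adj_min => //; [apply: subset_trans NX _; exact: sub_adj|exact: mem_adj].
- by apply: adj_min => //; apply: N'L'; exact: mem_adj.
have stepX : step X (adj X b) by exists b; split=> // a /mb; exact: NX.
exists p, q.+1; split; rewrite ?addnS //; last by exists (adj X b).
have : adj X b `<=` addm (adj N b) X.
  apply: adj_min; first exact: submodule_addm.
    exact: sub_addmr.
  by apply: sub_addml => //; exact: mem_adj.
move=> /(clen_setI sX) /(_ N'X).
have -> : X `&` adj X b = X by apply/seteqP; split=> [y []//|y Xy]; split=> //; exact: sub_adj.
suff -> : X `&` adj N b = N by [].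
apply/seteqP; split=> [y [Xy [a Na]]|y Ny]; last by split; [exact: NX|exact: sub_adj].
apply: submBl (Na) => //; apply: mb; apply: contrapT => ma; apply: Xb.
by apply: (submZ_unit locR sX ma); exact: submBr Xy (NX _ Na).
Qed.

(** The theorem of Jordan and Hoelder: the second series is split at the first term of the first
    one, and a simple module has only composition series of length one. *)
Lemma clen_uniq N L p q : clen N L p -> clen N L q -> p = q.
Proof.
elim: p N q => [|p IH] N q /=.
  by move=> [sN <-]; case: q => // q /clen_neq.
move=> [N' NN' N'L]; case: q => [/= [sN NL]|q NLq].
  by have /clen_neq : clen N L p.+1 by exists N'.
have [sN sN' N'N] := clen_submod (clen1 NN').
have [_ _ N'L'] := clen_submod N'L.
have [r [t [rt Nr /(IH _ _ N'L) tp]]] := clen_split NLq sN' N'N N'L'.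
suff r1 : r = 1%N by lia.
case: r Nr {rt} => [[_ NE]|[//|r]]; first by case: (step_neq NN').
move=> [N1 NN1 N1N']; have {}N1N' : clen N1 N' r.+1 := N1N'.
have [_ _ N1N] := clen_submod N1N'.
case: (clen_neq N1N'); apply/seteqP; split=> //.
case: NN1 N1N => c [_ Nc _ ->] N1N.
case: NN' N1N => b [_ _ mb ->] /(_ c (mem_adj c sN)) [a ca].
apply: adj_min; [exact: submodule_adj|exact: sub_adj|].
apply: (@submZ_unit _ _ locR _ _ a); first exact: submodule_adj.
  by move=> /mb Nab; apply: Nc; exact: submBl Nab ca.
by exists 1; apply: eqmem (submN sN ca) _; meq.
Qed.

Definition flen N L : Prop := exists n, clen N L n.

(** Meaningful under [flen]; without a composition series the value is the default 0. *)
Definition len N L : nat := xget 0%N [set n | clen N L n].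

Lemma clen_len N L n : clen N L n -> len N L = n.
Proof.
move=> NL; apply: clen_uniq (NL); exact: (@xgetPex _ 0%N [set k | clen N L k] (ex_intro _ n NL)).
Qed.

Lemma flen_clen N L : flen N L -> clen N L (len N L).
Proof. by move=> [n NL]; rewrite (clen_len NL). Qed.

Lemma flen_submod N L : flen N L -> [/\ submodule N, submodule L & N `<=` L].
Proof. by move=> [n /clen_submod]. Qed.

Lemma len_add N X L : flen N L -> submodule X -> N `<=` X -> X `<=` L ->
  [/\ flen N X, flen X L & len N L = len N X + len X L]%N.
Proof.
move=> [n NL] sX NX XL; have [p [q [_ NXp XLq]]] := clen_split NL sX NX XL.
split; [by exists p|by exists q|].
by rewrite (clen_len NXp) (clen_len XLq) (clen_len (clen_cat NXp XLq)).
Qed.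

Lemma len_cat N X L : flen N X -> flen X L ->
  flen N L /\ len N L = (len N X + len X L)%N.
Proof.
move=> [p NX] [q XL]; have NL := clen_cat NX XL; split; first by exists (p + q)%N.
by rewrite (clen_len NX) (clen_len XL) (clen_len NL).
Qed.

Lemma len0_eq N L : flen N L -> len N L = 0%N -> N = L.
Proof. by move=> /flen_clen + E; rewrite E => -[]. Qed.

Lemma len_self N : submodule N -> flen N N /\ len N N = 0%N.
Proof.
by move=> sN; have h : clen N N 0 by []; split; [exists 0%N|exact: clen_len].
Qed.

Lemma len_gt0 N L : flen N L -> ~ (L `<=` N) -> (0 < len N L)%N.
Proof.
move=> fNL LN; rewrite lt0n; apply/eqP => /(len0_eq fNL) E.
by apply: LN; rewrite E.
Qed.

Lemma len_lt N X L : flen N L -> submodule X -> N `<=` X -> X `<=` L -> ~ (L `<=` X) ->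
  (len N X < len N L)%N.
Proof.
move=> fNL sX NX XL LX; have [_ fXL ->] := len_add fNL sX NX XL.
by rewrite -addn1 leq_add2l len_gt0.
Qed.

(** A maximal X between N and L with X / N of finite length must be L, since a socle element of L /
    X would add one more step. *)
Lemma flen_noeth N L k : noeth M -> submodule N -> submodule L -> N `<=` L ->
  iter k (smul m) L `<=` N -> flen N L.
Proof.
move=> nM sN sL NL mL.
pose F X := [/\ submodule X, N `<=` X, X `<=` L & flen N X].
have F0 : F N by split=> //; exists 0%N.
have [X [[sX NX XL fX] _ Xmax]] :=
  noeth_max nM (fun X (h : F X) => let: And4 sX _ _ _ := h in sX) F0.
suff LX : L `<=` X by have -> : L = X by apply/seteqP; split.
apply: contrapT => LX.
have [b [Lb Xb mb]] := socle_exists sL sX (subset_trans mL NX) LX.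
apply: (Xb); rewrite -(Xmax (adj X b)); [exact: mem_adj| |exact: sub_adj].
split=> //.
- exact: submodule_adj.
- by apply: subset_trans NX _; exact: sub_adj.
- exact: adj_min.
case: fX => n NXn; exists n.+1; apply: clen_rcons NXn _; by exists b.
Qed.

(** Links the longest chains used in the definition of multiplicity with composition series: [len]
    grows strictly along a chain, and a composition series is itself a chain. *)
Lemma has_colengthP N n : submodule N -> flen N setT ->
  has_colength N n <-> len N setT = n.
Proof.
move=> sN fN.
have chain_le (c : nat -> set M) k :
    (forall i, (i <= k)%N -> submodule (c i) /\ N `<=` c i) ->
    (forall i, (i < k)%N -> c i `<` c i.+1) -> (k <= len N setT)%N.
  move=> cP cS; suff : (k <= len N (c k))%N.
    have [sc Nc] := cP k (leqnn k).
    by have [_ _ ->] := len_add fN sc Nc (@subsetT _ _); lia.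
  have : (k <= k)%N by [].
  elim: {-2}k => [//|i IH] lik; have [sc Nc] := cP i.+1 lik.
  have [sci Nci] := cP i (ltnW lik).
  have [fNc _ _] := len_add fN sc Nc (@subsetT _ _).
  have [cle cne] := cS i lik.
  by apply: leq_ltn_trans (IH (ltnW lik)) _; exact: len_lt.
have chain_ex (L : set M) k : clen N L k -> chain (fun X => submodule X /\ N `<=` X) k.
  elim: k N sN {fN chain_le} => [|k IH] N' sN'.
    by move=> _; exists (fun=> N'); split=> // i _; split.
  move=> [N1 NN1 N1L]; have [sN1 _ _] := clen_submod N1L.
  have [c [cP cS]] := IH N1 sN1 N1L.
  have [_ _ NN1'] := clen_submod (clen1 NN1).
  have c0 := cP 0%N (leq0n _).
  exists (fun i => if i is i'.+1 then c i' else N'); split=> [[|i] lik|[|i] lik] //.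
  - by split.
  - by have [sc Nc] := cP i lik; split=> //; exact: subset_trans Nc.
  - split; first by apply: subset_trans NN1' _; exact: c0.2.
    move=> E; apply: (step_neq NN1); apply/seteqP; split=> //.
    by apply: subset_trans E; exact: c0.2.
  - exact: cS.
split=> [[[c [cP cS]] nmax]|<-].
  by apply/eqP; rewrite eqn_leq (chain_le c n cP cS) andbT nmax //; exact:
    chain_ex (flen_clen fN).
by split=> [|k [c [cP cS]]]; [exact: chain_ex (flen_clen fN)|exact: chain_le cP cS].
Qed.

End LengthTheory.
End Length.

(** * Length under linear maps, and bounds from generators and independent families *)

Section LengthMore.
Variables (R : comNzRingType) (m : set R).
Hypothesis locR : noetherian_local m.

Section Image.
Variables (M M' : lmodType R) (f : {linear M -> M'}).
Implicit Types (A B X : set M) (N P Q : set M').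

(** The part of B / A that dies modulo N is cut off by [clen_split]; on what remains, [clen_image]
    preserves the length. *)
Lemma clen_image_le A B N n : submodule N -> clen m A B n ->
  exists2 r, (r <= n)%N & clen m (addm N (f @` A)) (addm N (f @` B)) r.
Proof.
move=> sN AB; have [sA sB AB'] := clen_submod AB.
have sX := submodule_setI sB (submodule_preimage f sN).
have sAX : submodule (addm A (B `&` f @^-1` N)) by exact: submodule_addm.
have [|p [q [pq Ap AB2]]] := clen_split locR AB sAX (sub_addml sX).
  by apply: addm_min => // y [].
exists q; first by lia.
suff -> : addm N (f @` A) = addm N (f @` addm A (B `&` f @^-1` N)).
  by apply: (clen_image sN sB _ _ AB2) => //; exact: sub_addmr.
have sfA := submodule_image f sA; have sNA := submodule_addm sN sfA.
apply/seteqP; split.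
  by apply: addm_mono => // _ [y Ay <-]; exists y => //; exact: sub_addml.
apply: addm_min => //; first exact: sub_addml.
move=> _ [y [u [Bu Nu] Ay] <-].
have -> : f y = f (y - u) + f u by rewrite -linearD subrK.
apply: submD => //; last exact: sub_addml.
by apply: sub_addmr => //; exists (y - u).
Qed.

Lemma len_image X N : submodule X -> submodule N -> flen m (X `&` f @^-1` N) X ->
  flen m N (addm N (f @` X)) /\ len m N (addm N (f @` X)) = len m (X `&` f @^-1` N) X.
Proof.
move=> sX sN fX.
have sfX := submodule_image f sX.
have h : clen m N (addm N (f @` X)) (len m (X `&` f @^-1` N) X).
  have /= := clen_image sN sX (@subset_refl _ X) (@subset_refl _ _) (flen_clen locR fX).
  congr (clen m _ _ _); apply: addm_absorb => //.
    by apply: submodule_image; apply: submodule_setI => //; exact: submodule_preimage.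
  by move=> _ [y [_ Ny] <-].
by split; [eexists; exact: h|exact: clen_len h].
Qed.

Lemma len_preimage X N : submodule X -> submodule N -> flen m N (addm N (f @` X)) ->
  flen m (X `&` f @^-1` N) X /\ len m N (addm N (f @` X)) = len m (X `&` f @^-1` N) X.
Proof.
move=> sX sN fX.
have h : clen m (X `&` f @^-1` N) X (len m N (addm N (f @` X))).
  have /= := clen_preimage sX (@subset_refl _ _) (flen_clen locR fX).
  congr (clen m _ _ _); apply/seteqP; split=> [y []//|y Xy]; split=> //.
  by apply: sub_addmr => //; exists y.
by split; [eexists; exact: h|rewrite (clen_len locR h)].
Qed.

End Image.

Section Bounds.
Variable M : lmodType R.
Implicit Types (N L A B X P Q : set M).
Local Ltac meq := module_eq R M.

Lemma clen_addm_le N A B n : submodule N -> clen m A B n ->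
  exists2 r, (r <= n)%N & clen m (addm N A) (addm N B) r.
Proof.
by move=> sN /(clen_image_le idfun sN); rewrite !image_id.
Qed.

Lemma addm_spans_cons N v (s : seq M) : submodule N ->
  addm N (spans (v :: s)) = adj (addm N (spans s)) v.
Proof.
move=> sN; have ss := submodule_spans s; have sNs := submodule_addm sN ss.
apply/seteqP; split=> [y [w [c wc] yw]|y [c [w sw yw]]].
  by exists c, (w - c *: v) => //; apply: eqmem yw _; meq.
exists (w + c *: v); last by apply: eqmem yw _; meq.
by exists c; apply: eqmem sw _; meq.
Qed.

Lemma addm0 N : addm N [set 0] = N.
Proof.
apply/seteqP; split=> [y [_ -> ]|y Ny]; first by rewrite subr0.
by exists 0; rewrite ?subr0.
Qed.

Lemma clen_spans N (s : seq M) : submodule N ->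
  (forall a v, m a -> v \in s -> N (a *: v)) ->
  exists2 n, (n <= size s)%N & clen m N (addm N (spans s)) n.
Proof.
move=> sN; elim: s => [|v s IH] ms.
  by exists 0%N => //=; rewrite addm0.
have [|n ns Ns] := IH; first by move=> a w ma ws; apply: ms => //; rewrite inE ws orbT.
have ss := submodule_spans s; have sNs := submodule_addm sN ss.
rewrite addm_spans_cons //; have [v_in|v_out] := pselect (addm N (spans s) v).
  exists n; first exact: leqW.
  congr (clen m _ _ _): Ns; apply/seteqP; split; first exact: sub_adj.
  exact: adj_min.
exists n.+1 => //; apply: clen_rcons Ns _; exists v; split=> // a ma.
by apply: sub_addml => //; apply: ms => //; rewrite mem_head.
Qed.

Lemma len_le_generators N L (s : seq M) : submodule N -> submodule L -> N `<=` L ->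
  (forall a y, m a -> L y -> N (a *: y)) -> (forall v, v \in s -> L v) ->
  L `<=` addm N (spans s) -> flen m N L /\ (len m N L <= size s)%N.
Proof.
move=> sN sL NL mL sL' Ls.
have [|n ns Nn] := @clen_spans N s sN.
  by move=> a v ma /sL'; exact: mL.
have <- : addm N (spans s) = L.
  by apply/seteqP; split=> //; apply: addm_min => //; exact: spans_min.
by split; [exists n|rewrite (clen_len locR Nn)].
Qed.

(* A family whose only relations modulo [N] have coefficients in [m]. *)
Lemma len_ge_family N L (I : finType) (v : I -> M) : flen m N L ->
  (forall i, L (v i)) ->
  (forall c : I -> R, N (\sum_i c i *: v i) -> forall i, m (c i)) ->
  (#|I| <= len m N L)%N.
Proof.
move=> fNL Lv free; have [sN sL NL] := flen_submod fNL.
pose X (s : seq I) := addm N (spans (map v s)).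
have sX s : submodule (X s) by apply: submodule_addm => //; exact: submodule_spans.
have XL s : X s `<=` L.
  by apply: addm_min => //; apply: spans_min => // _ /mapP[i _ ->].
suff h (s : seq I) : uniq s -> (size s <= len m N (X s))%N.
  have [_ _ ->] := len_add locR fNL (sX _) (sub_addml (submodule_spans _)) (XL (enum I)).
  by rewrite cardE; apply: leq_trans (h _ (enum_uniq _)) (leq_addr _ _).
have Xsum t y : uniq t -> X t y -> exists2 c : I -> R,
    N (y - \sum_i c i *: v i) & forall i, i \notin t -> c i = 0.
  elim: t y => [|i t IH] y /=.
    move=> _ [_ -> Ny]; exists (fun=> 0) => //.
    by rewrite big1 // => i _; rewrite scale0r.
  move=> /andP[it ut]; rewrite /X /= addm_spans_cons // => -[c /(IH _ ut) [d Nd d0]].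
  exists (fun j => if j == i then c else d j).
    have -> : \sum_j (if j == i then c else d j) *: v j = c *: v i + \sum_j d j *: v j.
      rewrite (bigD1 i) //= eqxx [in RHS](bigD1 i) //= d0 // scale0r add0r.
      by congr (_ + _); apply: eq_bigr => j /negPf ->.
    by apply: eqmem Nd _; meq.
  by move=> j; rewrite inE negb_or => /andP[/negPf -> /d0].
elim: s => [//|i s IH] /= /andP[is_ us].
have fX : flen m N (X (i :: s)).
  by have [] := len_add locR fNL (sX _) (sub_addml (submodule_spans _)) (XL (i :: s)).
apply: leq_ltn_trans (IH us) _; apply: len_lt => //.
- exact/sub_addml/submodule_spans.
- by rewrite /X /= addm_spans_cons //; exact: sub_adj.
move=> /(_ (v i)); rewrite {1}/X /= addm_spans_cons // => /(_ (mem_adj _ (sX s))).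
move=> /(Xsum _ _ us) [c Nc c0]; apply: (max_not1 locR).
have : m (if i == i then 1 else - c i); last by rewrite eqxx.
apply: (free (fun j => if j == i then 1 else - c j)).
apply: eqmem Nc _; rewrite (bigD1 i) //= c0 // scale0r add0r.
rewrite [RHS](bigD1 i) //= eqxx scale1r -sumrN; congr (_ + _).
by apply: eq_bigr => j /negPf ->; rewrite scaleNr.
Qed.

End Bounds.
End LengthMore.

(** * Regular sequences *)

Section RegularSequences.
Variables (R : comNzRingType) (M : lmodType R).
Implicit Types (N L A B X P Q : set M).
Local Ltac meq := module_eq R M.

Definition addsc N (a : R) : set M := [set y | exists u, N (y - a *: u)].

Definition regular_on N (a : R) : Prop := forall y, N (a *: y) -> N y.

(* [s] is a weakly regular sequence on [M / N] *)
Fixpoint wreg N (s : seq R) : Prop :=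
  if s is a :: s' then regular_on N a /\ wreg (addsc N a) s' else True.

Lemma submodule_addsc N a : submodule N -> submodule (addsc N a).
Proof.
move=> sN; split; first by exists 0; rewrite scaler0 subr0; exact: subm0.
move=> c x y [u Nu] [v Nv]; exists (c *: u + v).
by apply: eqmem (submD sN (submZ c sN Nu) Nv) _; meq.
Qed.

Lemma sub_addsc N a : N `<=` addsc N a.
Proof. by move=> y Ny; exists 0; rewrite scaler0 subr0. Qed.

Lemma mem_addsc N a y : submodule N -> addsc N a (a *: y).
Proof. by move=> sN; exists y; rewrite subrr; exact: subm0. Qed.

Lemma addsc_min N a X : submodule X -> N `<=` X -> (forall y, X (a *: y)) ->
  addsc N a `<=` X.
Proof. by move=> sX NX Xa y [u /NX]; exact: submBl. Qed.

Lemma addscC N a b : submodule N -> addsc (addsc N a) b = addsc (addsc N b) a.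
Proof.
move=> sN; apply/seteqP; split=> y [u [v Nuv]]; exists v, u;
  by apply: eqmem Nuv _; meq.
Qed.

Lemma addm_msq1 N a s : submodule N ->
  addm N (msq (a :: s) setT) = addm (addsc N a) (msq s setT).
Proof.
move=> sN; have sT := submodule_setT M; have ss := submodule_msq s sT.
apply/seteqP; split=> y.
  move=> [w [u _ wu] yw]; exists (w - a *: u) => //.
  by exists u; apply: eqmem yw _; meq.
move=> [w sw [u yu]]; exists (a *: u + w).
  by exists u => //; apply: eqmem sw _; meq.
by apply: eqmem yu _; meq.
Qed.

(** Let Z be the set of y with by in N. Since b is regular modulo a, such a y is az modulo N, and
    then z is in Z because a is regular. So Z <= N + mZ and Nakayama's lemma gives Z <= N. *)
Lemma wreg_swap (m : set R) N a b s : noetherian_local m -> noeth M ->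
  submodule N -> m a -> wreg N [:: a, b & s] -> wreg N [:: b, a & s].
Proof.
move=> locR nM sN ma [ra [rb rs]]; rewrite /= addscC //.
have rb' : regular_on N b.
  pose Z : set M := [set y | N (b *: y)].
  have sZ : submodule Z.
    split; first by rewrite /Z /= scaler0; exact: subm0.
    by move=> c x y Nx Ny; apply: eqmem (submD sN (submZ c sN Nx) Ny) _; meq.
  apply: (Nakayama locR nM sN sZ) => y Nby.
  have [z yz] : addsc N a y by apply: rb; exact: sub_addsc.
  exists (a *: z) => //; apply: mem_smul => //; apply: ra.
  by apply: eqmem (submB sN Nby (submZ b sN yz)) _; meq.
split=> //; split=> // y [w yw].
have [w' ww'] : addsc N a w.
  by apply: rb; exists y; apply: eqmem (submN sN yw) _; meq.
exists w'; apply: ra; apply: eqmem (submD sN yw (submZ b sN ww')) _; meq.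
Qed.

Lemma wreg_perm (m : set R) N s t : noetherian_local m -> noeth M ->
  submodule N -> (forall a, a \in s -> m a) -> perm_eq s t -> wreg N s -> wreg N t.
Proof.
move=> locR nM; have front : forall s1 N a s2, submodule N ->
    (forall a, a \in s1 -> m a) -> wreg N (s1 ++ a :: s2) -> wreg N (a :: s1 ++ s2).
  elim=> [//|c s1 IH] {}N a s2 sN ms1 [rc rs1].
  apply: (wreg_swap locR nM sN); first by apply: ms1; rewrite mem_head.
  split=> //; apply: IH => //; first exact: submodule_addsc.
  by move=> x xs; apply: ms1; rewrite inE xs orbT.
elim: t s N => [|a t IH] s N sN ms st.
  by move/perm_nilP: st => ->.
have as_ : a \in s by rewrite (perm_mem st) mem_head.
case/splitPr: as_ ms st => s1 s2 ms st /front [//||ra rs].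
  by move=> x xs; apply: ms; rewrite mem_cat xs.
split=> //; apply: (IH (s1 ++ s2)) => //; first exact: submodule_addsc.
  by move=> x; rewrite mem_cat => xs; apply: ms; rewrite mem_cat inE orbCA xs orbT.
rewrite -(perm_cons a); apply: perm_trans st; rewrite perm_sym.
exact: permEl (perm_catCA s1 [:: a] s2).
Qed.

(** This is I^j M for the ideal I generated by [s]. *)
Definition spow (s : seq R) (j : nat) : set M := iter j (msq s) setT.

Lemma submodule_spow s j : submodule (spow s j).
Proof. by case: j => [//|j]; apply: submodule_msq; elim: j => [//|j]; exact: submodule_msq. Qed.

Lemma spow_sub s j : spow s j.+1 `<=` spow s j.
Proof. by apply: msq_sub; exact: submodule_spow. Qed.

Lemma spowS s t j : {subset s <= t} -> spow s j `<=` spow t j.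
Proof.
by move=> st; elim: j => [//|j IH]; apply: msqS => //; exact: submodule_spow.
Qed.

Lemma submodule_iter_msq s j L : submodule L -> submodule (iter j (msq s) L).
Proof. by move=> sL; elim: j => [//|j IH]; exact: submodule_msq. Qed.

Lemma iter_msq_cons a s j L : submodule L -> iter j.+1 (msq (a :: s)) L =
  addm (iter j.+1 (msq s) L) ( *:%R a @` iter j (msq (a :: s)) L).
Proof.
move=> sL; have sp t i : submodule (iter i (msq t) L) by exact: submodule_iter_msq.
have sa i : submodule ( *:%R a @` iter i (msq (a :: s)) L).
  exact: (submodule_image ( *:%R a) (sp _ i)).
have sA i : submodule (addm (iter i.+1 (msq s) L) ( *:%R a @` iter i (msq (a :: s)) L)).
  exact: (submodule_addm (sp s i.+1) (sa i)).
apply/seteqP; split; last first.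
  apply: addm_min => //.
    elim: j.+1 => [//|i IH]; apply: msqS => //; first exact: (sp (a :: s) i).
    by move=> x xs; rewrite in_cons xs orbT.
  by move=> _ [y jy <-]; apply: (@mem_msq _ _ (a :: s) _ a y (sp _ j)) => //; exact: mem_head.
elim: j => [|j IH]; apply: msq_min => // b y; rewrite inE => /orP[/eqP ->|bs] jy.
- by apply: (sub_addmr (sp s 1%N)); exists y.
- by apply: (sub_addml (sa 0%N)); exact: mem_msq.
- by apply: (sub_addmr (sp s j.+2)); exists y.
have [_ [z az <-] yz] := IH _ jy; exists (a *: (b *: z)).
  exists (b *: z) => //.
  by apply: (@mem_msq _ _ (a :: s) _ b z (sp _ _) _ az); rewrite inE bs orbT.
have -> : b *: y - a *: (b *: z) = b *: (y - a *: z) by meq.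
exact: (@mem_msq _ _ s _ b _ (sp _ _) bs yz).
Qed.

Lemma spow_cons a s j : spow (a :: s) j.+1 `<=`
  [set y | exists2 z, spow (a :: s) j z & spow s j.+1 (y - a *: z)].
Proof.
rewrite [X in X `<=` _](@iter_msq_cons a s j) // => y [_ [z jz <-] yz].
by exists z.
Qed.

(** An element of (b, s)^(j+1) M is bz modulo s^(j+1) M with z in (b, s)^j M. Hence b(w - z) lies in
    N + s^(j+1) M, where b can be cancelled. *)
Lemma regular_on_spow_cons N b s j : submodule N ->
  regular_on (addm N (spow s j.+1)) b ->
  forall w, addm N (spow (b :: s) j.+1) (b *: w) -> addm N (spow (b :: s) j) w.
Proof.
move=> sN rb w [t /spow_cons [z jz tz] wt].
have sp := submodule_spow.
have bz : addm N (spow (b :: s) j) z by exact: sub_addmr.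
apply: submBl bz _; first exact: submodule_addm.
have /rb : addm N (spow s j.+1) (b *: (w - z)).
  by exists (t - b *: z) => //; apply: eqmem wt _; meq.
apply: addm_mono => //; apply: subset_trans (@spow_sub s j) _.
by apply: spowS => x xs; rewrite in_cons xs orbT.
Qed.

Lemma wreg_cat N s t : wreg N (s ++ t) -> wreg N s.
Proof. by elim: s N => [//|a s IH] N /= [ra /IH]. Qed.

(* A permutable regular sequence stays regular modulo the powers of its other
   members. *)
Lemma regular_on_spow (m : set R) N a s j : noetherian_local m -> noeth M ->
  submodule N -> m a -> (forall b, b \in s -> m b) -> wreg N (a :: s) ->
  regular_on (addm N (spow s j)) a.
Proof.
move=> locR nM; have sp := submodule_spow.
elim: s N a j => [|b s IH] N a j sN ma ms was.
  case: j => [|j] y; first by move=> _; exact: sub_addmr.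
  by rewrite [spow _ _]/([set 0] : set M) addm0 => /was.1.
have mb : m b by apply: ms; rewrite mem_head.
have ms' c : c \in s -> m c by move=> cs; apply: ms; rewrite inE cs orbT.
have [rb was'] := wreg_swap locR nM sN ma was.
have wbs : wreg N (b :: s).
  apply: (@wreg_cat _ _ [:: a]); apply: (wreg_perm locR nM sN _ _ was).
    by move=> x; rewrite inE => /orP[/eqP ->|] //; exact: ms.
  by rewrite -cat1s perm_catC.
have colon i := regular_on_spow_cons sN (IH N b i.+1 sN mb ms' wbs).
have sNb := submodule_addsc b sN.
elim: j => [|j IHj] u au; first exact: sub_addmr.
have sNj i : submodule (addm N (spow (b :: s) i)) by exact: submodule_addm.
(* Modulo [b] the induction on [s] applies and leaves u = w + bz with w in s^(j+1) M. It remains to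
   treat bz: the colon statement cancels [b] from a b z, and the induction on [j] then cancels
   [a]. *)
have [w sw [z uz]] : addm (addsc N b) (spow s j.+1) u.
  apply: (IH _ a j.+1 sNb ma ms' was'); have [t bt ut] := au.
  have [z bz tz] := spow_cons bt; exists (t - b *: z) => //.
  by exists z; apply: eqmem ut _; meq.
have bw : addm N (spow (b :: s) j.+1) (u - b *: z).
  exists w; last by apply: eqmem uz _; meq.
  by apply: spowS sw => x xs; rewrite in_cons xs orbT.
have /IHj [t bt zt] : addm N (spow (b :: s) j) (a *: z).
  by apply: colon; apply: eqmem (submB (sNj _) au (submZ a (sNj _) bw)) _; meq.
apply: submBl (_ : addm N (spow (b :: s) j.+1) (b *: z)) bw; first exact: sNj.
exists (b *: t).
  by apply: (@mem_msq _ _ (b :: s) (spow (b :: s) j) b t (sp _ _) (mem_head _ _)).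
by apply: eqmem (submZ b sN zt) _; meq.
Qed.

(** Pascal's rule. Multiplication by [a] embeds M / (N + (a, s)^(k+1) M) into M / (N + (a, s)^(k+2)
    M), because the colon by [a] is no larger than expected. The cokernel is the quotient belonging
    to [s] on M / (N + aM). *)
Lemma clen_spow (m : set R) N s l k : noetherian_local m -> noeth M ->
  submodule N -> (forall b, b \in s -> m b) -> wreg N s ->
  clen m (addm N (msq s setT)) setT l ->
  clen m (addm N (spow s k.+1)) setT (l * 'C(k + size s, size s)).
Proof.
move=> locR nM; have sp := submodule_spow; have sT := submodule_setT M.
elim: s N k => [|a s IH] N k sN ms ws; first by rewrite bin0 muln1.
have ma : m a by apply: ms; rewrite mem_head.
have ms' c : c \in s -> m c by move=> cs; apply: ms; rewrite inE cs orbT.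
have sNa := submodule_addsc a sN.
have sNj i : submodule (addm N (spow (a :: s) i)) by exact: submodule_addm.
move=> ll; elim: k => [|k IHk]; first by rewrite binn muln1.
have lower : clen m (addm N (spow (a :: s) k.+2)) (addm (addsc N a) (spow s k.+2))
    (l * 'C(k + size (a :: s), size (a :: s))).
  have -> : addm (addsc N a) (spow s k.+2) =
      addm (addm N (spow (a :: s) k.+2)) ( *:%R a @` setT).
    have sa : submodule ( *:%R a @` [set: M]) := submodule_image ( *:%R a) sT.
    apply/seteqP; split=> [y [w sw [z yz]]|].
      exists (a *: z); first by exists z.
      exists w; last by apply: eqmem yz _; meq.
      by apply: spowS sw => x xs; rewrite in_cons xs orbT.
    have sNas : submodule (addm (addsc N a) (spow s k.+2)) by exact: submodule_addm.
    apply: addm_min => //.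
      move=> y [t /spow_cons [z _ tz] yt]; exists (t - a *: z) => //.
      by exists z; apply: eqmem yt _; meq.
    move=> _ [z _ <-]; apply: sub_addml => //; exact: mem_addsc.
  have colon : setT `&` *:%R a @^-1` addm N (spow (a :: s) k.+2) `<=`
      addm N (spow (a :: s) k.+1).
    move=> y [_]; apply: regular_on_spow_cons => //.
    exact: regular_on_spow locR nM sN ma ms' ws.
  have := clen_image (f := *:%R a) (sNj _) sT (@subsetT _ _) colon IHk.
  rewrite (_ : addm _ ( _ @` addm _ _) = addm N (spow (a :: s) k.+2)) //.
  apply: addm_absorb => //; first exact: submodule_image.
  move=> _ [y [t ty yt] <-]; exists (a *: t).
    by apply: (@mem_msq _ _ (a :: s) (spow (a :: s) k.+1) a t (sp _ _) (mem_head _ _)).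
  by apply: eqmem (submZ a sN yt) _ => /=; meq.
have upper : clen m (addm (addsc N a) (spow s k.+2)) setT (l * 'C(k.+1 + size s, size s)).
  by apply: IH => //; [exact: ws.2|rewrite -addm_msq1].
have := clen_cat lower upper; congr (clen m _ _ _).
by rewrite -mulnDr /= !addnS !addSn [in RHS]binS.
Qed.

End RegularSequences.

(** * Products of ideals and modules *)

Section IdealProducts.
Variables (R : comNzRingType) (M : lmodType R).
Implicit Types (L : set M) (I : set R) (P : set R^o).

Lemma scale_regE (a : R) (b : R^o) : a *: b = a * b :> R.
Proof. by []. Qed.

Lemma smulA I P L : smul (smul I P) L = smul I (smul P L).
Proof.
apply/seteqP; split.
  apply: smul_min; first exact: submodule_smul.
  move=> a y IPa Ly; pose X : set R^o := [set b | smul I (smul P L) (b *: y)].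
  apply: (@smul_min _ R^o I P X _ _ a IPa).
    split; first by rewrite /X /= scale0r; apply: subm0; exact: submodule_smul.
    move=> c b b' Xb Xb'; rewrite /X /= scalerDl scale_regE -scalerA.
    by apply: submD; [exact: submodule_smul|apply: submZ => //; exact: submodule_smul|].
  move=> c b Ic Pb; rewrite /X /= scale_regE -scalerA.
  by apply: mem_smul => //; exact: mem_smul.
apply: smul_min; first exact: submodule_smul.
move=> a y Ia; pose X : set M := [set z | smul (smul I P) L (a *: z)].
apply: (@smul_min _ _ P L X).
  split; first by rewrite /X /= scaler0; apply: subm0; exact: submodule_smul.
  move=> c u v Xu Xv; rewrite /X /= scalerDr scalerA mulrC -scalerA.
  by apply: submD; [exact: submodule_smul|apply: submZ => //; exact: submodule_smul|].
move=> b z Pb Lz; rewrite /X /= scalerA; apply: mem_smul => //.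
exact: (@mem_smul _ R^o I P a b).
Qed.

Lemma smul_setT L : submodule L -> smul [set: R] L = L.
Proof.
move=> sL; apply/seteqP; split; first exact: smul_sub.
by move=> y Ly; rewrite -[y]scale1r; exact: mem_smul.
Qed.

Lemma smul_msq s P L : submodule L -> submodule P ->
  smul (msq s P : set R^o) L = msq s (smul P L).
Proof.
move=> sL sP; rewrite -smul_seq // smulA smul_seq //; exact: submodule_smul.
Qed.

Lemma smul_iter I k L : submodule L ->
  smul (iter k (@smul R R^o I) setT) L = iter k (smul I) L.
Proof.
move=> sL; elim: k => [|k IH]; first exact: smul_setT.
by rewrite !iterS smulA IH.
Qed.

Lemma smul_spow s k L : submodule L ->
  smul (@spow R R^o s k) L = iter k (msq s) L.
Proof.
move=> sL; elim: k => [|k IH]; first exact: smul_setT.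
by rewrite /= -IH -smul_msq //; exact: submodule_spow.
Qed.

Lemma submodule_iter_smul I k L : submodule L -> submodule (iter k (smul I) L).
Proof. by move=> sL; case: k => [//|k]; exact: submodule_smul. Qed.

Lemma iter_msq_sub s j k L : submodule L -> (j <= k)%N ->
  iter k (msq s) L `<=` iter j (msq s) L.
Proof.
move=> sL /subnK <-; elim: (k - j)%N => [//|i IH]; rewrite addSn iterS.
apply: subset_trans IH; apply: msq_sub.
by elim: (i + j)%N => [//|l IHl]; exact: submodule_msq.
Qed.

End IdealProducts.

(** * Prime ideals and regular sequences *)

Section Primes.
Variables (R : comNzRingType) (m : set R).
Hypothesis locR : noetherian_local m.

Lemma prime_avoiding (I S : set R) : @submodule R R^o I ->
  S 1 -> (forall a b, S a -> S b -> S (a * b)) -> (forall a, S a -> ~ I a) ->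
  exists P, [/\ prime_ideal P, I `<=` P & forall a, S a -> ~ P a].
Proof.
move=> sI S1 SM IS.
pose F (X : set R^o) := submodule X /\ forall a, S a -> ~ X a.
have [P [[sP PS] IP Pmax]] := noeth_max (noeth_ring locR) (fun X (h : F X) => h.1) (conj sI IS).
exists P; split=> //; split=> //; first exact: PS.
move=> a b Pab; apply: contrapT => /not_orP [Pa Pb].
have big c : ~ P c -> exists2 t, S t & adj P c t.
  move=> Pc; apply: contrapT => noS; apply: Pc.
  rewrite -(Pmax (adj P c)); [exact: mem_adj| |exact: sub_adj].
  split; first exact: submodule_adj.
  by move=> t St Pct; apply: noS; exists t.
have [t St [c tc]] := big a Pa; have [u Su [e ue]] := big b Pb.
apply: (PS (t * u)); first exact: SM.
have -> : t * u = (t - c * a) * u + (c * a * (u - e * b) + c * e * (a * b)) by ring.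
apply: (submD sP); first by rewrite mulrC; exact: (submZ u sP tc).
by apply: (submD sP); [exact: (submZ (c * a) sP ue)|exact: (submZ (c * e) sP Pab)].
Qed.

Lemma prime_max : prime_ideal m.
Proof.
split; [exact: ideal_max|exact: max_not1|move=> a b mab].
apply: contrapT => /not_orP [/(max_unit locR) [c ca] mb]; apply: mb.
have -> : b = c * (a * b) by rewrite mulrA ca mul1r.
exact: max_mul.
Qed.

Section Chains.
Variable M : lmodType R.
Implicit Types (N L : set M).

Definition annm N : set R := [set a | forall y, N (a *: y)].

(** Each regular element adds a prime at the bottom of the chain. If c0 is the lowest prime so far,
    the products y a^k with y outside c0 miss the annihilator of M / N, as [a] is regular there. A
    prime avoiding them lies below c0 and does not contain [a], which c0 does. *)
Lemma wreg_chain N s Q : submodule N -> wreg N s -> prime_ideal Q ->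
  annm (addm N (msq s setT)) `<=` Q ->
  exists c : nat -> set R, [/\ forall i, (i <= size s)%N -> prime_ideal (c i) /\ annm N `<=` c i,
    forall i, (i < size s)%N -> c i `<` c i.+1 & c (size s) = Q].
Proof.
elim: s N => [|a s IH] N sN /=.
  move=> _ pQ NQ; exists (fun=> Q); split=> // i _; split=> //.
  by move=> b Nb; apply: NQ => y; rewrite addm0; exact: Nb.
move=> [ra ws] pQ NQ; have sNa := submodule_addsc a sN.
have [|c [cP cS cQ]] := IH _ sNa ws pQ.
  by rewrite -addm_msq1.
have [[sc0 c01 c0M] Nc0] := cP 0%N (leq0n _).
have [P [pP NP PS]] : exists P, [/\ prime_ideal P, annm N `<=` P &
    forall b, (exists2 y, ~ c 0%N y & exists k, b = y * a ^+ k) -> ~ P b].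
  apply: prime_avoiding.
  - split=> [y|e b b' Nb Nb' y]; first by rewrite scale0r; exact: subm0.
    by rewrite scalerDl scale_regE -scalerA; apply: submD => //; exact: submZ.
  - by exists 1 => //; exists 0%N; rewrite expr0 mulr1.
  - move=> _ _ [y cy [k ->]] [z cz [l ->]]; exists (y * z).
      by move=> /c0M [].
    by exists (k + l)%N; rewrite exprD; ring.
  - move=> _ [y cy [k ->]] Nyk; apply: cy; apply: Nc0 => z; apply: sub_addsc.
    elim: k z Nyk => [|k IHk] z Nyk; first by have := Nyk z; rewrite expr0 mulr1.
    apply: IHk => w; apply: ra.
    by have := Nyk w; rewrite exprSr mulrA [_ * a]mulrC -scalerA.
have Pa : ~ P a.
  by apply: PS; exists 1 => //; exists 1%N; rewrite expr1 mul1r.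
have c0a : c 0%N a by apply: Nc0 => y; exact: mem_addsc.
exists (fun i => if i is i'.+1 then c i' else P); split=> //.
- move=> [|i] lis //; have [pc Nc] := cP i lis; split=> //.
  by move=> b Nb; apply: Nc => y; apply: sub_addsc; exact: Nb.
- move=> [|i] lis; last exact: cS.
  split; last by move=> /(_ a c0a).
  move=> b Pb; apply: contrapT => cb; apply: PS Pb.
  by exists b => //; exists 0%N; rewrite expr0 mulr1.
Qed.

Lemma wregP N s : submodule N -> wreg N s <->
  forall i, (i < size s)%N -> regular_on (addm N (msq (take i s) setT)) s`_i.
Proof.
elim: s N => [|a s IH] N sN //=; have sNa := submodule_addsc a sN.
split=> [[ra /(IH _ sNa) h] [|i] lis /=|h].
- by rewrite addm0.
- have := h i lis; rewrite -addm_msq1 //.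
split; first by have := h 0%N isT; rewrite /= addm0.
by apply/IH => // i lis; have := h i.+1 lis; rewrite -addm_msq1.
Qed.

Lemma add0m L : addm [set 0] L = L.
Proof.
apply/seteqP; split=> [y [u Lu /eqP]|y Ly]; first by rewrite subr_eq0 => /eqP ->.
by exists y; rewrite ?subrr.
Qed.

Lemma regular_seqP s : regular_seq m M s <->
  [/\ forall a, a \in s -> m a, wreg [set (0 : M)] s & msq s [set: M] <> setT].
Proof.
have s0 := submodule_set0 M.
have E i : smul [set a | a \in take i s] [set: M] = msq (take i s) setT by exact: smul_seq.
split=> [[ms rs sT]|[ms /(wregP _ s0) rs sT]]; split=> //.
- by apply/wregP => // i lis y; rewrite add0m -E; exact: rs.
- by rewrite -[in msq _ _](take_size s) -E.
- by move=> i y lis; rewrite /= !E; have := rs i lis y; rewrite add0m.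
- by rewrite E take_size.
Qed.

End Chains.

Section Dimension.
Variable d : nat.
Hypothesis dimR : has_dim R^o d.

Lemma prime_chain_le (c : nat -> set R) k :
  (forall i, (i <= k)%N -> prime_ideal (c i)) -> (forall i, (i < k)%N -> c i `<` c i.+1) ->
  (k <= d)%N.
Proof.
move=> cP cS; case: dimR => _ dmax; apply: dmax; exists c; split=> // i ik.
split; first exact: cP.
move=> a /(_ (1 : R^o)); rewrite scale_regE mulr1 => ->.
by have [sc _ _] := cP i ik; exact: (subm0 sc).
Qed.

Lemma annm_proper (M : lmodType R) (N : set M) : submodule N -> N <> setT -> annm N `<=` m.
Proof.
move=> sN NT; apply: (ideal_sub_max locR).
  split=> [y|e b b' Nb Nb' y]; first by rewrite scale0r; exact: subm0.
  by rewrite scalerDl scale_regE -scalerA; apply: submD => //; exact: submZ.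
move=> N1; apply: NT; apply/seteqP; split=> // y _.
by rewrite -[y]scale1r; exact: N1.
Qed.

Lemma wreg_size_le (M : lmodType R) s : wreg [set (0 : M)] s -> msq s [set: M] <> setT ->
  (size s <= d)%N.
Proof.
move=> ws sT; have s0 := submodule_set0 M.
have [|c [cP cS _]] := wreg_chain s0 ws prime_max.
  by rewrite add0m; apply: annm_proper => //; exact: submodule_msq.
by apply: (prime_chain_le _ cS) => i /cP [].
Qed.

Lemma wreg_has_dim (M : lmodType R) s : wreg [set (0 : M)] s -> msq s [set: M] <> setT ->
  size s = d -> has_dim M d.
Proof.
move=> ws sT sd; have s0 := submodule_set0 M.
have [|c [cP cS _]] := wreg_chain s0 ws prime_max.
  by rewrite add0m; apply: annm_proper => //; exact: submodule_msq.
split=> [|k [e [eP eS]]].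
  rewrite -sd; exists c; split; last exact: cS.
  move=> i lis; have [pc Nc] := cP i lis; split; first exact: pc.
  by move=> a aM; apply: Nc => y; exact: aM.
by apply: (prime_chain_le _ eS) => i /eP [].
Qed.

Lemma longest_chain_uniq (T : Type) (P : set T -> Prop) p q :
  longest_chain P p -> longest_chain P q -> p = q.
Proof.
move=> [cp pmax] [cq qmax]; apply/eqP.
by rewrite eqn_leq (qmax _ cp) (pmax _ cq).
Qed.

Lemma cohen_macaulay_wreg (M : lmodType R) s : fin_gen M ->
  (forall a, a \in s -> m a) -> wreg [set (0 : M)] s -> msq s [set: M] <> setT ->
  size s = d -> max_cohen_macaulay m M.
Proof.
move=> fM ms ws sT sd; have dimM := wreg_has_dim ws sT sd.
split; last by exists d.
split=> //.
  apply: contrapT => M0; apply: sT; apply/seteqP; split=> // y _.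
  have -> : y = 0 by apply: contrapT => /eqP y0; apply: M0; exists y.
  by apply: subm0; apply: submodule_msq.
exists d => //; split; first by exists s => //; apply/regular_seqP; split.
by move=> x /regular_seqP [_ wx xT]; exact: wreg_size_le wx xT.
Qed.

Lemma depth_wreg (M : lmodType R) : max_cohen_macaulay m M ->
  exists s, [/\ forall a, a \in s -> m a, wreg [set (0 : M)] s, msq s [set: M] <> setT
    & size s = d].
Proof.
move=> [[_ _ [s dM [[x /regular_seqP [mx wx xT] xs] _]]] [s' dM' dR']].
exists x; split=> //; rewrite xs.
by rewrite (longest_chain_uniq dM dM') (longest_chain_uniq dR' dimR).
Qed.

(* A prime containing [z] properly below [m] would make a chain of length [d + 1]. *)
Lemma wreg_max_primary (z : seq R) : wreg [set (0 : R^o)] z -> size z = d ->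
  (forall a, a \in z -> m a) ->
  exists n, iter n (@smul R R^o m) setT `<=` msq z [set: R^o].
Proof.
move=> wz zd mz; have nR := noeth_ring locR.
apply: contrapT => nopow; set J := msq z [set: R^o] in nopow *.
have sJ : submodule J by exact: submodule_msq.
pose F (X : set R^o) := submodule X /\ ~ exists n, iter n (@smul R R^o m) setT `<=` X.
have [P [[sP Ppow] JP Pmax]] := noeth_max nR (fun X (h : F X) => h.1) (conj sJ nopow).
have P1 : ~ P 1.
  move=> P1; apply: Ppow; exists 0%N => y _.
  by rewrite -[y]mulr1; exact: (submZ (y : R) sP P1).
have pP : prime_ideal P.
  split=> // a b Pab; apply: contrapT => /not_orP [Pa Pb].
  have big c : ~ P c -> exists n, iter n (@smul R R^o m) setT `<=` adj P c.
    move=> Pc; apply: contrapT => npow; apply: Pc.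
    rewrite -(Pmax (adj P c)); [exact: mem_adj| |exact: sub_adj].
    by split; first exact: submodule_adj.
  have [k ka] := big a Pa; have [l lb] := big b Pb.
  apply: Ppow; exists (k + l)%N; rewrite iterD -(@smul_iter R R^o) //; last first.
    exact: submodule_iter_smul.
  apply: smul_min => // x y /ka [c xc] /lb [e ye].
  have -> : x *: (y : R^o) = (x - c * a) * y + (c * a * (y - e * b) + c * e * (a * b)) :> R.
    by rewrite scale_regE; ring.
  apply: (submD sP); first by rewrite mulrC; exact: (submZ (y : R) sP xc).
  by apply: (submD sP); [exact: (submZ (c * a) sP ye)|exact: (submZ (c * e) sP Pab)].
have Pm := ideal_sub_max locR sP P1.
have mP : ~ m `<=` P.
  move=> mP; apply: Ppow; exists 1%N; apply: smul_min => // a y ma _.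
  by rewrite scale_regE mulrC; apply: mP; exact: max_mul.
have [|c [cP cS cQ]] := wreg_chain (submodule_set0 R^o) wz pP.
  by rewrite add0m => a /(_ (1 : R^o)); rewrite scale_regE mulr1 => /JP.
have : (d.+1 <= d)%N; last by rewrite ltnn.
apply: (@prime_chain_le (fun i => if (i <= d)%N then c i else m)).
  move=> i _; case: ifP => [lid|_]; last exact: prime_max.
  by have [] := cP i; rewrite ?zd.
move=> i; rewrite ltnS => lid; rewrite lid; case: ltnP => [ltid|geid].
  by apply: cS; rewrite zd.
have -> : i = size z by rewrite zd; apply/eqP; rewrite eqn_leq lid.
by rewrite cQ; split.
Qed.

End Dimension.
End Primes.

(** * Zero divisors and avoidance of ideals *)

Section Avoidance.
Variables (R : comNzRingType) (m : set R).
Hypothesis locR : noetherian_local m.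

Section ZeroDivisors.
Variable M : lmodType R.
Implicit Types (N L : set M).
Local Ltac meq := module_eq R M.

Definition annel N (y : M) : set R := [set a | N (a *: y)].

Lemma submodule_annel N y : submodule N -> @submodule R R^o (annel N y).
Proof.
move=> sN; split=> [|e b b' Nb Nb']; first by rewrite /annel /= scale0r; exact: subm0.
by rewrite /annel /= scalerDl scale_regE -scalerA; apply: submD => //; exact: submZ.
Qed.

(* Every zero divisor lies in a maximal annihilator; these are prime, and finitely
   many of them suffice because their witnesses span a finitely generated module. *)
Lemma zero_divisors N : noeth M -> submodule N ->
  exists ys : seq M, (forall y, y \in ys -> ~ N y) /\
    forall a, (forall y, y \in ys -> ~ annel N y a) -> regular_on N a.
Proof.
move=> nM sN.
pose S y := ~ N y /\ forall z, ~ N z -> annel N y `<=` annel N z -> annel N z = annel N y.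
have maxS y0 : ~ N y0 -> exists2 y, S y & annel N y0 `<=` annel N y.
  move=> Ny0; pose F (X : set R^o) := exists2 y, ~ N y & X = annel N y.
  have sF X : F X -> submodule X by move=> [y _ ->]; exact: submodule_annel.
  have F0 : F (annel N y0) by exists y0.
  have [_ [[y Ny ->] y0y ymax]] := noeth_max (noeth_ring locR) sF F0.
  by exists y => //; split=> // z Nz yz; apply: ymax => //; exists z.
have Sprime y a b : S y -> ~ annel N y a -> annel N y (a * b) -> annel N y b.
  move=> [Ny ymax] Nay Nab; rewrite -(ymax (a *: y)) //; last first.
    move=> c; rewrite /annel /= scalerA mulrC -scalerA; exact: submZ.
  by rewrite /annel /= scalerA mulrC.
pose F X := exists2 ys : seq M, (forall y, y \in ys -> S y) & X = spans ys.
have sF X : F X -> submodule X by move=> [ys _ ->]; exact: submodule_spans.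
have F0 : F (spans [::]) by exists [::].
have [_ [[ys Sys ->] _ ysmax]] := noeth_max nM sF F0.
have Sspan y : S y -> spans ys y.
  move=> Sy; have <- : spans (y :: ys) = spans ys.
    apply: ysmax; last exact: sub_adj.
    by exists (y :: ys) => // z; rewrite inE => /orP[/eqP ->|/Sys].
  by apply: mem_spans; rewrite mem_head.
exists ys; split=> [y /Sys []//|a aP z Naz].
apply: contrapT => Nz; have [y Sy zy] := maxS z Nz.
suff [y' y'ys E] : exists2 y', y' \in ys & annel N y' `<=` annel N y.
  apply: (aP y' y'ys); have [_ ymax] := Sys y' y'ys.
  by rewrite -(ymax y) //; [exact: zy|case: Sy].
apply: contrapT => noy'.
have [c yc cys] : exists2 c, ~ annel N y c & forall y', y' \in ys -> N (c *: y').
  have : forall y', y' \in ys -> ~ annel N y' `<=` annel N y.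
    by move=> y' y'ys E; apply: noy'; exists y'.
  elim: (ys) => [|w ys' IH] nw.
    by exists 1 => //; rewrite /annel /= scale1r; case: Sy.
  have [|c yc cys] := IH; first by move=> y' y'ys; apply: nw; rewrite inE y'ys orbT.
  have /existsNP [b /not_implyP [wb yb]] := nw w (mem_head _ _).
  exists (b * c); first by move=> /(Sprime _ _ _ Sy yb).
  move=> y'; rewrite inE => /orP[/eqP ->|/cys cy'].
    by rewrite mulrC -scalerA; exact: submZ.
  by rewrite -scalerA; exact: submZ.
apply: yc; pose X : set M := [set w | N (c *: w)].
have sX : submodule X.
  split; first by rewrite /X /= scaler0; exact: subm0.
  by move=> e u v Nu Nv; apply: eqmem (submD sN (submZ e sN Nu) Nv) _; meq.
by apply: (spans_min sX cys); exact: Sspan.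
Qed.

End ZeroDivisors.

Hypothesis infR : infinite_set (cosets m).

Lemma infinite_residues : exists t : nat -> R, forall i j, i <> j -> ~ m (t i - t j).
Proof.
have /infiniteP /pcard_leP [f] := infR.
have fP i : exists x, f i = [set y | m (y - x)].
  have : cosets m (f i) by apply: funS.
  by move=> [x _ <-]; exists x.
have [t tP] := choice fP; exists t => i j ij mij; apply: ij.
have fij : f i = f j.
  have sm := ideal_max locR.
  rewrite !tP; apply/seteqP; split=> y /= my.
    by apply: eqmem (submD sm my mij) _; ring.
  by apply: eqmem (submB sm my mij) _; ring.
have /= := @inj _ _ setT f i j; apply=> //; exact: in_setT.
Qed.

(* Along the line [y + t x] each ideal not containing [x] is met at most once. *)
Lemma ideal_avoid (J : set R) (Qs : seq (set R)) : @submodule R R^o J ->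
  (forall Q, Q \in Qs -> @submodule R R^o Q /\ ~ (J `<=` Q)) ->
  exists2 x, J x & forall Q, Q \in Qs -> ~ Q x.
Proof.
move=> sJ; have [t tP] := infinite_residues.
elim: Qs => [|Q Qs IH] QsP; first by exists 0 => //; exact: (subm0 sJ).
have [|x Jx Qsx] := IH; first by move=> P PQs; apply: QsP; rewrite inE PQs orbT.
have [sQ /existsNP [y /not_implyP [Jy Qy]]] := QsP Q (mem_head _ _).
have [Qx|Qx] := pselect (Q x); last first.
  by exists x => // P; rewrite inE => /orP[/eqP ->|/Qsx].
have [B goodB] : exists B, forall i, (B <= i)%N -> forall P, P \in Qs -> ~ P (y + t i * x).
  have : forall P, P \in Qs -> submodule (P : set R^o) /\ ~ P x.
    by move=> P PQs; split; [case: (QsP P _) => //; rewrite inE PQs orbT|exact: Qsx].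
  elim: (Qs) => [|P Ps IHP] PsP; first by exists 0%N.
  have [|B goodB] := IHP; first by move=> P' P'Ps; apply: PsP; rewrite inE P'Ps orbT.
  have [sP Px] := PsP P (mem_head _ _).
  have [[i0 Pi0]|noi] := pselect (exists i, P (y + t i * x)); last first.
    exists B => i Bi P'; rewrite inE => /orP[/eqP -> Pi|]; last exact: goodB.
    by apply: noi; exists i.
  exists (B + i0.+1)%N => i Bi P'; rewrite inE => /orP[/eqP -> Pi|]; last first.
    by apply: goodB; apply: leq_trans Bi; exact: leq_addr.
  apply: Px; apply: (@submZ_unit _ _ locR R^o P (t i - t i0)) => //.
    by apply: tP => E; move: Bi; rewrite E addnS ltnNge leq_addl.
  by rewrite scale_regE; apply: eqmem (submB sP Pi Pi0) _; ring.
exists (y + t B * x).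
  by apply: (submD sJ) => //; exact: (submZ (t B) sJ Jx).
move=> P; rewrite inE => /orP[/eqP -> Pi|]; last exact: goodB.
apply: Qy; apply: eqmem (submB sQ Pi (submZ (t B) sQ Qx)) _; rewrite scale_regE; ring.
Qed.

End Avoidance.

(** * Reductions of the maximal ideal *)

Section Reductions.
Variables (R : comNzRingType) (m : set R).
Hypothesis locR : noetherian_local m.
Hypothesis infR : infinite_set (cosets m).
Implicit Types (s t : seq R) (I : set R^o).

Let mpow (k : nat) : set R^o := iter k (@smul R R^o m) setT.

(** For [s] inside m the reverse inclusion is automatic, so this says that the ideal generated by
    [s] is a reduction of m, with reduction number at most [n]. *)
Definition reduction s n : Prop := mpow n.+1 `<=` msq s (mpow n).

Lemma msq_scale (M : lmodType R) t (L L' : set M) b z : submodule L' ->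
  (forall y, L y -> L' (b *: y)) -> msq t L z -> msq t L' (b *: z).
Proof.
move=> sL' LL'; have sT := submodule_msq t sL'.
apply: (@msq_min _ _ t L [set w | msq t L' (b *: w)]).
  split; first by rewrite /= scaler0; exact: subm0.
  move=> c u v /= Nu Nv; rewrite scalerDr scalerA mulrC -scalerA.
  by apply: submD => //; exact: submZ.
move=> c y ct Ly /=; rewrite scalerA mulrC -scalerA; apply: mem_msq => //; exact: LL'.
Qed.

Lemma msq_setT_mul t (M : lmodType R) (L : set M) b y : submodule L ->
  @msq R R^o t setT b -> L y -> msq t L (b *: y).
Proof.
move=> sL tb Ly; have := mem_smul tb Ly.
by rewrite smul_msq // smul_setT.
Qed.

Lemma mem_msq_setT t (b : R) : b \in t -> @msq R R^o t setT b.
Proof.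
move=> bt; have := @mem_msq R R^o t setT b 1 (submodule_setT _) bt I.
by rewrite scale_regE mulr1.
Qed.

Let submodule_mpow i : submodule (mpow i).
Proof. exact: submodule_iter_smul. Qed.

Lemma reduction_iter s n k : reduction s n -> mpow (n + k) `<=` iter k (msq s) (mpow n).
Proof.
move=> red; have red_add i : mpow (n + i).+1 `<=` msq s (mpow (n + i)).
  elim: i => [|i IH]; first by rewrite addn0.
  rewrite addnS; apply: smul_min; first exact: submodule_msq.
  move=> b z mb /IH; apply: msq_scale => // y iy.
  exact: (@mem_smul R R^o m (mpow (n + i)) b y mb iy).
elim: k => [|k IH]; first by rewrite addn0.
rewrite addnS; apply: subset_trans (red_add k) _.
by apply: (@msqS _ _ s s) => //; exact: submodule_iter_msq.
Qed.

Lemma reduction_spow s n k : reduction s n -> mpow (n + k) `<=` @spow R R^o s k.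
Proof.
move=> red y /(reduction_iter red); elim: k y => [//|k IH] y.
by apply: msqS => //; exact: submodule_spow.
Qed.

Section Step.
Variables (a : R) (ys : seq R).
Let s := a :: ys.
Let g := size ys.

(** The linear forms in [s] that vanish at the point with coordinate 1 at [a] and coordinates [th]
    at [ys]. *)
Definition shear (th : 'I_g -> R) : seq R := [seq ys`_i - th i * a | i : 'I_g].

(* [x] is a form of degree [n] in [s] with value [c] at the point [(1, th)]. *)
Definition form_value (th : 'I_g -> R) (n : nat) (x c : R) : Prop :=
  @spow R R^o s n x /\ @msq R R^o (shear th) (spow s n.-1) (x - c * a ^+ n).

Lemma submodule_shear th n : submodule (msq (shear th) (@spow R R^o s n)).
Proof. by apply: submodule_msq; exact: submodule_spow. Qed.

(** The linear form w + ea has the value e, since w vanishes at the point; values are multiplied. *)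
Lemma form_value_mul th n x c w e : form_value th n x c ->
  @msq R R^o s setT (w + e * a) -> @msq R R^o (shear th) setT w ->
  form_value th n.+1 ((w + e * a) * x) (e * c).
Proof.
move=> [xn xc] sw tw; have sp := @submodule_spow R R^o; split.
  exact: (@msq_setT_mul s R^o _ _ _ (sp s n) sw xn).
have -> : (w + e * a) * x - e * c * a ^+ n.+1 = w * x + e * (a * (x - c * a ^+ n)).
  by rewrite exprS; ring.
apply: (submD (submodule_shear th n)).
  exact: (@msq_setT_mul _ R^o _ _ _ (sp s n) tw xn).
apply: (submZ e (submodule_shear th n)).
apply: (@msq_scale R^o (shear th) (spow s n.-1) _ a _ (sp s n) _ xc).
case: (n) => [//|k] y /= sy; apply: (@mem_msq R R^o s _ a _ (sp s k) _ sy).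
exact: mem_head.
Qed.

Lemma form_value_linear th n x c y e b : form_value th n x c -> form_value th n y e ->
  form_value th n (b * x + y) (b * c + e).
Proof.
move=> [xn xc] [yn ye]; have sp := @submodule_spow R R^o; split.
  by apply: (submD (sp _ _)) => //; exact: (submZ b (sp _ _) xn).
apply: eqmem (submD (submodule_shear th n.-1) (submZ b (submodule_shear th n.-1) xc) ye) _.
by rewrite scale_regE; ring.
Qed.

Lemma form_value_ex th n (x : R) : @spow R R^o s n x -> exists c, form_value th n x c.
Proof.
elim: n x => [|n IH] x.
  move=> _; exists x; split=> //; rewrite expr0 mulr1 subrr; exact: (subm0 (submodule_shear _ _)).
have st := submodule_shear th n.
have sX : @submodule R R^o [set x | exists c, form_value th n.+1 x c].
  split; first by exists 0; split; [exact: (subm0 (@submodule_spow R R^o s n.+1))|rewrite mul0r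
    subrr; exact: (subm0 st)].
  by move=> b u v [c uc] [e ve]; exists (b * c + e); exact: form_value_linear.
apply: (@msq_min R R^o s _ _ sX) => b y bs yn.
have [c yc] := IH y yn.
have sb : @msq R R^o s setT b by exact: mem_msq_setT.
have [w [e [bE tw]]] : exists w e, b = w + e * a /\ @msq R R^o (shear th) setT w.
  move: bs; rewrite inE => /orP[/eqP ->|/(nthP 0) [i lis <-]].
    by exists 0, 1; split; [ring|exact: (subm0 (@submodule_msq R R^o _ _ (submodule_setT R^o)))].
  exists (ys`_i - th (Ordinal lis) * a), (th (Ordinal lis)); split; first by ring.
  by apply: mem_msq_setT; apply/fintype.imageP; exists (Ordinal lis).
exists (e * c); rewrite scale_regE bE; apply: form_value_mul => //.
by rewrite -bE.
Qed.

Hypothesis ms : forall b, b \in s -> m b.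

Lemma shear_sub th b : b \in shear th -> m b.
Proof.
move=> /fintype.imageP [i _ ->]; have sm := ideal_max locR.
apply: (submB sm); first by apply: ms; rewrite inE mem_nth ?orbT.
by apply: (submZ (th i) sm); apply: ms; exact: mem_head.
Qed.

Let spow_msub n : @spow R R^o s n.+1 `<=` smul m (@spow R R^o s n).
Proof.
apply: msq_min; first exact: submodule_smul.
by move=> b y /ms mb ny; exact: mem_smul.
Qed.

Let flen_spow n k j : reduction s n -> (k <= j)%N -> flen m (@spow R R^o s j) (spow s k).
Proof.
move=> red kj; apply: (@flen_noeth _ _ R^o _ _ (n + j)) => //.
- exact: noeth_ring locR.
- exact: submodule_spow.
- exact: submodule_spow.
- exact: (@iter_msq_sub R R^o s k j setT).
apply: subset_trans (@reduction_spow s n j red).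
elim: (n + j)%N => [//|i IH]; rewrite iterS /mpow iterS; exact: smulS.
Qed.

(* The form [a^n] is nonzero at every point of the chart, so Lagrange's
   interpolation forms show that [s^n / m s^n] is large. *)
Lemma len_spow_ge (t : nat -> R) B n :
  (forall i j, i <> j -> ~ m (t i - t j)) ->
  (forall th, ~ addm (msq (shear th) (@spow R R^o s n.-1)) (smul m (@spow R R^o s n)) (a ^+ n)) ->
  (g * B.+1 <= n)%N -> flen m (@spow R R^o s n.+1) (spow s n) ->
  (B.+1 ^ g <= len m (@spow R R^o s n.+1) (spow s n))%N.
Proof.
move=> tP nonred gBn fsn.
have sp := @submodule_spow R R^o s.
have sm n' : submodule (smul m (@spow R R^o s n')) by exact: submodule_smul.
have [_ fm ->] := len_add locR fsn (sm n) (@spow_msub n) (smul_sub (sp n)).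
apply: leq_trans (leq_addl _ _).
pose T := {ffun 'I_g -> 'I_B.+1}.
pose pt (ph : T) (i : 'I_g) : R := t (ph i).
(* For p = (i, j) the factor [lf ph' p] is y_i - t_j a, replaced by [a] when j = ph' i so that the
   number of factors is always g(B + 1). Its value at the grid point [ph] is [le ph ph' p], and [lw]
   is the remainder that vanishes there. A power of [a], of value 1, completes the degree to [n]. *)
pose lw (ph ph' : T) (p : 'I_g * 'I_B.+1) : R :=
  if p.2 == ph' p.1 then 0 else ys`_p.1 - t (ph p.1) * a.
pose le (ph ph' : T) (p : 'I_g * 'I_B.+1) : R :=
  if p.2 == ph' p.1 then 1 else t (ph p.1) - t p.2.
pose lf (ph' : T) (p : 'I_g * 'I_B.+1) : R :=
  if p.2 == ph' p.1 then a else ys`_p.1 - t p.2 * a.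
have lfE ph ph' p : lf ph' p = lw ph ph' p + le ph ph' p * a.
  by rewrite /lf /lw /le; case: ifP => _; ring.
have ssp (b : R) : b \in s -> @msq R R^o s setT b by exact: mem_msq_setT.
have sas : @submodule R R^o (msq s setT) by exact: submodule_msq.
have lfs ph' p : @msq R R^o s setT (lf ph' p).
  rewrite /lf; case: ifP => _; first by apply: ssp; exact: mem_head.
  apply: (submB sas); first by apply: ssp; rewrite inE mem_nth ?orbT.
  by apply: (submZ (t p.2) sas); apply: ssp; exact: mem_head.
pose k := (n - g * B.+1)%N.
pose L (ph' : T) : R^o := (\prod_p lf ph' p) * a ^+ k.
pose E (ph ph' : T) : R := \prod_p le ph ph' p.
have formL ph ph' : form_value (pt ph) n (L ph') (E ph ph').
  have base j : form_value (pt ph) j (a ^+ j) 1.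
    split; last by rewrite mul1r subrr; exact: (subm0 (submodule_shear _ _)).
    elim: j => [//|j IHj]; rewrite exprS.
    by apply: (@mem_msq R R^o s _ a _ (sp j) _ IHj); exact: mem_head.
  have -> : n = (#|{: 'I_g * 'I_B.+1}| + k)%N.
    by rewrite card_prod !card_ord /k subnKC.
  rewrite /L /E cardT -[enum _]/(enum {: 'I_g * 'I_B.+1}) -!big_enum /=.
  elim: (enum _) => [|p r IH] /=.
    by rewrite !big_nil mul1r; exact: base.
  rewrite !big_cons addSn (lfE ph) -mulrA; apply: form_value_mul => //.
    by rewrite -lfE.
  rewrite /lw; case: ifP => _; first by exact: (subm0 (@submodule_msq R R^o _ _ (submodule_setT
    R^o))).
  by apply: mem_msq_setT; apply/fintype.imageP; exists p.1.
have Ene ph ph' : ph <> ph' -> E ph ph' = 0.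
  move=> ne; have [i /eqP phi] : exists i, ph i != ph' i.
    by apply/existsP; apply: contra_notT ne => /existsPn h; apply/ffunP => i; apply/eqP/negPn.
  rewrite /E (bigD1 (i, ph i)) //= {1}/le /=; case: eqP => // _.
  by rewrite subrr mul0r.
have Eeq ph : ~ m (E ph ph).
  have pm := prime_max locR.
  rewrite /E; elim/big_rec: _ => [|p x _ mx]; first exact: max_not1.
  move=> mex; case: pm => _ _ /(_ _ _ mex) [|//]; rewrite /le.
  case: eqP => [_|ne]; first exact: max_not1.
  by apply: tP => /val_inj /esym.
have -> : (B.+1 ^ g)%N = #|{: T}| by rewrite card_ffun !card_ord.
apply: (@len_ge_family _ _ locR R^o _ _ T L) => // [ph|c Lc ph].
  by have [] := formL ph ph.
apply: contrapT => mc; apply: (nonred (pt ph)).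
have st := submodule_shear (pt ph) n.-1.
have form_sum : form_value (pt ph) n (\sum_ph' c ph' * L ph') (\sum_ph' c ph' * E ph ph').
  elim/big_rec2: _ => [|ph' x y _]; last exact: form_value_linear.
  by split; [exact: (subm0 (sp n))|rewrite mul0r subrr; exact: (subm0 st)].
have sumE : \sum_ph' c ph' * E ph ph' = c ph * E ph ph.
  rewrite (bigD1 ph) //= big1 ?addr0 // => ph' /eqP ne.
  by rewrite Ene ?mulr0 // => /esym.
rewrite sumE in form_sum.
have [|u uE] := @max_unit _ _ locR (c ph * E ph ph).
  by move=> mcE; case: (prime_max locR) => _ _ /(_ _ _ mcE); case; [exact: mc|exact: Eeq].
have sH := submodule_addm st (sm n).
have -> : a ^+ n = u * (c ph * E ph ph * a ^+ n) by rewrite !mulrA -(mulrA u) uE mul1r.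
apply: (submZ u sH); case: form_sum => _ h.
apply: (submBr sH _ (sub_addml (sm n) h)); exact: (sub_addmr st Lc).
Qed.

(** If a power of [a] is redundant at some point of the chart, the [g] sheared elements form a
    reduction. Otherwise s^j / s^(j+1) has length at least (B + 1)^g for all j >= g(B + 1), too much
    for colengths bounded with degree d <= g. *)
Lemma reduction_step c d n : reduction s n -> (d <= g)%N ->
  (forall k, exists2 l, (l <= c * (k + d) ^ d)%N & clen m (mpow k.+1) setT l) ->
  exists s' n', [/\ size s' = g, forall b, b \in s' -> m b & reduction s' n'].
Proof.
move=> red dg growth; have [t tP] := infinite_residues locR infR.
have sp := @submodule_spow R R^o s.
have [[th [k thk]]|nonred] := pselect (exists th k,
    addm (msq (shear th) (@spow R R^o s k)) (smul m (@spow R R^o s k.+1)) (a ^+ k.+1)).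
  exists (shear th), (n + k)%N; split; first by rewrite size_map size_enum_ord.
    by move=> b; exact: shear_sub.
  (* Every form of degree k + 1 is its value times a^(k+1) modulo the sheared elements, so
     redundancy of that one power makes s^(k+1) redundant up to m s^(k+1), and Nakayama's lemma
     applies. *)
  have nak : @spow R R^o s k.+1 `<=` msq (shear th) (@spow R R^o s k).
    apply: (Nakayama locR (noeth_ring locR) (submodule_shear _ _) (sp _)).
    move=> x /(form_value_ex th) [e [_ xe]].
    have sH : submodule (addm (msq (shear th) (@spow R R^o s k)) (smul m (@spow R R^o s k.+1))).
      by apply: submodule_addm; [exact: submodule_shear|exact: submodule_smul].
    apply: (submBl sH (submZ e sH thk)); apply: sub_addml => //; exact: submodule_smul.
  rewrite /reduction -addnS; apply: subset_trans (@reduction_iter s n k.+1 red) _.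
  rewrite -smul_spow; last exact: submodule_mpow.
  apply: subset_trans (smulS nak (@subset_refl _ _)) _.
  rewrite smul_msq; [|exact: submodule_mpow|exact: sp].
  apply: msqS => //; first exact: submodule_mpow.
  rewrite smul_spow; last exact: submodule_mpow.
  elim: (k) => [|i IH]; first by rewrite addn0.
  rewrite addnS; apply: (@msq_min R R^o s); first exact: (submodule_mpow (n + i).+1).
  by move=> b y /ms mb /IH iy; exact: (@mem_smul R R^o m (mpow (n + i)) b y mb iy).
have nonred' th k : ~ addm (msq (shear th) (@spow R R^o s k.-1)) (smul m (@spow R R^o s k)) (a
  ^+ k).
  case: k => [|k]; last by move=> h; apply: nonred; exists th, k.
  have sm := ideal_max locR; move=> h; apply: (max_not1 locR); move: h; rewrite expr0.
  apply: (@addm_min R R^o) => //.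
    by apply: msq_min => // b y /shear_sub mb _; rewrite scale_regE mulrC; exact: max_mul.
  by apply: smul_min => // b y mb _; rewrite scale_regE mulrC; exact: max_mul.
(* With N = g(B + 1) + B + 1 the length of R / s^N is at least (B + 1)^(g+1). It is at most that of
   R / m^(n+N), hence at most c (C(B + 1))^d = B(B + 1)^d. These bounds contradict each other as d
   <= g. *)
pose C := (n + d + g).+1; pose B := (c * C ^ d)%N; pose N0 := (g * B.+1)%N.
have lower K : (K * B.+1 ^ g <= len m (@spow R R^o s (N0 + K)) setT)%N.
  elim: K => [|K IH]; first by rewrite mul0n.
  have fK := @flen_spow n 0%N (N0 + K.+1)%N red (leq0n _).
  have fKK := @flen_spow n (N0 + K)%N (N0 + K).+1 red (leqnSn _).
  rewrite addnS in fK *.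
  have [_ _ ->] := len_add locR fK (sp (N0 + K)%N) (@iter_msq_sub R R^o s _ _ setT
    (submodule_setT _) (leqnSn _)) (@subsetT _ _).
  rewrite mulSn; apply: leq_add => //.
  by apply: (len_spow_ge tP) => //; exact: leq_addr.
pose N := (N0 + B.+1)%N.
have [l ll lN] := growth (n + N).-1.
have NE : (n + N).-1.+1 = (n + N)%N by rewrite /N addnS addnS.
rewrite NE in lN.
have [_ _ lenE] := len_add locR (ex_intro _ l lN) (sp N) (@reduction_spow s n N red) (@subsetT _
  _).
have := lower B.+1; rewrite -/N => lowerN.
have upper : (len m (@spow R R^o s N) setT <= c * (C * B.+1) ^ d)%N.
  apply: leq_trans (_ : (l <= _)%N).
    by rewrite -(clen_len locR lN) lenE leq_addl.
  apply: leq_trans ll _; rewrite leq_mul2l; apply/orP; right.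
  have [->|d0] := posnP d; first by rewrite !expn0.
  by rewrite leq_exp2r // /N /N0 /C; nia.
have := leq_trans lowerN upper; rewrite expnMn mulnA -/B -expnS => le.
have : (B.+1 ^ d.+1 <= B * B.+1 ^ d)%N by apply: leq_trans le; rewrite leq_pexp2l.
by rewrite expnS leq_pmul2r ?expn_gt0 // ltnn.
Qed.

End Step.

Lemma exists_reduction d c :
  (forall k, exists2 l, (l <= c * (k + d) ^ d)%N & clen m (mpow k.+1) setT l) ->
  exists s n, [/\ size s = d, forall b, b \in s -> m b & reduction s n].
Proof.
move=> growth.
have [s0 s0m] := noeth_ring locR (ideal_max locR).
have ms0 b : b \in s0 -> m b by move=> bs; rewrite s0m; exact: mem_spans.
have red0 : reduction s0 0.
  apply: smul_min; first exact: submodule_msq.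
  move=> b y mb _; have : spans s0 b by rewrite -s0m.
  apply: (@spans_min R R^o s0 [set b | msq s0 [set: R^o] (b *: y)]).
    split=> [|e u v Xu Xv]; first by rewrite /= scale0r; exact:
      (subm0 (submodule_msq _ (submodule_setT _))).
    have s0T := @submodule_msq R R^o s0 _ (submodule_setT _).
    have h : @msq R R^o s0 setT ((e * u + v) * y).
      by apply: eqmem (submD s0T (submZ e s0T Xu) Xv) _; rewrite !scale_regE; ring.
    exact: h.
  by move=> v vs; exact: mem_msq.
have : exists s n, [/\ (d <= size s)%N, forall b, b \in s -> m b & reduction s n].
  (* The zeros guarantee at least [d] elements, from which one can descend to exactly [d]. *)
  exists (s0 ++ nseq d 0), 0%N; split; first by rewrite size_cat size_nseq leq_addl.
    move=> b; rewrite mem_cat => /orP[/ms0 //|/nseqP[-> _]]; exact: (subm0 (ideal_max locR)).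
  by apply: subset_trans red0 _; apply: msqS => // b bs; rewrite mem_cat bs.
move=> [s [n [ds ms red]]].
have [k] := ubnP (size s - d); elim: k s n ds ms red => // k IH s n ds ms red.
case: (ltngtP d (size s)) ds => // [dlt _|dE _ _]; last by exists s, n.
case: s dlt ms red => [//|a ys] dlt ms red sk.
have [s' [n' [ss' ms' red']]] := reduction_step ms red dlt growth.
by apply: (IH s' n'); rewrite ?ss' //; move: dlt sk => /=; lia.
Qed.

End Reductions.

(** * Ext of the residue field *)

Section HomMap.
Variables (R : comNzRingType) (M : lmodType R).
Implicit Types (N : set M).
Local Ltac meq := module_eq R M.

Lemma hom_mapP p q (A : 'M[R]_(p, q)) a (u v : {ffun 'I_q -> M}) :
  hom_map A (a *: u + v) = a *: hom_map A u + hom_map A v.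
Proof.
apply/ffunP => l; rewrite !ffunE scaler_sumr -big_split /=; apply: eq_bigr => j _.
by rewrite !ffunE scalerDr !scalerA (mulrC a).
Qed.

Lemma hom_mapB p q (A : 'M[R]_(p, q)) (u v : {ffun 'I_q -> M}) :
  hom_map A (u - v) = hom_map A u - hom_map A v.
Proof.
have := hom_mapP A (-1) v u; rewrite !scaleN1r addrC => ->; exact: addrC.
Qed.

Lemma hom_mapD p q (A : 'M[R]_(p, q)) (u v : {ffun 'I_q -> M}) :
  hom_map A (u + v) = hom_map A u + hom_map A v.
Proof. by have := hom_mapP A 1 u v; rewrite !scale1r. Qed.

Lemma hom_mapZ p q (A : 'M[R]_(p, q)) a (u : {ffun 'I_q -> M}) :
  hom_map A (a *: u) = a *: hom_map A u.
Proof.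
apply/ffunP => l; rewrite !ffunE scaler_sumr; apply: eq_bigr => j _.
by rewrite !ffunE !scalerA (mulrC a).
Qed.

Lemma hom_map_mul p q r (A : 'M[R]_(p, q)) (B : 'M[R]_(q, r)) (w : {ffun 'I_r -> M}) :
  hom_map (A *m B) w = hom_map A (hom_map B w).
Proof.
apply/ffunP => l; rewrite !ffunE.
under eq_bigr => j _ do rewrite mxE scaler_suml.
rewrite exchange_big; apply: eq_bigr => k _; rewrite ffunE scaler_sumr.
by apply: eq_bigr => j _; rewrite scalerA.
Qed.

Lemma hom_map_add p q (A B : 'M[R]_(p, q)) (w : {ffun 'I_q -> M}) :
  hom_map (A + B) w = hom_map A w + hom_map B w.
Proof.
apply/ffunP => l; rewrite !ffunE -big_split /=; apply: eq_bigr => j _.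
by rewrite mxE scalerDl.
Qed.

Lemma hom_map_scalar p (a : R) (w : {ffun 'I_p -> M}) : hom_map a%:M w = a *: w.
Proof.
apply/ffunP => l; rewrite !ffunE (bigD1 l) //= mxE eqxx mulr1n big1 ?addr0 // => j /negPf nj.
by rewrite mxE eq_sym nj mulr0n scale0r.
Qed.

Lemma hom_map0 p q (w : {ffun 'I_q -> M}) : hom_map (0 : 'M[R]_(p, q)) w = 0.
Proof.
by apply/ffunP => l; rewrite !ffunE big1 // => j _; rewrite mxE scale0r.
Qed.

Lemma hom_mapr0 p q (A : 'M[R]_(p, q)) : hom_map A (0 : {ffun 'I_q -> M}) = 0.
Proof. by have := hom_mapZ A 0 0; rewrite !scale0r. Qed.

Definition ffun_in N p : set {ffun 'I_p -> M} := [set w | forall j, N (w j)].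

Lemma submodule_ffun_in N p : submodule N -> submodule (@ffun_in N p).
Proof.
move=> sN; split=> [j|a u v Nu Nv j]; rewrite !ffunE; first exact: subm0.
by apply: submD => //; exact: submZ.
Qed.

Lemma hom_map_in N p q (A : 'M[R]_(p, q)) w : submodule N ->
  ffun_in N w -> ffun_in N (hom_map A w).
Proof. by move=> sN Nw l; rewrite ffunE; apply: subm_sum => // j _; exact: submZ. Qed.

End HomMap.

(** The linear relation [T] acts as an isomorphism from Z / B to Z' / B'. It need not be
    single-valued on representatives, which suits connecting maps. *)
Lemma residue_dim_transfer (R : comNzRingType) (m : set R) (X X' : lmodType R)
    (Z B : set X) (Z' B' : set X') (T : X -> X' -> Prop) n :
  T 0 0 -> (forall a x x' y y', T x x' -> T y y' -> T (a *: x + y) (a *: x' + y')) ->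
  (forall z, Z z -> exists2 z', Z' z' & T z z') ->
  (forall z', Z' z' -> exists2 z, Z z & T z z') ->
  (forall z z', T z z' -> B z <-> B' z') ->
  has_residue_dim m Z B n -> has_residue_dim m Z' B' n.
Proof.
move=> T0 TS Tl Tr TB [v [vZ vgen vfree]].
have [v' v'P] := choice (fun i => let: ex_intro2 x p q := Tl _ (vZ i) in ex_intro _ x (conj p q)).
have Tsum (a : 'I_n -> R) : T (\sum_i a i *: v i) (\sum_i a i *: v' i).
  elim/big_rec2: _ => // i y y' _ Ty; apply: TS => //.
  by have [] := v'P i.
exists v'; split=> [i|z' /Tr [z /vgen [a Ba] Tz]|a].
- by have [] := v'P i.
- exists a; apply/(TB _ _ _).1: Ba.
  have := TS (-1) _ _ _ _ (Tsum a) Tz.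
  by rewrite !scaleN1r ![- _ + _]addrC.
- by move/(TB _ _ (Tsum a)).2; exact: vfree.
Qed.

Section Resolution.
Variables (R : comNzRingType) (m : set R).
Hypothesis locR : noetherian_local m.
Variables (b : nat -> nat) (eps : 'cV[R]_(b 0%N)) (D : forall i, 'M[R]_(b i.+1, b i)).
Hypothesis resD : residue_resolution m eps D.

Lemma lift_rows p q r (A : 'M[R]_(p, q)) (B : 'M[R]_(r, q)) :
  (forall i, exists v : 'rV_r, row i A = v *m B) -> exists C : 'M[R]_(p, r), A = C *m B.
Proof.
move=> /choice [v vP]; exists (\matrix_i v i); apply/row_matrixP => i.
by rewrite row_mul rowK.
Qed.

Lemma resolution_comp i : D i.+1 *m D i = 0.
Proof.
case: resD => _ _ ex; apply/row_matrixP => k; rewrite row_mul row0.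
apply/ex; exists (delta_mx 0 k); exact: rowE.
Qed.

Lemma homotopy0 a : m a -> exists h, a%:M = h *m D 0%N.
Proof.
move=> ma; case: resD => _ ex0 _; apply: lift_rows => i; apply/ex0.
have sm := ideal_max locR.
rewrite mxE; apply: (@subm_sum R R^o m _ _ _ _ sm) => j _; rewrite mulrC; apply: (submZ _ sm).
by rewrite !mxE; case: eqP => _; rewrite ?mulr1n ?mulr0n //; exact: (subm0 sm).
Qed.

(** Multiplication by an element of m is zero on R / m, hence null-homotopic on the resolution. This
    is why m annihilates Ext from R / m. *)
Lemma homotopy a i : m a -> exists h h', a%:M = D i *m h + h' *m D i.+1.
Proof.
move=> ma; have [_ _ ex] := resD.
have next h : a *: D i = D i *m h *m D i ->
    exists h', a%:M = D i *m h + h' *m D i.+1.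
  move=> hE; have [|h' h'E] := @lift_rows _ _ _ (a%:M - D i *m h) (D i.+1).
    move=> k; apply/ex; rewrite -row_mul mulmxBl mul_scalar_mx hE subrr row0 //.
  by exists h'; rewrite -h'E addrC subrK.
suff [h hE] : exists h, a *: D i = D i *m h *m D i.
  by have [h' h'E] := next h hE; exists h, h'.
elim: i {next} => [|i [h hE]].
  by have [h hE] := homotopy0 ma; exists h; rewrite -mulmxA -hE mul_mx_scalar.
have [|h' h'E] := @lift_rows _ _ _ (a%:M - D i *m h) (D i.+1).
  by move=> k; apply/ex; rewrite -row_mul mulmxBl mul_scalar_mx hE subrr row0.
exists h'; rewrite -mulmxA -h'E mulmxBr mulmxA resolution_comp mul0mx subr0.
by rewrite mul_mx_scalar.
Qed.

Section Cohomology.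
Variable M : lmodType R.
Implicit Types (N : set M).
Local Ltac meq := module_eq R M.

(* The cocycles and coboundaries of Hom(D, M / N), as submodules of powers of [M]. *)
Definition coZ i N : set {ffun 'I_(b i) -> M} := [set w | ffun_in N (hom_map (D i) w)].

Definition coB i N : set {ffun 'I_(b i) -> M} :=
  match i return set {ffun 'I_(b i) -> M} with
  | 0%N => @ffun_in R M N _
  | j.+1 => [set w | exists u, ffun_in N (w - hom_map (D j) u)]
  end.

Arguments coZ : clear implicits.
Arguments coB : clear implicits.

Definition ext_zero i N : Prop := coZ i N `<=` coB i N.

Definition ext_dim i N n : Prop := has_residue_dim m (coZ i N) (coB i N) n.

Lemma coZ0_max N w a : submodule N -> coZ 0 N w -> m a -> ffun_in N (a *: w).
Proof.
move=> sN Zw /homotopy0 [h hE]; rewrite -hom_map_scalar hE hom_map_mul.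
exact: hom_map_in.
Qed.

Lemma coZS_max N i w a : submodule N -> coZ i.+1 N w -> m a ->
  exists u, ffun_in N (a *: w - hom_map (D i) u).
Proof.
move=> sN Zw /(homotopy i) [h [h' hE]]; exists (hom_map h w).
rewrite -hom_map_scalar hE hom_map_add !hom_map_mul addrC addKr.
exact: hom_map_in.
Qed.

Lemma ffun_in_reg N a p (w : {ffun 'I_p -> M}) : regular_on N a ->
  ffun_in N (a *: w) -> ffun_in N w.
Proof. by move=> ra Nw j; apply: ra; have := Nw j; rewrite ffunE. Qed.

Lemma ffun_in_addsc N a p (w : {ffun 'I_p -> M}) : ffun_in (addsc N a) w ->
  exists u, ffun_in N (w - a *: u).
Proof.
by move=> /choice [u uP]; exists [ffun j => u j] => j; rewrite !ffunE.
Qed.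

Lemma addsc_ffun_in N a p (w u : {ffun 'I_p -> M}) : ffun_in N (w - a *: u) ->
  ffun_in (addsc N a) w.
Proof. by move=> Nwu j; exists (u j); have := Nwu j; rewrite !ffunE. Qed.

(* The connecting map: [w] mod [N + a M] is sent to [u] with [D w = a u] mod [N]. *)
Definition connects N a i (w : {ffun 'I_(b i) -> M}) (u : {ffun 'I_(b i.+1) -> M}) : Prop :=
  [/\ coZ i (addsc N a) w, coZ i.+1 N u & ffun_in N (hom_map (D i) w - a *: u)].

Section Connecting.
Variables (N : set M) (a : R).
Hypotheses (sN : submodule N) (ma : m a) (ra : regular_on N a).

Let sf p := @submodule_ffun_in R M N p sN.

Lemma connects_l i w : coZ i (addsc N a) w -> exists2 u, coZ i.+1 N u & connects N a w u.
Proof.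
move=> Zw; have [u wu] := ffun_in_addsc Zw.
have Zu : coZ i.+1 N u.
  apply: (ffun_in_reg ra); have := hom_map_in (D i.+1) sN wu.
  rewrite hom_mapB -hom_map_mul resolution_comp hom_map0 sub0r hom_mapZ => h.
  by rewrite -[_ *: _]opprK; exact: (submN (sf _) h).
by exists u.
Qed.

(** The connecting map is onto because [a] annihilates the next Ext: au is a coboundary Dw modulo
    N. *)
Lemma connects_r i u : coZ i.+1 N u -> exists2 w, coZ i (addsc N a) w & connects N a w u.
Proof.
move=> Zu; have [w uw] := coZS_max sN Zu ma.
have wu : ffun_in N (hom_map (D i) w - a *: u) by exact: (submBC (sf _) uw).
have Zw : coZ i (addsc N a) w by exact: addsc_ffun_in wu.
by exists w.
Qed.

Lemma connects_coB_r i w u : connects N a w u -> coB i (addsc N a) w -> coB i.+1 N u.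
Proof.
move=> [_ _ wu] Bw.
have [w' [u' ww']] : exists w' u', ffun_in N (w - (w' + a *: u')) /\
    hom_map (D i) w' = 0.
  case: i w u wu Bw => [|i] w u wu /=.
    by move=> /ffun_in_addsc [u' wu']; exists 0, u'; rewrite add0r hom_mapr0.
  move=> [v /ffun_in_addsc [u' wvu']]; exists (hom_map (D i) v), u'.
  by rewrite opprD addrA -hom_map_mul resolution_comp hom_map0.
have [{}ww' w'0] := ww'; exists u'.
apply: (ffun_in_reg ra); have := hom_map_in (D i) sN ww'.
rewrite hom_mapB hom_mapD w'0 add0r hom_mapZ => h.
apply: eqmem (submB (sf _) h wu) _.
by module_eq R {ffun 'I_(b i.+1) -> M}.
Qed.

(** Injectivity of the connecting map: if u = Dv modulo N, then w - av is a cocycle modulo N, hence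
    a coboundary by the vanishing in degree [i]. *)
Lemma connects_coB_l i w u : ext_zero i N -> connects N a w u ->
  coB i.+1 N u -> coB i (addsc N a) w.
Proof.
move=> e0 [_ _ wu] [v uv].
have : coZ i N (w - a *: v).
  rewrite /coZ /= hom_mapB hom_mapZ.
  apply: eqmem (submD (sf _) wu (submZ a (sf _) uv)) _.
  by module_eq R {ffun 'I_(b i.+1) -> M}.
move=> /e0; case: i w u v wu uv {e0} => [|i] w u v wu uv /=.
  exact: addsc_ffun_in.
move=> [t wt]; exists t; apply: (@addsc_ffun_in _ _ _ _ v).
by apply: eqmem wt _; module_eq R {ffun 'I_(b i.+1) -> M}.
Qed.

Lemma ext_zero_lift i : ext_zero i (addsc N a) -> ext_zero i.+1 N.
Proof.
by move=> e0 u /connects_r [w /e0 Bw wu]; exact: connects_coB_r wu Bw.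
Qed.

Lemma ext_zero_quot i : ext_zero i N -> ext_zero i.+1 N -> ext_zero i (addsc N a).
Proof.
by move=> e0 e1 w /connects_l [u /e1 Bu wu]; exact: connects_coB_l wu Bu.
Qed.

Lemma ext_zero0 : ext_zero 0 N.
Proof. by move=> w Zw; apply: (ffun_in_reg ra); exact: coZ0_max. Qed.

Lemma connects_linear i c w w' u u' : connects N a w u -> connects N a w' u' ->
  @connects N a i (c *: w + w') (c *: u + u').
Proof.
move=> [Zw Zu wu] [Zw' Zu' wu']; split.
- rewrite /coZ /= hom_mapP.
  have sa p := @submodule_ffun_in R M _ p (submodule_addsc a sN).
  exact: (submD (sa _) (submZ c (sa _) Zw) Zw').
- rewrite /coZ /= hom_mapP; apply: (submD (sf _)); last exact: Zu'.
  exact: (submZ c (sf _) Zu).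
rewrite hom_mapP; apply: eqmem (submD (sf _) (submZ c (sf _) wu) wu') _.
by module_eq R {ffun 'I_(b i.+1) -> M}.
Qed.

Lemma ext_dim_quot i n : ext_zero i N -> ext_dim i (addsc N a) n <-> ext_dim i.+1 N n.
Proof.
move=> e0.
have c0 : @connects N a i 0 0.
  split.
  - rewrite /coZ /= hom_mapr0; exact: (subm0 (submodule_ffun_in _ (submodule_addsc a sN))).
  - by rewrite /coZ /= hom_mapr0; exact: (subm0 (sf _)).
  - by rewrite hom_mapr0 scaler0 subr0; exact: (subm0 (sf _)).
have cB w u : @connects N a i w u -> coB i (addsc N a) w <-> coB i.+1 N u.
  by move=> wu; split; [exact: connects_coB_r|exact: connects_coB_l].
split.
  apply: (residue_dim_transfer (T := @connects N a i)) => //.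
  - by move=> *; exact: connects_linear.
  - exact: connects_l.
  - exact: connects_r.
apply: (residue_dim_transfer (T := fun u w => @connects N a i w u)) => //.
- by move=> *; exact: connects_linear.
- exact: connects_r.
- exact: connects_l.
- by move=> u w /cB ->.
Qed.

End Connecting.

Definition socle N : set M := [set y | forall a, m a -> N (a *: y)].

Lemma submodule_socle N : submodule N -> submodule (socle N).
Proof.
move=> sN; split=> [a _|c x y Sx Sy a ma]; first by rewrite scaler0; exact: subm0.
by apply: eqmem (submD sN (submZ c sN (Sx a ma)) (Sy a ma)) _; meq.
Qed.

(** Hom(R / m, M / N) is the socle of M / N: y corresponds to the family of all eps_j y. In the
    other direction y is the value at a vector [u0] which the augmentation sends to 1 modulo m. *)
Lemma ext_dim0 N n : submodule N -> ext_dim 0 N n <-> has_residue_dim m (socle N) N n.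
Proof.
move=> sN; have sf p := @submodule_ffun_in R M N p sN.
have [[u0 u0E] ex0 _] := resD; have sm := ideal_max locR.
pose T (y : M) (w : {ffun 'I_(b 0) -> M}) :=
  [/\ socle N y, coZ 0 N w & forall j, N (w j - eps j 0 *: y)].
have row0 (r : 'rV_(b 0)) w : m ((r *m eps) 0 0) -> coZ 0 N w ->
    N (\sum_j r 0 j *: w j).
  move=> /ex0 [v ->] Zw; have := hom_map_in v sN Zw.
  by rewrite -hom_map_mul => /(_ 0); rewrite ffunE.
have T00 : T 0 0.
  split; first exact: (subm0 (submodule_socle sN)).
    by rewrite /coZ /= hom_mapr0; exact: (subm0 (sf _)).
  by move=> j; rewrite ffunE scaler0 subr0; exact: subm0.
have TS c x x' y y' : T x x' -> T y y' -> T (c *: x + y) (c *: x' + y').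
  move=> [Sx Zx xx'] [Sy Zy yy']; split.
  - exact: (submD (submodule_socle sN) (submZ c (submodule_socle sN) Sx) Sy).
  - rewrite /coZ /= hom_mapP; exact: (submD (sf _) (submZ c (sf _) Zx) Zy).
  move=> j; rewrite !ffunE.
  move: (x' j) (y' j) (xx' j) (yy' j) => p q Np Nq.
  by apply: eqmem (submD sN (submZ c sN Np) Nq) _; meq.
have Tl y : socle N y -> exists2 w, coZ 0 N w & T y w.
  move=> Sy; have Zw : coZ 0 N [ffun j => eps j 0 *: y].
    move=> l; rewrite ffunE; under eq_bigr => j _ do rewrite ffunE scalerA.
    rewrite -scaler_suml; apply: Sy.
    have : m ((row l (D 0%N) *m eps) 0 0).
      by apply/ex0; exists (delta_mx 0 l); exact: rowE.
    by rewrite mxE; under eq_bigr => j _ do rewrite mxE.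
  exists [ffun j => eps j 0 *: y] => //; split=> // j.
  by rewrite ffunE subrr; exact: subm0.
have Tr w : coZ 0 N w -> exists2 y, socle N y & T y w.
  move=> Zw; pose y := \sum_j u0 0 j *: w j.
  have Sy : socle N y.
    move=> a ma; rewrite scaler_sumr.
    rewrite (eq_bigr (fun j => (a *: u0) 0 j *: w j)); last first.
      by move=> j _; rewrite mxE scalerA.
    apply: row0 => //; rewrite -scalemxAl mxE mulrC; exact: (submZ _ sm ma).
  exists y => //; split=> // j.
  have -> : w j - eps j 0 *: y = \sum_l (delta_mx 0 j - eps j 0 *: u0 : 'rV_(b 0)) 0 l *: w l.
    under eq_bigr => l _ do rewrite !mxE eqxx scalerBl.
    rewrite sumrB (bigD1 j) //= eqxx scale1r big1 ?addr0; last first.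
      by move=> l /negPf ->; rewrite scale0r.
    by congr (_ - _); rewrite scaler_sumr; apply: eq_bigr => l _; rewrite scalerA.
  apply: row0 => //; rewrite mulmxBl -rowE -scalemxAl !mxE.
  move: u0E; rewrite mxE; set e := \sum_k _ => mE.
  apply: eqmem (submN sm (submZ (eps j 0) sm mE)) _; rewrite scale_regE; ring.
have TB y w : T y w -> N y <-> coB 0 N w.
  move=> [Sy Zw yw]; split=> [Ny j|Nw].
    by apply: submBl (yw j) => //; exact: submZ.
  have Ney j : N (eps j 0 *: y) by apply: submBr (Nw j) (yw j).
  have := Sy _ u0E; rewrite scalerBl scale1r => h; apply: submBr h => //.
  by rewrite mxE scaler_suml; apply: subm_sum => // j _; rewrite -scalerA; exact: submZ.
split.
  apply: (residue_dim_transfer (T := fun w y => T y w)) => //.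
    by move=> *; exact: TS.
  by move=> w y /TB [? ?]; split.
by apply: (residue_dim_transfer (T := T)).
Qed.

Lemma ext_zero0_socle N : submodule N -> ext_zero 0 N -> socle N `<=` N.
Proof.
move=> sN e0 y Sy.
have [_ h] : True /\ has_residue_dim m (coZ 0 N) (coB 0 N) 0.
  split=> //; exists (fun=> 0); split=> [[]//|w /e0 Bw|a _ []//].
  by exists (fun=> 0); rewrite big_ord0 subr0.
have [v [_ vg _]] := (ext_dim0 0 sN).1 h; have [a] := vg y Sy.
by rewrite big_ord0 subr0.
Qed.

Lemma wreg_ext_zero N s : submodule N -> (forall a, a \in s -> m a) -> wreg N s ->
  forall i, (i < size s)%N -> ext_zero i N.
Proof.
elim: s N => [//|a s IH] N sN ms [ra ws] [|i] lis.
  by apply: (ext_zero0 sN (ms a (mem_head _ _)) ra).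
apply: (ext_zero_lift sN (ms a (mem_head _ _)) ra).
apply: IH => //; first exact: submodule_addsc.
by move=> c cs; apply: ms; rewrite inE cs orbT.
Qed.

Lemma ext_zero_wreg N s k : submodule N -> (forall a, a \in s -> m a) -> wreg N s ->
  (forall i, (i < size s + k)%N -> ext_zero i N) ->
  forall i, (i < k)%N -> ext_zero i (addm N (msq s setT)).
Proof.
elim: s N => [|a s IH] N sN ms /=; first by rewrite addm0.
move=> [ra ws] eN; rewrite addm_msq1 //; apply: IH => //.
- exact: submodule_addsc.
- by move=> c cs; apply: ms; rewrite inE cs orbT.
move=> i lis; apply: (ext_zero_quot sN ra); apply: eN.
  by apply: leq_trans lis _; rewrite addSn.
by rewrite addSn ltnS.
Qed.

(** The isomorphism of Rees: each element of the regular sequence lowers the degree by one, and in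
    degree 0 the socle remains. *)
Lemma ext_dim_wreg N s n : submodule N -> (forall a, a \in s -> m a) -> wreg N s ->
  ext_dim (size s) N n <->
  has_residue_dim m (socle (addm N (msq s setT))) (addm N (msq s setT)) n.
Proof.
elim: s N => [|a s IH] N sN ms /=; first by rewrite addm0 => _; exact: ext_dim0.
move=> [ra ws]; rewrite addm_msq1 //; have ma := ms a (mem_head _ _).
rewrite -IH //.
- apply: iff_sym; apply: ext_dim_quot => //.
  by apply: (@wreg_ext_zero N (a :: s)).
- exact: submodule_addsc.
- by move=> c cs; apply: ms; rewrite inE cs orbT.
Qed.

Lemma ext_dim_Defs i n : has_residue_dim m (@cocycles R M b D i) (@coboundaries R M b D i) n <->
  ext_dim i [set 0] n.
Proof.
suff [-> ->] : @cocycles R M b D i = coZ i [set 0] /\ @coboundaries R M b D i = coB i [set 0].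
  by [].
have in0 p (w : {ffun 'I_p -> M}) : ffun_in [set 0] w <-> w = 0.
  by split=> [h|-> j]; [apply/ffunP => j; rewrite ffunE; exact: h|rewrite ffunE].
split; first by apply/seteqP; split=> w /in0.
case: i => [|i]; first by apply/seteqP; split=> w /in0.
apply/seteqP; split=> [_ [u _ <-]|w [u /in0 /eqP]].
  by exists u; rewrite subrr; apply/in0.
by rewrite subr_eq0 => /eqP ->; exists u.
Qed.

End Cohomology.
End Resolution.

(** * Existence of a resolution of the residue field by finite free modules *)

Section ResolutionExists.
Variables (R : comNzRingType) (m : set R).
Hypothesis locR : noetherian_local m.

Lemma rV_noeth n : noeth 'rV[R]_n.
Proof.
apply: fin_gen_noeth; first by case: locR.
apply/fin_genP; exists [seq delta_mx 0 i | i : 'I_n]; apply/seteqP; split=> // u _.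
rewrite (row_sum_delta u); apply: subm_sum; first exact: submodule_spans.
move=> i _; apply: submZ; first exact: submodule_spans.
by apply: mem_spans; apply/fintype.imageP; exists i.
Qed.

Lemma rV_submodule_rows n (N : set 'rV[R]_n) : submodule N ->
  exists p (B : 'M[R]_(p, n)), forall u, N u <-> exists v : 'rV_p, u = v *m B.
Proof.
move=> sN; have [s ->] := rV_noeth sN.
exists (size s), (\matrix_(i < size s) nth 0 s i) => u; split.
  apply: (@spans_min _ _ s [set u | exists v : 'rV_(size s), u = v *m _]).
    split; first by exists 0; rewrite mul0mx.
    by move=> a _ _ [v ->] [v' ->]; exists (a *: v + v'); rewrite mulmxDl scalemxAl.
  move=> _ /(nthP 0) [i lis <-]; exists (delta_mx 0 (Ordinal lis)).
  by rewrite -rowE rowK.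
move=> [v ->]; rewrite mulmx_sum_row; apply: subm_sum; first exact: submodule_spans.
move=> i _; rewrite rowK; apply: submZ; first exact: submodule_spans.
by apply: mem_spans; rewrite mem_nth.
Qed.

Lemma residue_resolution_exists : exists (b : nat -> nat) (eps : 'cV[R]_(b 0%N))
  (D : forall i, 'M[R]_(b i.+1, b i)), residue_resolution m eps D.
Proof.
have ker p q (A : 'M[R]_(p, q)) : submodule [set u : 'rV_p | u *m A = 0].
  split; first by rewrite /= mul0mx.
  by move=> a u v /= u0 v0; rewrite mulmxDl -scalemxAl u0 v0 scaler0 addr0.
pose nextP p q (A : 'M[R]_(p, q)) := cid (rV_submodule_rows (ker p q A)).
(* A stage stores a matrix with both its sizes, and [next] reuses the row number of the old matrix
   as column number of the new one. The sizes of consecutive differentials thus agree by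
   computation. *)
pose st_type := {p : nat & {q : nat & 'M[R]_(p, q)}}.
pose next (x : st_type) : st_type :=
  let P := nextP _ _ (projT2 (projT2 x)) in
  existT _ (projT1 P) (existT _ (projT1 x) (projT1 (cid (projT2 P)))).
have sm : submodule [set u : 'rV[R]_1 | m (u 0 0)].
  have sm := ideal_max locR; split; first by rewrite /= mxE; exact: (subm0 sm).
  by move=> a u v mu mv; rewrite /= !mxE; apply: (submD sm) => //; exact: (submZ a sm mu).
have [p0 [A0 A0P]] := rV_submodule_rows sm.
pose st i : st_type := iter i next (existT _ p0 (existT _ 1%N A0)).
pose b i := if i is j.+1 then projT1 (st j) else 1%N.
pose D i : 'M[R]_(b i.+1, b i) :=
  match i return 'M[R]_(b i.+1, b i) with
  | 0%N => projT2 (projT2 (st 0%N))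
  | j.+1 => projT2 (projT2 (st j.+1))
  end.
exists b, (1%:M : 'cV_1), D; split.
- exists (1%:M : 'rV_1); rewrite mulmx1 mxE eqxx subrr; exact: (subm0 (ideal_max locR)).
- by move=> u; rewrite mulmx1; exact: A0P.
- have E p q (A : 'M[R]_(p, q)) (u : 'rV[R]_p) : u *m A = 0 <->
      exists v : 'rV_(projT1 (nextP p q A)), u = v *m projT1 (cid (projT2 (nextP p q A))).
    exact: (projT2 (cid (projT2 (nextP p q A))) u).
  by move=> [|i] u; exact: E.
Qed.

End ResolutionExists.

(** * Quotient modules *)

(** An element is an actual coset, so that congruence modulo N becomes equality. The proof [sN] is a
    parameter because the module structure depends on it. *)
Record quotient (R : comNzRingType) (M : lmodType R) (N : set M) (sN : submodule N) :=
  Quotient { quot_coset : set M;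
             quot_cosetP : exists x, quot_coset = [set y | N (y - x)] }.

Section QuotientModule.
Variables (R : comNzRingType) (M : lmodType R) (N : set M) (sN : submodule N).
Local Notation Q := (quotient sN).
Local Ltac meq := module_eq R M.

HB.instance Definition _ := gen_eqMixin Q.
HB.instance Definition _ := gen_choiceMixin Q.

Definition quot_proj (x : M) : Q :=
  @Quotient R M N sN [set y | N (y - x)] (ex_intro _ x erefl).

Definition quot_repr (q : Q) : M := projT1 (cid (quot_cosetP q)).

Lemma quot_projP x y : quot_proj x = quot_proj y <-> N (x - y).
Proof.
split=> [[E]|Nxy].
  have : [set z | N (z - x)] x by rewrite /= subrr; exact: subm0.
  by rewrite E.
have E : [set z | N (z - x)] = [set z | N (z - y)].
  apply/seteqP; split=> z /= Nz.
    by apply: eqmem (submD sN Nz Nxy) _; meq.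
  by apply: eqmem (submB sN Nz Nxy) _; meq.
rewrite /quot_proj; move: (ex_intro _ x _) (ex_intro _ y _); rewrite E => p p'.
by congr Quotient; exact: Prop_irrelevance.
Qed.

Lemma quot_reprK q : quot_proj (quot_repr q) = q.
Proof.
case: q => A Ap; rewrite /quot_repr; case: (cid _) => x /= E.
rewrite /quot_proj; move: (ex_intro _ x _); rewrite -E => p.
by congr Quotient; exact: Prop_irrelevance.
Qed.

Lemma quot_repr_proj x : N (quot_repr (quot_proj x) - x).
Proof. by apply/quot_projP; rewrite quot_reprK. Qed.

Definition quot_add (p q : Q) : Q := quot_proj (quot_repr p + quot_repr q).
Definition quot_opp (p : Q) : Q := quot_proj (- quot_repr p).
Definition quot_scale (a : R) (p : Q) : Q := quot_proj (a *: quot_repr p).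

Lemma quot_addE x y : quot_add (quot_proj x) (quot_proj y) = quot_proj (x + y).
Proof.
apply/quot_projP.
by apply: eqmem (submD sN (quot_repr_proj x) (quot_repr_proj y)) _; meq.
Qed.

Lemma quot_oppE x : quot_opp (quot_proj x) = quot_proj (- x).
Proof. by apply/quot_projP; apply: eqmem (submN sN (quot_repr_proj x)) _; meq. Qed.

Lemma quot_scaleE a x : quot_scale a (quot_proj x) = quot_proj (a *: x).
Proof. by apply/quot_projP; apply: eqmem (submZ a sN (quot_repr_proj x)) _; meq. Qed.

Lemma quot_addA : associative quot_add.
Proof.
move=> p q r; rewrite -(quot_reprK p) -(quot_reprK q) -(quot_reprK r).
by rewrite !quot_addE addrA.
Qed.

Lemma quot_addC : commutative quot_add.
Proof. by move=> p q; rewrite /quot_add addrC. Qed.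

Lemma quot_add0 : left_id (quot_proj 0) quot_add.
Proof. by move=> p; rewrite -(quot_reprK p) quot_addE add0r. Qed.

Lemma quot_addN : left_inverse (quot_proj 0) quot_opp quot_add.
Proof. by move=> p; rewrite -(quot_reprK p) quot_oppE quot_addE addNr. Qed.

HB.instance Definition _ := GRing.isZmodule.Build Q quot_addA quot_addC quot_add0 quot_addN.

Lemma quot_scaleA a b p : quot_scale a (quot_scale b p) = quot_scale (a * b) p.
Proof. by rewrite -(quot_reprK p) !quot_scaleE scalerA. Qed.

Lemma quot_scale1 : left_id 1 quot_scale.
Proof. by move=> p; rewrite -(quot_reprK p) quot_scaleE scale1r. Qed.

Lemma quot_projD x y : quot_proj x + quot_proj y = quot_proj (x + y).
Proof. exact: quot_addE. Qed.

Lemma quot_scaleDr : right_distributive quot_scale +%R.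
Proof.
move=> a p q; rewrite -(quot_reprK p) -(quot_reprK q) quot_projD.
by rewrite !quot_scaleE quot_projD scalerDr.
Qed.

Lemma quot_scaleDl p : {morph quot_scale^~ p : a b / a + b}.
Proof.
move=> a b; rewrite -(quot_reprK p) !quot_scaleE.
by rewrite quot_projD scalerDl.
Qed.

HB.instance Definition _ := GRing.Zmodule_isLmodule.Build R Q
  quot_scaleA quot_scale1 quot_scaleDr quot_scaleDl.

Lemma quot_proj_linear : linear quot_proj.
Proof.
by move=> a x y; rewrite -quot_projD -quot_scaleE.
Qed.

HB.instance Definition _ := GRing.isLinear.Build R M Q *:%R quot_proj quot_proj_linear.

Lemma quot_proj0 x : quot_proj x = 0 <-> N x.
Proof. by rewrite -[0]/(quot_proj 0) quot_projP subr0. Qed.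

End QuotientModule.

(** * Injective resolutions *)

(** Multiplication by [b] embeds R / (I : b) into R / I. The map from R / (I : b) to E sending 1 to
    [e] extends along it, and [ee] is the image of 1 under the extension. *)
Lemma injective_extend (R : comNzRingType) (E : lmodType R) (I : set R^o) b (e : E) :
  injective_module E -> submodule I -> (forall a, I (a * b) -> a *: e = 0) ->
  exists ee : E, (forall a, I a -> a *: ee = 0) /\ b *: ee = e.
Proof.
move=> injE sI Ie.
have sIb : @submodule R R^o [set a | I (a * b)].
  split=> [|a x y Ix Iy]; first by rewrite /= mul0r; exact: (subm0 sI).
  apply: eqmem (submD sI (submZ a sI Ix) Iy) _; rewrite !scale_regE; ring.
pose f0 (q : quotient sIb) : quotient sI := quot_proj sI (quot_repr q * b).
have f0E x : f0 (quot_proj sIb x) = quot_proj sI (x * b).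
  have h : I ((quot_repr (quot_proj sIb x) - x : R) * b) := quot_repr_proj sIb x.
  by apply/quot_projP; rewrite mulrBl in h.
have f0l : linear f0.
  move=> a p q; rewrite -(quot_reprK p) -(quot_reprK q) -linearP !f0E -linearP.
  by congr quot_proj; rewrite !scale_regE; ring.
pose g0 (q : quotient sIb) : E := quot_repr q *: e.
have g0E x : g0 (quot_proj sIb x) = x *: e.
  by apply/eqP; rewrite -subr_eq0 -scalerBl Ie //; exact: (quot_repr_proj sIb x).
have g0l : linear g0.
  move=> a p q; rewrite -(quot_reprK p) -(quot_reprK q) -linearP !g0E.
  by rewrite scalerDl scale_regE -scalerA.
pose f : {linear quotient sIb -> quotient sI} := HB.pack f0 (GRing.isLinear.Build _ _ _ _ f0 f0l).
pose g : {linear quotient sIb -> E} := HB.pack g0 (GRing.isLinear.Build _ _ _ _ g0 g0l).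
have f_inj : injective f.
  move=> p q; rewrite -(quot_reprK p) -(quot_reprK q) /f /= !f0E => /quot_projP h.
  by apply/quot_projP; rewrite -mulrBl in h.
have [h hE] := injE _ _ f g f_inj.
have hP a : a *: h (quot_proj sI (1 : R^o)) = h (quot_proj sI (a : R^o)).
  by rewrite -!linearZ scale_regE mulr1.
exists (h (quot_proj sI (1 : R^o))); split=> [a Ia|].
  by rewrite hP (quot_proj0 sI a).2 // linear0.
have := hE (quot_proj sIb (1 : R^o)).
by rewrite /f /g /= f0E g0E mul1r scale1r -hP.
Qed.

Section InjectiveResolution.
Variables (R : comNzRingType) (m : set R).
Hypothesis locR : noetherian_local m.
Variables (K : lmodType R) (n : nat) (E : nat -> lmodType R) (eta : {linear K -> E 0%N})
  (D : forall i, {linear E i -> E i.+1}).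
Hypotheses (injE : forall i, injective_module (E i))
  (E0 : forall i, (n < i)%N -> forall x : E i, x = 0)
  (eta_inj : injective eta)
  (ex0 : forall y, D 0%N y = 0 <-> exists x, eta x = y)
  (exS : forall i y, D i.+1 y = 0 <-> exists x, D i x = y).
Implicit Types (I J : set R^o) (N : set K).

(** This is Hom(R / I, E i), a map being identified with its value at 1. *)
Definition torsion I i : set (E i) := [set z | forall a, I a -> a *: z = 0].

Arguments torsion : clear implicits.

(* The coboundaries of the complex Hom(R / I, E) *)
Definition tbound I i : set (E i) :=
  match i return set (E i) with
  | 0%N => [set 0]
  | j.+1 => [set D j w | w in torsion I j]
  end.

Arguments tbound : clear implicits.

Lemma submodule_torsion I i : submodule (torsion I i).
Proof.
split=> [a _|c x y Tx Ty a Ia]; first by rewrite scaler0.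
by rewrite scalerDr scalerA mulrC -scalerA Tx // Ty // scaler0 addr0.
Qed.

Lemma submodule_tbound I i : submodule (tbound I i).
Proof.
case: i => [|i]; first exact: submodule_set0.
exact: submodule_image (submodule_torsion I i).
Qed.

Lemma torsionS I J i : I `<=` J -> torsion J i `<=` torsion I i.
Proof. by move=> IJ z Tz a /IJ; exact: Tz. Qed.

Lemma DD i (z : E i) : D i.+1 (D i z) = 0.
Proof. by apply/exS; exists z. Qed.

Lemma D_torsion I i z : torsion I i z -> torsion I i.+1 (D i z).
Proof. by move=> Tz a Ia; rewrite -linearZZ Tz // linear0. Qed.

Lemma tbound_cocycle I i z : tbound I i z -> torsion I i z /\ D i z = 0.
Proof.
case: i z => [|i] z /=; first by move=> ->; split; [exact:
  (subm0 (submodule_torsion I 0))|rewrite linear0].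
by move=> [w Tw <-]; split; [exact: D_torsion|exact: DD].
Qed.

Lemma torsion_extend I i b (z : E i) : submodule I -> (forall a, I (a * b) -> a *: z = 0) ->
  exists2 w, torsion I i w & b *: w = z.
Proof. by move=> sI /(injective_extend (@injE i) sI) [w [Tw bw]]; exists w. Qed.

(** Expresses Ext^i(R / I, K) = 0, computed from the injective resolution of K. *)
Definition acyclic I i : Prop := forall z, torsion I i z -> D i z = 0 -> tbound I i z.

(* [T] identifies [K / N] with the cohomology of Hom(R / J, E) in degree [k], all
   other cohomology being zero. *)
Definition concentrated J N k (T : K -> E k -> Prop) : Prop :=
  [/\ forall i, i <> k -> acyclic J i,
      forall a y y' z z', T y z -> T y' z' -> T (a *: y + y') (a *: z + z'),
      forall y z, T y z -> [/\ torsion J k z, D k z = 0 & N y <-> tbound J k z],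
      forall y, exists z, T y z
    & forall z, torsion J k z -> D k z = 0 -> exists y, T y z].

Lemma concentrated0 : concentrated [set 0] [set 0] (fun y z => z = eta y).
Proof.
have T0 i z : torsion [set 0] i z by move=> _ ->; rewrite scale0r.
split.
- move=> [//|i] _ z _ /exS [x <-]; by exists x.
- by move=> a y y' _ _ -> ->; rewrite linearP.
- move=> y _ ->; split=> //; first by apply/ex0; exists y.
  split=> [->|/= y0]; first by rewrite /= linear0.
  by apply: eta_inj; rewrite y0 linear0.
- by move=> y; exists (eta y).
- by move=> z _ /ex0 [y <-]; exists y.
Qed.

Lemma torsion_addsc J a i z : submodule J -> torsion (addsc J a) i z <->
  torsion J i z /\ a *: z = 0.
Proof.
move=> sJ; split=> [Tz|[Tz az] b [c Jb]].
  split; first by apply: torsionS Tz; exact: sub_addsc.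
  by apply: Tz; exists 1; rewrite scale_regE mulr1 subrr; exact: subm0.
have -> : b = (b - a * c) + c * a by ring.
by rewrite scalerDl -[c * a *: z]scalerA az scaler0 addr0; apply: Tz; exact: Jb.
Qed.

(* A preimage under the differential can be corrected to be killed by [a]. *)
Lemma lift_torsion J I b i z w : submodule J ->
  (forall c, J (c * b) -> I c) -> acyclic I i ->
  (forall c, I c -> J (c * b)) ->
  torsion (adj J b) i.+1 z -> torsion J i w -> D i w = z ->
  exists2 w', torsion (adj J b) i w' & D i w' = z.
Proof.
move=> sJ colonI acI Icolon Tz Tw Dw.
have bw : tbound I i (b *: w).
  apply: acI.
    by move=> c /Icolon Jcb; rewrite scalerA Tw.
  by rewrite linearZZ Dw Tz //; exact: mem_adj.
have [v [Tv bv Dv]] : exists v, [/\ torsion J i v, b *: v = b *: w & D i v = 0].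
  case: i z w Tz Tw Dw acI bw => [|i] z w Tz Tw Dw acI.
    move=> /= bw0; exists 0; split; [exact: (subm0 (submodule_torsion J 0))|by rewrite scaler0
      bw0|exact: linear0].
  move=> [v Tv Ev].
  have [|v' Tv' bv'] := @torsion_extend J i b v sJ.
    by move=> c /colonI; exact: Tv.
  exists (D i v'); split; [exact: D_torsion|by rewrite -linearZZ bv'|exact: DD].
exists (w - v); last by rewrite linearB Dv subr0.
move=> c [e Jc]; have -> : c = (c - e * b) + e * b by ring.
have bwv : b *: (w - v) = 0 by rewrite scalerBr bv subrr.
rewrite scalerDl -[e * b *: _]scalerA bwv scaler0 addr0.
by apply: (submB (submodule_torsion J i) Tw Tv); exact: Jc.
Qed.

Lemma adj_addsc J a : submodule J -> adj J a = addsc J a.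
Proof.
move=> sJ; apply/seteqP; split=> y [c Jy]; exists c; apply: eqmem Jy _;
  by rewrite !scale_regE mulrC.
Qed.

(** As each E i is injective, [a] acts surjectively on Hom(R / J, E i), with kernel Hom(R / (J +
    aR), E i). The new relation is the connecting map of this sequence: divide a cocycle of y by
    [a], then apply the differential. Since [a] is regular on K / N, nothing is left in degree k,
    and K / (N + aK) appears in degree k + 1. *)
Lemma concentrated_step J N k T a : submodule J -> submodule N ->
  regular_on J a -> regular_on N a -> concentrated J N (k := k) T ->
  exists T', concentrated (addsc J a) (addsc N a) (k := k.+1) T'.
Proof.
move=> sJ sN rJ rN [ac Tlin Tcoc Ttot Tsurj].
have div i z : torsion J i z -> exists2 w, torsion J i w & a *: w = z.
  move=> Tz; apply: torsion_extend => // b Jba; apply: Tz; apply: rJ.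
  by rewrite scale_regE mulrC.
have tJ i z := @torsion_addsc J a i z sJ.
have lift i z w : i <> k -> torsion (addsc J a) i.+1 z -> torsion J i w -> D i w = z ->
    exists2 w', torsion (addsc J a) i w' & D i w' = z.
  move=> ik; rewrite -adj_addsc // => Tz; apply: (@lift_torsion J J) => //.
  - by move=> c Jca; apply: rJ; rewrite scale_regE mulrC.
  - exact: ac.
  by move=> c Jc; rewrite mulrC; exact: (submZ a sJ Jc).
have bdiv i x : tbound J i x -> exists v, [/\ torsion J i v, a *: v = x & D i v = 0].
  case: i x => [|i] x /=.
    by move=> ->; exists 0; split; [exact: (subm0 (submodule_torsion J 0))|rewrite
      scaler0|exact: linear0].
  move=> [v /div [v' Tv' <-] <-]; exists (D i v').
  by split; [exact: D_torsion|rewrite linearZZ|exact: DD].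
have T00 : T 0 0.
  have [z Tz] := Ttot 0; have := Tlin (-1) _ _ _ _ Tz Tz.
  by rewrite !scaleN1r !addNr.
have TZ c y z : T y z -> T (c *: y) (c *: z).
  by move=> Tyz; have := Tlin c _ _ _ _ Tyz T00; rewrite !addr0.
have TB y z y' z' : T y z -> T y' z' -> T (y - y') (z - z').
  by move=> Tyz Tyz'; have := Tlin (-1) _ _ _ _ Tyz' Tyz; rewrite !scaleN1r ![- _ + _]addrC.
exists (fun y z' => exists z w, [/\ T y z, torsion J k w, a *: w = z & D k w = z']); split.
- move=> i ik z /tJ [Tz az] Dz.
  have [ki|ki] := pselect (i = k); last first.
    case: i ik ki z Tz az Dz => [|i] ik ki z Tz az Dz; first exact: (ac 0%N ki z Tz Dz).
    have [w Tw Dw] := ac i.+1 ki z Tz Dz.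
    have [||||w' Tw' Dw'] := lift i z w => //; last by exists w'.
      by move=> ik'; apply: ik; rewrite ik'.
    by apply/tJ.
  subst i; have [y Tyz] := Tsurj z Tz Dz.
  have Ny : N y.
    apply: rN; have [_ _ h] := Tcoc _ _ (TZ a _ _ Tyz); apply/h; rewrite az.
    exact: (subm0 (submodule_tbound _ _)).
  have [_ _ [/(_ Ny) bz _]] := Tcoc _ _ Tyz.
  case: (k) ac lift {ik Tlin Tcoc Ttot Tsurj T00 TZ TB Tyz} z Tz az Dz bz => [//|i] ac' lift' z
    Tz az Dz [w Tw Dw].
  have [||||w' Tw' Dw'] := lift' i z w => //; last by exists w'.
  by apply/tJ.
- move=> c y y' z z' [z1 [w1 [T1 Tw1 aw1 Dw1]]] [z2 [w2 [T2 Tw2 aw2 Dw2]]].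
  subst z z' z1 z2.
  exists (a *: (c *: w1 + w2)), (c *: w1 + w2); split=> //.
  + rewrite scalerDr scalerA mulrC -scalerA; exact: Tlin.
  + by apply: (submD (submodule_torsion _ _)) => //; exact: (submZ c (submodule_torsion _ _)).
  + by rewrite linearP.
- move=> y z' [z [w [Tyz Tw aw Dw]]]; have [Tz Dz Nz] := Tcoc _ _ Tyz.
  split.
  + apply/tJ; split; first by rewrite -Dw; exact: D_torsion.
    by rewrite -Dw -linearZZ aw.
  + by rewrite -Dw DD.
  split=> [[y1 Ny1]|[w' /tJ [Tw' aw'] Dw']].
    have [z1 T1] := Ttot y1; have [Tz1 Dz1 _] := Tcoc _ _ T1.
    have T2 := TB _ _ _ _ Tyz (TZ a _ _ T1).
    have [_ _ [/(_ Ny1) bd _]] := Tcoc _ _ T2.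
    have [v [Tv av Dv]] := bdiv _ _ bd.
    exists (w - z1 - v); last by rewrite !linearB Dz1 Dv !subr0.
    apply/tJ; split; last by rewrite !scalerBr aw av subrr.
    by do 2!apply: (submB (submodule_torsion _ _)) => //.
  have [||y1 T1] := Tsurj (w - w').
  + exact: (submB (submodule_torsion _ _)).
  + by rewrite linearB Dw Dw' subrr.
  exists y1; have T2 := TB _ _ _ _ Tyz (TZ a _ _ T1).
  have [_ _ h] := Tcoc _ _ T2; apply/h.
  rewrite scalerBr aw aw' subr0 subrr; exact: (subm0 (submodule_tbound _ _)).
- move=> y; have [z Tyz] := Ttot y; have [Tz _ _] := Tcoc _ _ Tyz.
  by have [w Tw aw] := div _ _ Tz; exists (D k w), z, w.
- move=> z' /tJ [Tz' az'] Dz'.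
  have [|w Tw Dw] := ac k.+1 _ z' Tz' Dz'.
    by move/esym/n_Sn.
  have [||y Ty] := Tsurj (a *: w).
  + exact: (submZ a (submodule_torsion _ _)).
  + by rewrite linearZZ Dw.
  by exists y, (a *: w), w.
Qed.

Lemma concentrated_wreg J N k T s : submodule J -> submodule N -> wreg J s -> wreg N s ->
  concentrated J N (k := k) T ->
  exists T', concentrated (addm J (msq s setT)) (addm N (msq s setT)) (k := size s + k) T'.
Proof.
elim: s J N k T => [|a s IH] J N k T sJ sN /=; first by rewrite !addm0; exists T.
move=> [rJ wJ] [rN wN] /(concentrated_step sJ sN rJ rN) [T' cT'].
rewrite !addm_msq1 // addSnnS.
by apply: (IH _ _ _ T') => //; exact: submodule_addsc.
Qed.

Section Artinian.
Variables (J : set R^o) (N : set K) (k nn : nat) (T : K -> E k -> Prop).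
Hypotheses (sJ : submodule J) (Jm : J `<=` m) (mJ : iter nn (@smul R R^o m) setT `<=` J)
  (cT : concentrated J N T).

Let flenJ I : submodule I -> J `<=` I -> flen m I setT.
Proof.
move=> sI JI; apply: (@flen_noeth _ _ R^o _ _ nn) => //; first exact: noeth_ring locR.
exact: subset_trans JI.
Qed.

Let colon_max I b a : submodule I -> ~ I b -> I (a * b) -> m a.
Proof. by move=> sI Ib Iab; apply: contrapT => ma; apply: Ib; exact: (submZ_unit locR sI ma). Qed.

Let torsion_adj I b i z : submodule I ->
  torsion (adj I b) i z <-> torsion I i z /\ b *: z = 0.
Proof. by move=> sI; rewrite adj_addsc //; exact: torsion_addsc. Qed.

(** A socle element [s] gives 0 -> R / m -> R / J -> R / (J + sR) -> 0. A cocycle of R / m extends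
    to R / J, where it is corrected to a cocycle by the vanishing in degree i + 1; it is then a
    boundary, as i differs from k. *)
Let acyclic_max_above i : (k < i)%N ->
  (forall I, submodule I -> J `<=` I -> acyclic I i.+1) -> acyclic (m : set R^o) i.
Proof.
move=> ki acS z Tz Dz.
have [s [_ Js ms]] : exists s : R^o, [/\ setT s, ~ J s & forall a, m a -> J (a *: s)].
  apply: (socle_exists (submodule_setT R^o) sJ mJ) => /(_ 1 Logic.I) J1.
  by apply: (max_not1 locR); exact: Jm.
have [|z' Tz' sz'] := @torsion_extend J i s z sJ.
  by move=> a /(colon_max sJ Js); exact: Tz.
have sJs := submodule_adj s sJ.
have [||w Tw Dw] := acS (adj J s) sJs (@sub_adj _ _ _ _) (D i z').
- by apply/torsion_adj => //; split; [exact: D_torsion|rewrite -linearZZ sz' Dz].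
- exact: DD.
have /(torsion_adj s w sJ) [Tw' sw] := Tw.
have [aci _ _ _ _] := cT.
have : tbound J i (z' - w).
  apply: aci.
  - by move=> ik; move: ki; rewrite ik ltnn.
  - exact: (submB (submodule_torsion _ _)).
  - by rewrite linearB Dw subrr.
case: (i) ki z z' w Tz Dz Tz' sz' Tw Dw Tw' sw {acS} => [//|j] ki z z' w Tz Dz Tz' sz' Tw Dw Tw'
  sw.
move=> [v Tv Dv]; exists (s *: v).
  by move=> a /ms Jas; rewrite scalerA; exact: Tv.
by rewrite linearZZ Dv scalerBr sw subr0.
Qed.

(** Descending induction on [i], starting above [n] where the resolution is zero; this is where
    finite injective dimension is used. In a fixed degree, R / m comes from the degree above, and
    the other R / I follow by induction on length. *)
Let acyclic_above p i I : (k < i)%N -> (n < i + p)%N -> submodule I -> J `<=` I -> acyclic I i.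
Proof.
elim: p i I => [|p IH] i I ki ni sI JI.
  case: i ki ni => [//|i] ki ni z _ _; rewrite addn0 in ni; exists 0.
    exact: (subm0 (submodule_torsion _ _)).
  by rewrite linear0 [RHS](E0 ni).
have acm : acyclic (m : set R^o) i.
  by apply: acyclic_max_above => // I' sI' JI'; apply: IH => //; [exact: leqW|rewrite addSnnS].
have [l] := flenJ sI JI.
elim: l I sI JI => [|l IHl] I sI JI.
  move=> [_ IT] z Tz _; have -> : z = 0 by rewrite -[z]scale1r Tz // IT.
  exact: (subm0 (submodule_tbound _ _)).
move=> [_ [b [_ Ib mb ->]] cl] z Tz Dz.
have sIb := submodule_adj b sI.
have acIb := IHl _ sIb (subset_trans JI (@sub_adj _ _ _ _)) cl.
have bz : tbound (m : set R^o) i (b *: z).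
  apply: acm; last by rewrite linearZZ Dz scaler0.
  by move=> a /mb Iab; rewrite scalerA Tz.
case: (i) ki {ni acm} z Tz Dz bz acIb => [//|j] ki z Tz Dz [w Tw Dw] acIb.
have [|w' Tw' bw'] := @torsion_extend I j b w sI.
  by move=> a /(colon_max sI Ib); exact: Tw.
have [||w2 Tw2 Dw2] := acIb (z - D j w').
- apply/torsion_adj => //; split; last by rewrite scalerBr -linearZZ bw' Dw subrr.
  by apply: (submB (submodule_torsion _ _)) => //; exact: D_torsion.
- by rewrite linearB Dz DD subr0.
exists (w2 + w'); last by rewrite linearD Dw2 subrK.
apply: (submD (submodule_torsion _ _)) => //; apply: torsionS Tw2; exact: sub_adj.
Qed.

(** One application of [lift_torsion] for each simple factor of I / I0: as Ext^i(R / m, K) vanishes,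
    a class of R / I in degree i + 1 that dies over R / I0 is already zero. *)
Let lift_chain I0 I l i z w : clen m I0 I l -> acyclic (m : set R^o) i ->
  torsion I i.+1 z -> torsion I0 i w -> D i w = z -> exists2 w', torsion I i w' & D i w' = z.
Proof.
move=> + acm Tz; elim: l I0 w => [|l IH] I0 w.
  by move=> [_ <-]; exists w.
move=> [_ [b [sI0 Ib mb ->]] cl] Tw Dw.
have [_ _ I1I] := clen_submod cl.
have [w' Tw' Dw'] := lift_torsion sI0 (fun c => @colon_max I0 b c sI0 Ib) acm mb
  (torsionS I1I Tz) Tw Dw.
exact: IH cl Tw' Dw'.
Qed.

Let flenm : flen m J (m : set R^o).
Proof.
by have [] := len_add locR (flenJ sJ (@subset_refl _ _)) (ideal_max locR) Jm (@subsetT _ _).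
Qed.

Let acyclic_below i : (i < k)%N -> acyclic (m : set R^o) i.
Proof.
have [ac _ _ _ _] := cT.
elim: i => [|i IH] ik z Tz Dz.
  by apply: (ac 0%N _ z (torsionS Jm Tz) Dz) => k0; rewrite -k0 ltnn in ik.
have [|w Tw Dw] := ac i.+1 _ z (torsionS Jm Tz) Dz.
  by move=> k0; rewrite -k0 ltnn in ik.
have [l cl] := flenm.
have [w' Tw' Dw'] := lift_chain cl (IH (ltnW ik)) Tz Tw Dw.
by exists w'.
Qed.

(** A class killed by m has a representative killed by m. Along a composition series from I0 to m,
    the boundary bz is lifted to a boundary from Hom(R / m, -), divided by [b], and subtracted. *)
Let socle_lift I0 l z : (0 < k)%N -> clen m I0 (m : set R^o) l -> J `<=` I0 ->
  torsion I0 k z -> (forall a, m a -> tbound J k (a *: z)) ->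
  exists2 z', torsion (m : set R^o) k z' & tbound J k (z - z').
Proof.
move=> k0; elim: l I0 z => [|l IH] I0 z.
  move=> [_ <-] JI Tz _; exists z => //; rewrite subrr; exact: (subm0 (submodule_tbound _ _)).
move=> [_ [b [sI0 Ib mb ->]] cl] JI Tz Bz.
have [_ _ I1m] := clen_submod cl.
have bm : m b by apply: I1m; exact: mem_adj.
have [z1 [Tz1 bz1 Bz1]] : exists z1, [/\ torsion I0 k z1, b *: z1 = 0 & tbound J k (z - z1)].
  have := Bz b bm; case: (k) k0 (@acyclic_below) z Tz {Bz} => [//|j] k0 below z Tz [w Tw Dw].
  have [l' cl'] := flenm.
  have Tbz : torsion (m : set R^o) j.+1 (b *: z).
    by move=> a /mb Iab; rewrite scalerA; exact: Tz.
  have [w' Tw' Dw'] := lift_chain cl' (below j (ltnSn j)) Tbz Tw Dw.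
  have [|w2 Tw2 bw2] := @torsion_extend I0 j b w' sI0.
    by move=> a /(colon_max sI0 Ib); exact: Tw'.
  exists (z - D j w2); split.
  - by apply: (submB (submodule_torsion _ _)) => //; exact: D_torsion.
  - by rewrite scalerBr -linearZZ bw2 Dw' subrr.
  by exists w2; [exact: torsionS Tw2|rewrite opprB addrC subrK].
have sB := submodule_tbound J k.
have [||a ma|z' Tz' Bz'] := IH _ z1 cl.
- by apply: subset_trans JI _; exact: sub_adj.
- by apply/torsion_adj.
- have -> : a *: z1 = a *: z - a *: (z - z1) by module_eq R (E k).
  by apply: (submB sB); [exact: Bz|exact: (submZ a sB)].
exists z' => //; apply: eqmem (submD sB Bz1 Bz') _; module_eq R (E k).
Qed.

(* The functor Hom(-, K / N) is exact enough on the R / J-modules R / I. *)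
Lemma socle_extend I b e : (0 < k)%N -> submodule N -> submodule I -> J `<=` I -> ~ I b ->
  (forall a, m a -> I (a * b)) -> socle m N e ->
  exists ee, (forall a, I a -> N (a *: ee)) /\ N (b *: ee - e).
Proof.
move=> k0 sN sI JI Ib mb Se.
have [ac Tlin Tcoc Ttot Tsurj] := cT.
have T00 : T 0 0.
  have [z Tz] := Ttot 0; have := Tlin (-1) _ _ _ _ Tz Tz.
  by rewrite !scaleN1r !addNr.
have TZ c y z : T y z -> T (c *: y) (c *: z).
  by move=> Tyz; have := Tlin c _ _ _ _ Tyz T00; rewrite !addr0.
have [z Tez] := Ttot e; have [Tz Dz _] := Tcoc _ _ Tez.
have [l cl] := flenm.
have [|z' Tz' Bzz'] := @socle_lift J l z k0 cl (@subset_refl _ _) Tz.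
  by move=> a ma; have [_ _ [h _]] := Tcoc _ _ (TZ a _ _ Tez); apply: h; exact: Se.
have Dz' : D k z' = 0.
  by have [_] := tbound_cocycle Bzz'; rewrite linearB Dz sub0r => /eqP; rewrite oppr_eq0 => /eqP.
have [|z1 Tz1 bz1] := @torsion_extend I k b z' sI.
  by move=> a /(colon_max sI Ib); exact: Tz'.
have sIb := submodule_adj b sI.
have [||||||w Tw Dw] := @acyclic_above n k.+1 (adj I b) _ _ _ _ (D k z1) => //.
- by rewrite addSn ltnS leq_addl.
- by apply: subset_trans JI _; exact: sub_adj.
- by apply/torsion_adj => //; split; [exact: D_torsion|rewrite -linearZZ bz1 Dz'].
- exact: DD.
have /(torsion_adj b w sI) [Tw' bw] := Tw.
have Tz2 : torsion I k (z1 - w) by exact: (submB (submodule_torsion _ _)).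
have [||ee Tee] := Tsurj (z1 - w).
- exact: torsionS Tz2.
- by rewrite linearB Dw subrr.
exists ee; split=> [a Ia|].
  have [_ _ [_ h]] := Tcoc _ _ (TZ a _ _ Tee); apply: h; rewrite Tz2 //.
  exact: (subm0 (submodule_tbound _ _)).
have Tb := Tlin (-1) _ _ _ _ Tez (TZ b _ _ Tee).
have [_ _ [_ h]] := Tcoc _ _ Tb.
have -> : b *: ee - e = -1 *: e + b *: ee by rewrite scaleN1r addrC.
apply: h; rewrite scalerBr bw subr0 bz1 scaleN1r addrC.
have sB := submodule_tbound J k.
by apply: eqmem (submN sB Bzz') _; rewrite opprB.
Qed.

End Artinian.
End InjectiveResolution.

(** * Matlis duality for the reduction of the canonical module *)

Section Duality.
Variables (R : comNzRingType) (m : set R).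
Hypothesis locR : noetherian_local m.
Variables (K : lmodType R) (J : set R^o) (N : set K).
Hypotheses (sJ : submodule J) (sN : submodule N) (fJ : flen m J setT).
Hypothesis JN : forall a y, J a -> N (a *: y).
Hypothesis socN : has_residue_dim m (socle m N) N 1.
Hypothesis extN : forall (I : set R^o) b e, submodule I -> J `<=` I -> ~ I b ->
  (forall a, m a -> I (a * b)) -> socle m N e ->
  exists ee, (forall a, I a -> N (a *: ee)) /\ N (b *: ee - e).
Local Ltac meq := module_eq R K.

Lemma socle_generator : exists v, [/\ socle m N v, ~ N v &
  forall y, socle m N y -> exists c, N (y - c *: v)].
Proof.
have [v [vS vgen vfree]] := socN; exists (v ord0); split=> //.
  move=> Nv; apply: (max_not1 locR).
  by apply: (vfree (fun=> 1) _ ord0); rewrite big_ord1 scale1r.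
by move=> y /vgen [a]; rewrite big_ord1 => Na; exists (a ord0).
Qed.

Lemma clen_socle : clen m N (socle m N) 1.
Proof.
have [v [Sv Nv vgen]] := socle_generator.
apply: clen1; exists v; split=> //; apply/seteqP; split; first by move=> y /vgen.
apply: adj_min => //; first exact: submodule_socle.
by move=> y Ny a _; exact: submZ.
Qed.

(** Modulo N this is Hom(R / I, K / N); [annR A] below is the annihilator of A / N when A contains
    N. *)
Definition annK (I : set R^o) : set K := [set y | forall a, I a -> N (a *: y)].
Definition annR (A : set K) : set R^o := [set a | forall y, A y -> N (a *: y)].

(** Each simple factor of R / I contributes exactly one: at most one as the socle of K / N is
    simple, and at least one as its generator is b times some [ee] killed by I. *)
Lemma clen_annK (I : set R^o) l : clen m I setT l -> J `<=` I -> clen m N (annK I) l.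
Proof.
elim: l I => [|l IH] I /= => [[_ ->] JI|[_ [b [sI Ib mb ->]] cl] JI].
  split=> //; apply/seteqP; split=> y; first by move=> Ny a _; exact: submZ.
  by move=> /(_ 1 Logic.I); rewrite scale1r.
have [v [Sv Nv vgen]] := socle_generator.
have [ee [Iee bee]] := extN sI JI Ib mb Sv.
apply: clen_rcons (IH _ cl (subset_trans JI (@sub_adj _ _ _ _))) _.
have sK I' : submodule (annK I').
  split=> [a _|c x y Nx Ny a Ia]; first by rewrite scaler0; exact: subm0.
  by apply: eqmem (submD sN (submZ c sN (Nx a Ia)) (Ny a Ia)) _; meq.
have adjK y : annK I y -> N (b *: y) -> annK (adj I b) y.
  move=> Iy by_ a [c Ia]; have -> : a = (a - c * b) + c * b by ring.
  by rewrite scalerDl -[c * b *: _]scalerA; apply: submD => //; [exact: Iy|exact: submZ].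
exists ee; split=> //.
- move=> /(_ b (mem_adj b sI)) Nbe; apply: Nv.
  exact: submBr Nbe bee.
- move=> a ma; apply: adjK => [c Ic|].
    by rewrite scalerA mulrC -scalerA; apply: submZ => //; exact: Iee.
  by rewrite scalerA mulrC; apply: Iee; exact: mb.
apply/seteqP; split=> y.
  move=> Iy; have [c Nc] : exists c, N (b *: y - c *: v).
    by apply: vgen => a /mb Iab; rewrite scalerA; exact: Iy.
  exists c; apply: adjK => [a Ia|].
    by apply: eqmem (submB sN (Iy a Ia) (submZ c sN (Iee a Ia))) _; meq.
  by apply: eqmem (submB sN Nc (submZ c sN bee)) _; meq.
by apply: adj_min => // z Iz a Ia; apply: Iz; exact: sub_adj.
Qed.

Lemma len_annK (I : set R^o) : submodule I -> J `<=` I ->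
  flen m N (annK I) /\ len m N (annK I) = len m I setT.
Proof.
move=> sI JI; have [_ /(flen_clen locR) cl _] := len_add locR fJ sI JI (@subsetT _ _).
have cN := clen_annK cl JI; split; first by eexists; exact: cN.
exact: clen_len cN.
Qed.

Lemma annK_J : annK J = setT.
Proof. by apply/seteqP; split=> // y _ a Ja; exact: JN. Qed.

Lemma len_dual : flen m N setT /\ len m N setT = len m J setT.
Proof. by rewrite -annK_J; exact: len_annK. Qed.

(** If [a] kills K / N, then J and J + aR have the same annihilator in K / N, so R / J and R / (J +
    aR) have the same length. *)
Lemma dual_faithful (a : R^o) : (forall y, N (a *: y)) -> J a.
Proof.
move=> Na; have sJa := submodule_adj a sJ.
have [_ lJa] := len_annK sJa (@sub_adj _ _ _ _).
have aK : annK (adj J a) = setT.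
  apply/seteqP; split=> // y _ b [c Jb]; have -> : b = (b - c * a) + c * a by ring.
  rewrite scalerDl -[c * a *: _]scalerA; apply: submD => //; first exact: JN.
  exact: submZ.
have [_ lJ] := len_dual; rewrite aK lJ in lJa.
have [fJa _ E] := len_add locR fJ sJa (@sub_adj _ _ _ _) (@subsetT _ _).
have /(len0_eq locR fJa) -> : len m J (adj J a) = 0%N by lia.
exact: mem_adj.
Qed.

(** For a step from A to A + Re, the map a |-> ae embeds the quotient of the two annihilators into
    the socle of K / N, which has length one. *)
Lemma clen_annR A B l : clen m A B l -> N `<=` A ->
  exists2 r, (r <= l)%N & clen m (annR B) (annR A) r.
Proof.
have sR A' : submodule (annR A').
  split=> [y _|c a b Na Nb y Ay]; first by rewrite scale0r; exact: subm0.
  by apply: eqmem (submD sN (submZ c sN (Na y Ay)) (Nb y Ay)) _; rewrite scalerDl scalerA.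
elim: l A => [|l IH] A /= => [[_ ->] _|[_ [e [sA Ae me ->]] cl] NA].
  by exists 0%N.
have [r rl cr] := IH _ cl (subset_trans NA (@sub_adj _ _ _ _)).
have f0l : linear (fun a : R^o => a *: e) by move=> a b c; rewrite scalerDl -scalerA.
pose f : {linear R^o -> K} := HB.pack (fun a : R^o => a *:
  e) (GRing.isLinear.Build _ _ _ _ _ f0l).
have sX := sR A; have sfX := submodule_image f sX; have sNX := submodule_addm sN sfX.
have XS : addm N (f @` annR A) `<=` socle m N.
  apply: addm_min; [exact: submodule_socle|by move=> y Ny a _; exact: submZ|].
  move=> _ [a Aa <-] b mb /=.
  by rewrite scalerA mulrC -scalerA; apply: Aa; exact: me.
have [fX _ lX] := len_add locR (ex_intro _ 1%N clen_socle) sNX (sub_addml sfX) XS.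
have [fE lE] := len_preimage locR sX sN fX.
have XE : annR A `&` f @^-1` N = annR (adj A e).
  apply/seteqP; split=> [a [Aa Nae] y [c Ac]|a Na].
    have -> : a *: y = a *: (y - c *: e) + c *: (a *: e) by meq.
    by apply: submD => //; [exact: Aa|exact: submZ].
  by split=> [y Ay|]; apply: Na; [exact: sub_adj|exact: mem_adj].
rewrite XE in fE lE.
exists (r + len m (annR (adj A e)) (annR A))%N; last exact: clen_cat cr (flen_clen locR fE).
by rewrite -lE; have := clen_len locR clen_socle; lia.
Qed.

(* Both [A |-> 0 : A] and its bound are exact in total, so each step is exact. *)
Lemma len_socle_dual : flen m J (socle m J) /\
  len m J (socle m J) = len m (addm N (smul m setT)) setT.
Proof.
have [fN lN] := len_dual.
have sm : submodule (smul m [set: K]) := submodule_smul _ _.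
have sNm := submodule_addm sN sm.
have [fNm fmT lNm] := len_add locR fN sNm (sub_addml sm) (@subsetT _ _).
have [r1 r1l] := clen_annR (flen_clen locR fmT) (sub_addml sm).
have [r2 r2l] := clen_annR (flen_clen locR fNm) (@subset_refl _ _).
have -> : annR N = setT by apply/seteqP; split=> // a _ y Ny; exact: submZ.
have -> : annR setT = J.
  apply/seteqP; split=> a Na; first by apply: dual_faithful => y; exact: Na.
  by move=> y _; exact: JN.
have -> : annR (addm N (smul m setT)) = socle m J.
  apply/seteqP; split=> [a Na b mb|a Sa].
    apply: dual_faithful => y; rewrite scale_regE mulrC -scalerA; apply: Na.
    by apply: sub_addmr => //; exact: mem_smul.
  pose X := [set y | N (a *: y)].
  apply: (@addm_min _ _ N (smul m setT) X).
  - split; first by rewrite /X /= scaler0; exact: subm0.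
    by move=> c x y Nx Ny; apply: eqmem (submD sN (submZ c sN Nx) Ny) _; meq.
  - by move=> y Ny; exact: submZ.
  apply: smul_min.
    split; first by rewrite /X /= scaler0; exact: subm0.
    by move=> c x y Nx Ny; apply: eqmem (submD sN (submZ c sN Nx) Ny) _; meq.
  move=> b y mb _; rewrite /X /= scalerA mulrC; apply: JN; exact: Sa.
move=> c2 c1; split; first by exists r1.
have e := clen_len locR (clen_cat c1 c2).
rewrite (clen_len locR c1); move: lN; rewrite e lNm; move: r1l r2l.
by move: (len m N _) (len m _ setT) => p q; lia.
Qed.

End Duality.

(** * Generic minimal reductions *)

Section WregCat.
Variables (R : comNzRingType) (M : lmodType R).
Implicit Types (N : set M).

Lemma addm_msq_rcons N s a : submodule N ->
  addm N (msq (rcons s a) setT) = addsc (addm N (msq s setT)) a.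
Proof.
elim: s N => [|c s IH] N sN; first by rewrite addm_msq1 // !addm0.
by rewrite rcons_cons !addm_msq1 // IH //; exact: submodule_addsc.
Qed.

Lemma wreg_rcons N s a : submodule N ->
  wreg N (rcons s a) <-> wreg N s /\ regular_on (addm N (msq s setT)) a.
Proof.
elim: s N => [|c s IH] N sN; first by rewrite /= addm0; split=> [[]|[]].
have sNc := submodule_addsc c sN.
rewrite rcons_cons addm_msq1 //=; split=> [[rc /(IH _ sNc) []]|[[rc ws] ra]] //.
by split=> //; apply/IH.
Qed.

End WregCat.

Lemma msq_spans (R : comNzRingType) (s : seq R) : msq s [set: R^o] = spans (s : seq R^o).
Proof.
apply/seteqP; split.
  apply: msq_min; first exact: submodule_spans.
  move=> b y bs _; rewrite scale_regE mulrC.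
  by apply: (submZ (y : R) (submodule_spans _)); exact: mem_spans.
apply: spans_min; first exact: submodule_msq.
by move=> v vs; exact: mem_msq_setT.
Qed.

Section GoodSystem.
Variables (R : comNzRingType) (m : set R) (d : nat).
Hypothesis locR : noetherian_local m.
Hypothesis infR : infinite_set (cosets m).
Hypothesis dimR : has_dim R^o d.
Hypothesis cmR : max_cohen_macaulay m R^o.

Let mpow (k : nat) : set R^o := iter k (@smul R R^o m) setT.

Let submodule_mpow i : submodule (mpow i).
Proof. exact: submodule_iter_smul. Qed.

Lemma bin_le_exp p q : ('C(p, q) <= p ^ q)%N.
Proof.
apply: leq_trans (_ : (p ^_ q <= _)%N).
  by rewrite -bin_ffact leq_pmulr // fact_gt0.
elim: q p => [|q IH] p; first by rewrite ffactn0.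
case: p => [//|p]; rewrite ffactSS expnS leq_mul2l orbC.
by rewrite (leq_trans (IH p)) //; case: (q) => // j; rewrite leq_exp2r.
Qed.

(** For a maximal regular sequence z, the powers of z lie in those of m and have explicit binomial
    colengths. *)
Lemma hilbert_growth : exists c, forall k,
  exists2 l, (l <= c * (k + d) ^ d)%N & clen m (mpow k.+1) setT l.
Proof.
have [z [mz wz zT zd]] := depth_wreg dimR cmR.
have [nn znn] := wreg_max_primary locR dimR wz zd mz.
have sz := @submodule_msq R R^o z _ (submodule_setT R^o).
have fz : flen m (msq z [set: R^o]) setT.
  by apply: (@flen_noeth _ _ R^o _ _ nn) => //; exact: noeth_ring locR.
exists (len m (msq z [set: R^o]) setT) => k.
have cz := flen_clen locR fz; rewrite -{1}[msq z _]add0m in cz.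
have := clen_spow k locR (noeth_ring locR) (submodule_set0 R^o) mz wz cz.
rewrite add0m zd => ck.
have sub : spow z k.+1 `<=` mpow k.+1.
  elim: k {ck} => [|k IH]; apply: msq_min; try exact: submodule_mpow.
    by move=> b y /mz mb _; exact: mem_smul.
  by move=> b y /mz mb /IH ky; exact: (@mem_smul R R^o m (mpow k.+1) b y mb ky).
have [_ /(flen_clen locR) cl E] := len_add locR (ex_intro _ _ ck) (submodule_mpow _) sub
  (@subsetT _ _).
exists (len m (mpow k.+1) setT) => //.
apply: leq_trans (_ : (len m (@spow R R^o z k.+1) setT <= _)%N); first by rewrite E leq_addl.
by rewrite (clen_len locR ck) leq_mul2l bin_le_exp orbT.
Qed.

Variable M : lmodType R.
Hypothesis nM : noeth M.
Variables (b : nat -> nat) (eps : 'cV[R]_(b 0%N)) (D : forall i, 'M[R]_(b i.+1, b i)).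
Hypothesis resD : residue_resolution m eps D.
Hypothesis extM : forall i, (i < d)%N -> ext_zero D i [set (0 : M)].

Lemma extR i : (i < d)%N -> ext_zero D i [set (0 : R^o)].
Proof.
have [z [mz wz _ zd]] := depth_wreg dimR cmR.
by move=> id_; apply: (wreg_ext_zero locR resD (submodule_set0 _) mz wz); rewrite zd.
Qed.

Lemma msq_sub_max x : (forall a, a \in x -> m a) -> msq x [set: R^o] `<=` m.
Proof.
move=> mx; apply: msq_min; first exact: ideal_max.
by move=> a y /mx ma _; rewrite scale_regE mulrC; exact: max_mul.
Qed.

Lemma socle_trivial (L : lmodType R) x : (forall i, (i < d)%N -> ext_zero D i [set (0 : L)]) ->
  (forall a, a \in x -> m a) -> wreg [set (0 : L)] x -> (size x < d)%N ->
  socle m (msq x [set: L]) `<=` msq x setT.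
Proof.
move=> eL mx wx xd; rewrite -[msq x _]add0m.
have s0 := submodule_set0 L.
apply: (ext_zero0_socle locR resD); first by apply: submodule_addm => //; exact: submodule_msq.
apply: (ext_zero_wreg (k := 1) resD s0 mx wx) => // i id_; apply: eL.
by apply: leq_trans id_ _; rewrite addn1.
Qed.

(** Otherwise a power of m would send y into N, and the multiples of y would contain a socle element
    of L / N. *)
Lemma annel_not_primary (L : lmodType R) (N : set L) y k (J : set R^o) : submodule N ->
  socle m N `<=` N -> ~ N y -> mpow k `<=` J -> ~ (J `<=` annel N y).
Proof.
move=> sN soc Ny kJ Jy.
have sy := @submodule_spans R L [:: y].
have [||b' [_ Nb mb]] := @socle_exists _ m L (spans [:: y]) N k sy sN.
- rewrite -smul_iter //; apply: smul_min => // a z /kJ /Jy Nay [c /= /eqP].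
  rewrite subr_eq0 => /eqP ->; rewrite scalerA mulrC -scalerA; exact: submZ.
- by move=> /(_ y) h; apply/Ny/h/mem_spans; rewrite mem_head.
by apply: Nb; exact: soc.
Qed.

(** The ideals to avoid are m^2 + (x) and the maximal annihilators for R / (x) and M / xM. If J were
    inside m^2 + (x), then m^(n+1) = J m^n and Nakayama's lemma would give m^(n+1) <= (x), although
    R / (x) still has zero socle. *)
Lemma good_system_step s n x : (forall a, a \in s -> m a) -> reduction m s n ->
  (forall a, a \in x -> m a) -> wreg [set (0 : R^o)] x -> wreg [set (0 : M)] x ->
  msq x [set: R^o] `<=` msq s setT -> (size x < d)%N ->
  exists a, [/\ msq s [set: R^o] a, ~ addm (mpow 2) (msq x setT) a,
    regular_on (msq x [set: R^o]) a & regular_on (msq x [set: M]) a].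
Proof.
move=> ms red mx wR wM xs xd.
have sT := submodule_setT R^o; have sx := submodule_msq x sT.
have sxM := submodule_msq x (submodule_setT M).
have sJ := submodule_msq s sT.
have powJ : mpow n.+1 `<=` msq s setT by apply: subset_trans red _; exact: msqS.
have socR := socle_trivial extR mx wR xd.
have socM := socle_trivial extM mx wM xd.
have [yR [yRP yRreg]] := zero_divisors locR (noeth_ring locR) sx.
have [yM [yMP yMreg]] := zero_divisors locR nM sxM.
pose Q : set R := addm (mpow 2) (msq x setT).
have sQ : submodule (Q : set R^o) by exact: submodule_addm.
have nQ : ~ (msq s [set: R^o] `<=` Q).
  move=> JQ.
  have nak : mpow n.+1 `<=` msq x setT.
    apply: (Nakayama locR (noeth_ring locR) sx (submodule_mpow _)).
    apply: subset_trans (_ : msq s (mpow n) `<=` _); first exact: red.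
    have -> : msq s (mpow n) = smul (msq s [set: R^o]) (mpow n).
      by rewrite smul_msq ?smul_setT //; exact: (submodule_mpow n).
    apply: smul_min; first by apply: submodule_addm => //; exact: submodule_smul.
    move=> a y /JQ [u xu au] ny; exists ((a - u : R) *: y); last first.
      have -> : a *: y - (a - u : R) *: y = (y : R) *: (u : R^o) by rewrite !scale_regE; ring.
      exact: (submZ (y : R) sx xu).
    have -> : smul m (mpow n.+1) = smul (mpow 2) (mpow n).
      by rewrite /mpow smul_iter //; exact: submodule_mpow.
    exact: mem_smul.
  have [||c [_ Nc mc]] := @socle_exists _ m R^o setT (msq x setT) n.+1 sT sx.
  - exact: nak.
  - by move=> xT; apply: (max_not1 locR); apply: (msq_sub_max mx); exact: xT.
  by apply: Nc; exact: socR.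
pose Qs : seq (set R) := Q :: [seq annel (msq x [set: R^o]) y | y <- yR] ++
  [seq annel (msq x [set: M]) y | y <- yM].
have [|a Ja aQ] := @ideal_avoid _ _ locR infR (@msq R R^o s setT) Qs sJ.
  move=> P; rewrite inE mem_cat => /orP[/eqP -> //|/orP[]] /mapP[y yin ->].
    split; first exact: submodule_annel.
    by apply: (annel_not_primary sx socR (yRP y yin) powJ).
  split; first exact: submodule_annel.
  by apply: (annel_not_primary sxM socM (yMP y yin) powJ).
exists a; split=> //.
- by apply: aQ; rewrite mem_head.
- by apply: yRreg => y yin; apply: aQ; rewrite inE mem_cat map_f ?orbT.
- by apply: yMreg => y yin; apply: aQ; rewrite inE mem_cat [X in _ || (_ || X)]map_f ?orbT.
Qed.

(* Generic elements of a reduction generated by [d] elements; being independent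
   modulo [m^2], they generate it again. *)
Lemma good_system : exists x n, [/\ size x = d, forall a, a \in x -> m a,
  wreg [set (0 : R^o)] x, wreg [set (0 : M)] x & reduction m x n] /\
  (clen m (mpow 2) (addm (mpow 2) (msq x [set: R^o])) d /\
   msq x [set: R^o] `&` mpow 2 = smul m (msq x [set: R^o])).
Proof.
have [c growth] := hilbert_growth.
have [s [n [sd ms red]]] := exists_reduction locR infR growth.
have sT := submodule_setT R^o; have sJ := submodule_msq s sT.
have sx x := @submodule_msq R R^o x _ sT.
have build k : (k <= d)%N -> exists x, [/\ size x = k, forall a, a \in x -> m a,
    wreg [set (0 : R^o)] x, wreg [set (0 : M)] x & msq x [set: R^o] `<=` msq s setT] /\
    clen m (mpow 2) (addm (mpow 2) (msq x [set: R^o])) k.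
  elim: k => [|k IH] kd.
    exists [::]; split; first by split=> // _ ->; exact: (subm0 sJ).
    by split; [exact: submodule_mpow|rewrite addm0].
  have [x [[xk mx wR wM xs] cx]] := IH (ltnW kd).
  have xd : (size x < d)%N by rewrite xk.
  have [a [Ja Qa rR rM]] := good_system_step ms red mx wR wM xs xd.
  have ma : m a by apply: (msq_sub_max ms).
  exists (rcons x a); split; first split.
  - by rewrite size_rcons xk.
  - by move=> e; rewrite mem_rcons inE => /orP[/eqP ->|/mx].
  - by apply/wreg_rcons; [exact: submodule_set0|rewrite add0m].
  - by apply/wreg_rcons; [exact: submodule_set0|rewrite add0m].
  - rewrite -[X in X `<=` _]add0m addm_msq_rcons; last exact: submodule_set0.
    rewrite add0m; apply: addsc_min => // y.
    by rewrite scale_regE mulrC; exact: (submZ (y : R) sJ Ja).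
  apply: clen_rcons cx _; have sQ : submodule (addm (mpow 2) (msq x [set: R^o])) by exact:
    submodule_addm.
  exists a; split=> //.
    move=> e me; apply: sub_addml => //.
    apply: (@mem_smul R R^o m (mpow 1) e a me).
    by have := @mem_smul R R^o m (mpow 0) a 1 ma Logic.I; rewrite scale_regE mulr1.
  by rewrite addm_msq_rcons; [rewrite adj_addsc|exact: submodule_mpow].
have [x [[xd mx wR wM xs] cx]] := build d (leqnn d).
set I := msq x [set: R^o] in xs cx *; set J := msq s [set: R^o] in sJ xs *.
have sI : submodule I := sx x.
have m2 := submodule_mpow 2.
have Jm : J `<=` m := msq_sub_max ms.
have smJ : submodule (smul m J) by exact: submodule_smul.
have mJJ : smul m J `<=` J by exact: smul_sub.
have m1 : m `<=` mpow 1.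
  move=> a ma; have := @mem_smul R R^o m (mpow 0) a 1 ma Logic.I.
  by rewrite scale_regE mulr1.
have mJ2 : smul m J `<=` J `&` mpow 2.
  move=> y mJy; split; first exact: mJJ.
  exact: (@smulS R R^o m m J (mpow 1) (@subset_refl _ _) (subset_trans Jm m1) y mJy).
have sJ2 : submodule (J `&` mpow 2) by exact: submodule_setI.
have [fmJ lmJ] : flen m (smul m J) J /\ (len m (smul m J) J <= size s)%N.
  apply: (len_le_generators locR (s := s : seq R^o)) => //.
  - by move=> a y; exact: mem_smul.
  - by move=> v vs; exact: mem_msq_setT.
  - by rewrite -msq_spans; exact: sub_addmr.
have c2 : clen m (J `&` mpow 2) (J `&` addm (mpow 2) I) d.
  by apply: clen_setI cx => //; exact: addm_mono.
have sJQ : submodule (J `&` addm (mpow 2) I).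
  by apply: submodule_setI => //; exact: submodule_addm.
(* In the chain from mJ through the intersections of J with m^2 and with m^2 + I up to J, the middle
   step has length d, while J / mJ has length at most d. So both outer steps are trivial, which
   gives both equalities below. *)
have [f1 f2 e1] := len_add locR fmJ sJ2 mJ2 (@subIsetl _ _ _).
have [|f3 f4 e2] := len_add locR f2 sJQ _ (@subIsetl _ _ _).
  by move=> y [Jy y2]; split=> //; apply: sub_addml.
rewrite (clen_len locR c2) in e2.
have E1 : smul m J = J `&` mpow 2 by apply: (len0_eq locR f1); lia.
have E2 : J `&` addm (mpow 2) I = J by apply: (len0_eq locR f4); lia.
have JI : J = I.
  apply/seteqP; split=> //; apply: (Nakayama locR (noeth_ring locR) sI sJ).
  rewrite -{1}E2 => y [Jy [u Iu yu]].
  have : (J `&` mpow 2) (y - u) by split=> //; apply: (submB sJ) => //; exact: xs.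
  rewrite -E1 => mJyu; exists (y - u) => //.
  by apply: eqmem Iu _; rewrite opprB addrC subrK.
exists x, n; split; first split=> //.
  have E L : submodule L -> msq s L = msq x (L : set R^o).
    by move=> sL; rewrite -[L]smul_setT // -!smul_msq // -/J -/I JI.
  by move: red; rewrite /reduction E //; exact: submodule_mpow.
by split=> //; rewrite -/I -JI E1.
Qed.

End GoodSystem.

(** * Multiplicities *)

Section BinomialPolynomial.

(** The polynomial (X + d)(X + d - 1)...(X + 1) / d!, a binomial coefficient in X. *)
Definition binomial_poly (d : nat) : {poly rat} :=
  (d`!%:R^-1) *: \prod_(0 <= i < d) ('X - (- i.+1%:R)%:P).

Lemma binomial_polyE d k : (binomial_poly d).[k%:R] = 'C(k + d, d)%:R.
Proof.
have f0 : (d`!%:R : rat) != 0 by rewrite pnatr_eq0 -lt0n fact_gt0.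
rewrite hornerZ; apply: (mulfI f0); rewrite mulrA mulfV // mul1r mulrC -natrM bin_ffact.
rewrite horner_prod; elim: d {f0} => [|d IH]; first by rewrite big_nil ffactn0.
rewrite big_nat_recr //= IH hornerXsubC opprK addnS ffactSS natrM mulrC; congr (_ * _).
by rewrite -addnS natrD.
Qed.

Lemma size_binomial_poly d : size (binomial_poly d) = d.+1.
Proof.
have f0 : (d`!%:R : rat)^-1 != 0 by rewrite invr_eq0 pnatr_eq0 -lt0n fact_gt0.
by rewrite size_scale // size_prod_XsubC size_iota subn0.
Qed.

Lemma lead_binomial_poly d : lead_coef (binomial_poly d) = d`!%:R^-1.
Proof.
by rewrite lead_coefZ (monicP (monic_prod_XsubC _ _ _)) mulr1.
Qed.

(** Below the leading term, of degree n, the values at x >= 1 are at most C x^n / x, where C is the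
    sum of the absolute values of the coefficients. So a negative leading coefficient would dominate
    once x exceeds C divided by its absolute value. *)
Lemma eventually_ge0_lead (p : {poly rat}) (k0 : nat) :
  (forall k, (k0 <= k)%N -> 0 <= p.[k%:R]) -> 0 <= lead_coef p.
Proof.
move=> pge; have [->|p0] := eqVneq p 0; first by rewrite lead_coef0.
rewrite leNgt; apply/negP => lp0.
have [q pE sq] : exists2 q : {poly rat}, p = lead_coef p *:
  'X^((size p).-1) + q & (size q < size p)%N.
  exists (p - lead_coef p *: 'X^((size p).-1)); first by rewrite addrC subrK.
  rewrite -(prednK (_ : 0 < size p)%N) ?size_poly_gt0 // ltnS; apply/leq_sizeP => j.
  rewrite leq_eqVlt coefB coefZ coefXn => /orP[/eqP <-|lt_j].
    by rewrite eqxx mulr1 subrr.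
  rewrite (gtn_eqF lt_j) mulr0 subr0 nth_default //.
  by rewrite -(prednK (_ : 0 < size p)%N) ?size_poly_gt0.
set n := (size p).-1 in pE.
have sp : size p = n.+1 by rewrite /n prednK // size_poly_gt0.
rewrite sp ltnS in sq.
pose C := \sum_(i < n) `|q`_i|.
have qle k : q.[k.+1%:R] * k.+1%:R <= C * k.+1%:R ^+ n.
  rewrite (horner_coef_wide _ sq) mulr_suml mulr_suml; apply: ler_sum => i _.
  rewrite -mulrA -exprSr; apply: le_trans (_ : `|q`_i| * k.+1%:R ^+ i.+1 <= _).
    by apply: ler_wpM2r; [rewrite exprn_ge0|exact: ler_norm].
  apply: ler_wpM2l => //; apply: ler_weXn2l => //.
  by rewrite ler1n.
have C0 : 0 <= C by apply: sumr_ge0.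
pose N := Num.bound (C / - lead_coef p).
have NP : C / - lead_coef p < N%:R.
  by apply: archi_boundP; apply: divr_ge0 => //; lra.
pose k := (N + k0)%N.
have pk : 0 <= p.[k.+1%:R] by apply: pge; rewrite /k; lia.
have kpos : (0 : rat) < k.+1%:R ^+ n by rewrite exprn_gt0 // ltr0n.
have : 0 <= p.[k.+1%:R] * k.+1%:R by rewrite mulr_ge0.
apply/negP; rewrite -ltNge {1}pE hornerD hornerZ hornerXn mulrDl.
apply: le_lt_trans (_ : lead_coef p * k.+1%:R ^+ n * k.+1%:R + C * k.+1%:R ^+ n < 0).
  by rewrite lerD2l.
rewrite mulrAC -mulrDl; rewrite nmulr_rlt0 //.
have Nk : (N%:R : rat) <= k.+1%:R by rewrite ler_nat /k; lia.
have : C < N%:R * - lead_coef p by rewrite -ltr_pdivrMr //; lra.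
nra.
Qed.

Lemma eventually_le_coef (p q : {poly rat}) d k0 :
  (size p <= d.+1)%N -> (size q <= d.+1)%N ->
  (forall k, (k0 <= k)%N -> p.[k%:R] <= q.[k%:R]) -> p`_d <= q`_d.
Proof.
move=> sp sq pq; rewrite -subr_ge0 -coefB.
have : 0 <= lead_coef (q - p).
  by apply: (@eventually_ge0_lead _ k0) => k /pq; rewrite hornerD hornerN subr_ge0.
have : (size (q - p)%R <= d.+1)%N.
  by apply: leq_trans (size_polyD _ _) _; rewrite size_polyN geq_max sq.
rewrite leq_eqVlt => /orP[/eqP s_|]; first by rewrite /lead_coef s_.
by rewrite ltnS => s_ _; rewrite nth_default.
Qed.

Lemma coef_shift (p : {poly rat}) d n : size p = d.+1 ->
  size (p \Po ('X + n%:R%:P)) = d.+1 /\ (p \Po ('X + n%:R%:P))`_d = p`_d.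
Proof.
move=> sp; have s2 : size ('X + n%:R%:P : {poly rat}) = 2%N by rewrite size_XaddC.
have sc : size (p \Po ('X + n%:R%:P)) = d.+1.
  by rewrite size_comp_poly2 // sp.
have := @lead_coef_comp _ p ('X + n%:R%:P); rewrite s2 => /(_ isT).
by rewrite lead_coefXaddC expr1n mulr1 /lead_coef sc sp.
Qed.

End BinomialPolynomial.

(** * The minimal number of generators as a length *)

Section MinGens.
Variables (R : comNzRingType) (m : set R).
Hypothesis locR : noetherian_local m.
Variable M : lmodType R.
Implicit Types (N L : set M).
Hypothesis nM : noeth M.

Lemma clen_generators N L l : clen m N L l -> exists2 s :
  seq M, size s = l & L = addm N (spans s).
Proof.
elim: l N => [|l IH] N; first by move=> [_ <-]; exists [::] => //; rewrite addm0.
move=> [_ [v [sN _ _ ->]] /IH [s <- ->]]; exists (v :: s) => //.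
rewrite addm_spans_cons //; apply/seteqP; have ss := submodule_spans s.
have sNs := submodule_addm sN ss; have sNv := submodule_adj v sN.
split.
  apply: addm_min; first exact: submodule_adj.
    apply: adj_min; [exact: submodule_adj| |exact: mem_adj].
    by apply: subset_trans (sub_adj _); exact: sub_addml.
  by apply: subset_trans (sub_adj _); exact: sub_addmr.
apply: adj_min; first exact: submodule_addm.
  by apply: addm_mono => //; exact: sub_adj.
by apply: sub_addml => //; exact: mem_adj.
Qed.

Lemma flen_smul N : submodule N -> flen m (smul m N) N.
Proof.
move=> sN; apply: (@flen_noeth _ _ M _ _ 1) => //; first exact: submodule_smul.
exact: smul_sub.
Qed.

Lemma min_gens_len N k : submodule N -> has_min_gens N k <-> len m (smul m N) N = k.
Proof.
move=> sN; have smN := submodule_smul m N.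
have gen_le j : generated_by N j -> (len m (smul m N) N <= j)%N.
  move=> /generated_byP [s <- NE].
  have [||||_ ->] // := @len_le_generators _ _ locR M (smul m N) N s smN sN.
  - exact: smul_sub.
  - by move=> a y; exact: mem_smul.
  - by rewrite NE; exact: mem_spans.
  by move=> y Ny; apply: sub_addmr => //; rewrite -NE.
have gen : generated_by N (len m (smul m N) N).
  have [s sl NE] := clen_generators (flen_clen locR (flen_smul sN)).
  apply/generated_byP; exists s => //.
  have sNs : spans s `<=` N.
    by rewrite [X in _ `<=` X]NE; exact: sub_addmr.
  apply/seteqP; split=> //; apply: (Nakayama locR nM (submodule_spans s) sN).
  rewrite {1}NE; apply: addm_min; first exact/submodule_addm/smN/submodule_spans.
    exact/sub_addmr/submodule_spans.
  exact: sub_addml.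
split=> [[gk kmin]|<-]; last by split.
by apply/eqP; rewrite eqn_leq (gen_le _ gk) kmin.
Qed.

End MinGens.

Section Multiplicity.
Variables (R : comNzRingType) (m : set R) (d n : nat) (x : seq R).
Hypothesis locR : noetherian_local m.
Hypotheses (xd : size x = d) (mx : forall a, a \in x -> m a) (redx : reduction m x n).
Variable M : lmodType R.
Hypotheses (nM : noeth M) (wM : wreg [set (0 : M)] x) (dimM : has_dim M d).
Let mpow k : set M := iter k (smul m) setT.

Let smpow k : submodule (mpow k).
Proof. exact: submodule_iter_smul. Qed.

Lemma reduction_mod k : mpow (n + k) `<=` spow x k.
Proof.
rewrite /mpow -smul_iter // -[spow x k]smul_spow //.
by apply: smulS => //; exact: reduction_spow.
Qed.

Lemma spow_sub_mpow k : spow x k `<=` mpow k.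
Proof.
elim: k => [//|k IH]; apply: msq_min; first exact: smpow.
by move=> a y /mx ma /IH ky; exact: (@mem_smul _ _ m (mpow k) a y ma ky).
Qed.

Lemma flen_mpow (N : set M) k : submodule N -> mpow k `<=` N -> flen m N setT.
Proof. by move=> sN kN; exact: (@flen_noeth _ _ M _ _ k). Qed.

Let lam := len m (msq x [set: M]) setT.

Let clen_pow k : clen m (@spow R M x k.+1) setT (lam * 'C(k + d, d)).
Proof.
have s0 := submodule_set0 M; have := @clen_spow _ M m [set 0] x lam k locR nM s0 mx wM.
rewrite !add0m xd; apply; apply: (flen_clen locR).
apply: (@flen_mpow _ n.+1); first exact: submodule_msq.
by rewrite -addn1; exact: (@reduction_mod 1).
Qed.

Lemma colength_mpow k l : has_colength (smul (ideal_pow m k.+1) [set: M]) l <->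
  len m (mpow k.+1) setT = l.
Proof.
have -> : smul (ideal_pow m k.+1) [set: M] = mpow k.+1 by exact: (@smul_iter R M m k.+1 setT).
apply: (has_colengthP locR _ (smpow _)).
exact: (@flen_mpow _ k.+1).
Qed.

(** Let Q(k) be the colength of x^(k+1) M. As x^(k+1) M <= m^(k+1) M and m^(n+k+1) M <= x^(k+1) M,
    eventually P(k) <= Q(k) <= P(k+n). A shift of the variable keeps the coefficient of degree d, so
    those of P and Q agree. *)
Lemma multiplicity_len e : has_multiplicity m M e -> e = lam.
Proof.
move=> [s [P [dimM' sP [k0 Pk] eE]]].
have sd : s = d := longest_chain_uniq dimM' dimM.
rewrite {s dimM'}sd in sP eE *.
pose Q : {poly rat} := lam%:R *: binomial_poly d.
have Qk k : Q.[k%:R] = (lam * 'C(k + d, d))%:R by rewrite hornerZ binomial_polyE natrM.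
have sQ : (size Q <= d.+1)%N by rewrite -(size_binomial_poly d) size_scale_leq.
have Pk' k : (k0 <= k)%N -> P.[k%:R] = (len m (mpow k.+1) setT)%:R.
  by move=> /Pk [l /colength_mpow <- ->].
have QdE : Q`_d = lam%:R * d`!%:R^-1.
  by rewrite coefZ -lead_binomial_poly /lead_coef size_binomial_poly.
have lePQ : P`_d <= Q`_d.
  apply: (@eventually_le_coef P Q d k0) => // [|k k0k]; first by rewrite sP.
  rewrite Pk' // Qk ler_nat.
  have [_ _ E] := len_add locR (ex_intro _ _ (clen_pow k)) (smpow k.+1) (@spow_sub_mpow _)
    (@subsetT _ _).
  by rewrite -(clen_len locR (clen_pow k)) E leq_addl.
have [ss cs] := coef_shift n sP.
have leQP : Q`_d <= P`_d.
  rewrite -cs; apply: (@eventually_le_coef Q _ d k0) => // [|k k0k]; first by rewrite ss.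
  rewrite horner_comp hornerD hornerX hornerC -natrD Pk' ?(leq_trans k0k) ?leq_addr //.
  rewrite Qk ler_nat.
  have sub : mpow (k + n).+1 `<=` spow x k.+1.
    by rewrite addnC -addnS; exact: reduction_mod.
  have [_ _ E] := len_add locR (flen_mpow (smpow _) (@subset_refl _ (mpow (k + n).+1)))
    (@submodule_spow R M x k.+1) sub (@subsetT _ _).
  by rewrite E (clen_len locR (clen_pow k)) leq_addl.
apply/eqP; rewrite -(eqr_nat rat) eE /lead_coef sP /=; apply/eqP.
have -> : P`_d = Q`_d by apply/eqP; rewrite eq_le lePQ.
by rewrite QdE mulrCA mulfV ?mulr1 // pnatr_eq0 -lt0n fact_gt0.
Qed.

Hypothesis xT : msq x [set: M] <> setT.

Let lam_gt0 : (0 < lam)%N.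
Proof.
apply: (len_gt0 locR).
  apply: (@flen_mpow _ n.+1); first exact: submodule_msq.
  by rewrite -addn1; exact: (@reduction_mod 1).
by move=> h; apply: xT; apply/seteqP; split.
Qed.

(** The first form occurs when mM = xM. The second, delayed by one, occurs for R itself when m^2
    lies in the ideal of [x]; Q is the contribution of lower degree. *)
Lemma multiplicity_intro (P Q : {poly rat}) k0 : P = lam%:R *: binomial_poly d + Q \/
    P = lam%:R *: (binomial_poly d \Po ('X + (-1)%:P)) + Q ->
  (size Q <= d)%N ->
  (forall k, (k0 <= k)%N -> P.[k%:R] = (len m (mpow k.+1) setT)%:R) ->
  has_multiplicity m M lam.
Proof.
move=> PE sQ Pk.
have l0 : (lam%:R : rat) != 0 by rewrite pnatr_eq0 -lt0n lam_gt0.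
have f0 : (d`!%:R : rat) != 0 by rewrite pnatr_eq0 -lt0n fact_gt0.
have [sP lP] : size P = d.+1 /\ lead_coef P = lam%:R * d`!%:R^-1.
  have s2 : size ('X + (-1)%:P : {poly rat}) = 2%N by rewrite size_XaddC.
  case: PE => ->.
    have s1 : size (lam%:R *: binomial_poly d) = d.+1 by rewrite size_scale // size_binomial_poly.
    by rewrite size_polyDl ?lead_coefDl s1 // lead_coefZ lead_binomial_poly.
  have s1 : size (lam%:R *: (binomial_poly d \Po ('X + (-1)%:P))) = d.+1.
    by rewrite size_scale // size_comp_poly2 ?size_binomial_poly.
  rewrite size_polyDl ?lead_coefDl s1 // lead_coefZ lead_coef_comp ?s2 //.
  by rewrite lead_coefXaddC expr1n mulr1 lead_binomial_poly.
exists d, P; split=> //.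
  exists k0 => k k0k; exists (len m (mpow k.+1) setT); first exact/colength_mpow.
  exact: Pk.
by rewrite lP mulrCA mulfV ?mulr1.
Qed.

(** All powers of m and of [x] agree on M, so the Hilbert function is the binomial polynomial times
    [lam], from k = 0 on. *)
Lemma multiplicity_ulrich : smul m [set: M] `<=` msq x setT -> has_multiplicity m M lam.
Proof.
move=> mM; apply: (@multiplicity_intro (lam%:R *: binomial_poly d) 0 0); first by left;
  rewrite addr0.
  by rewrite size_poly0.
move=> k _; rewrite hornerZ binomial_polyE -natrM -(clen_len locR (clen_pow k)).
congr (len m _ _)%:R; apply/seteqP; split; first exact: spow_sub_mpow.
have step_ j : smul m (@spow _ M x j) `<=` spow x j.+1.
  elim: j => [//|j IH]; apply: smul_min; first exact: submodule_spow.
  move=> a y ma jy; apply: (@msq_scale _ M x (spow x j) (spow x j.+1)) => //.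
    exact: submodule_spow.
  by move=> z jz; apply: IH; exact: mem_smul.
elim: k.+1 => [//|j IH]; apply: subset_trans (step_ j); exact: smulS.
Qed.

End Multiplicity.

(** * Regular sequences on exact sequences and powers *)

Section WregMaps.
Variable R : comNzRingType.

Lemma addsc_addm (M : lmodType R) (N A : set M) a : submodule N -> submodule A ->
  addsc (addm N A) a = addm (addsc N a) A.
Proof.
move=> sN sA; apply/seteqP; split=> y.
  move=> [u [w Aw Nw]]; exists w => //; exists u.
  by apply: eqmem Nw _; module_eq R M.
move=> [w Aw [u Nu]]; exists u, w => //.
by apply: eqmem Nu _; module_eq R M.
Qed.

(** Passes regularity of a sequence from a product to its factors. *)
Lemma wreg_retract (A M : lmodType R) (i : {linear A -> M}) (p : {linear M -> A})
    (N : set M) (L : set A) s : cancel i p ->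
  (forall y, L y -> N (i y)) -> (forall z, N z -> L (p z)) -> wreg N s -> wreg L s.
Proof.
move=> ip; elim: s N L => [//|a s IH] N L LN NL [ra ws]; split.
  move=> y /LN; rewrite linearZZ => /ra /NL; by rewrite ip.
apply: IH ws => [y [u /LN]|z [u /NL]].
  by rewrite linearB linearZZ => h; exists (i u).
by rewrite linearB linearZZ => h; exists (p u).
Qed.

Lemma wreg_surj (B C : lmodType R) (g : {linear B -> C}) (N : set C) s :
  submodule N -> set_surj setT setT g -> wreg (g @^-1` N) s <-> wreg N s.
Proof.
move=> + gs; have {}gs c : exists b, g b = c by have [b _ <-] := gs c Logic.I; exists b.
elim: s N => [//|a s IH] N sN /=.
have -> : addsc (g @^-1` N) a = g @^-1` (addsc N a).
  apply/seteqP; split=> y [u Nu].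
    by exists (g u); rewrite -linearZZ -linearB.
  have [b gb] := gs u; exists b.
  by rewrite /preimage /= linearB linearZZ gb.
rewrite IH; last exact: submodule_addsc.
split=> [[ra ws]|[ra ws]]; split=> // y.
  by have [b <-] := gs y; rewrite -linearZZ; exact: ra.
by rewrite /preimage /= linearZZ; exact: ra.
Qed.

(** If iy = au modulo N, then u is in N + im i, as [a] is regular on the cokernel. So reducing by
    [a] commutes with taking the preimage, a form of the vanishing of Tor_1. *)
Lemma wreg_preimage (L B : lmodType R) (i : {linear L -> B}) (N : set B) s :
  submodule N -> wreg N s -> wreg (addm N (range i)) s ->
  wreg (i @^-1` N) s /\
  addm (i @^-1` N) (msq s setT) = i @^-1` (addm N (msq s setT)).
Proof.
have si : submodule (range i) := submodule_image i (submodule_setT L).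
elim: s N => [|a s IH] N sN; first by rewrite /= !addm0.
rewrite /= addsc_addm // => -[rN wN] [rA wA].
have sNa := submodule_addsc a sN; have sNi := submodule_preimage i sN.
have E : addsc (i @^-1` N) a = i @^-1` (addsc N a).
  apply/seteqP; split=> y [u Nu].
    by exists (i u); rewrite -linearZZ -linearB.
  have [_ [l _ <-] Nul] : addm N (range i) u.
    apply: rA; exists (i y); first by exists y.
    by apply: eqmem (submN sN Nu) _; rewrite opprB.
  exists l; rewrite /preimage /= linearB linearZZ.
  by apply: eqmem (submD sN Nu (submZ a sN Nul)) _; module_eq R B.
have [wL EL] := IH _ sNa wN wA.
rewrite E; split; first split=> //.
  by move=> y; rewrite /preimage /= linearZZ; exact: rN.
have := EL; rewrite -E -!addm_msq1 //.
Qed.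

Lemma ses_wreg (A B C : lmodType R) (f : {linear A -> B}) (g : {linear B -> C}) s :
  short_exact f g -> wreg [set (0 : B)] s -> wreg [set (0 : C)] s ->
  wreg [set (0 : A)] s /\ msq s [set: A] = f @^-1` (msq s [set: B]).
Proof.
move=> [f_inj g_surj fg] wB /(wreg_surj s (submodule_set0 C) g_surj) wC.
have s0 := submodule_set0 B.
have gE : g @^-1` [set 0] = addm [set 0] (range f).
  rewrite add0m; apply/seteqP; split=> y; first by move=> /fg [x <-]; exists x.
  by move=> [x _ <-]; apply/fg; exists x.
rewrite gE in wC; have [] := wreg_preimage s0 wB wC.
have -> : f @^-1` [set 0] = [set 0].
  apply/seteqP; split=> y; last by move=> ->; rewrite /preimage /= linear0.
  by rewrite /preimage /= -(linear0 f) => /f_inj.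
by rewrite !add0m.
Qed.

(* Injectivity modulo a regular sequence lifts, by Nakayama's lemma. *)
Lemma wreg_lift (m : set R) (B : lmodType R) (f : {linear R^o -> B}) (I : set R^o)
    (N : set B) s : noetherian_local m -> (forall a, a \in s -> m a) ->
  submodule I -> submodule N -> (forall a, I a -> N (f a)) -> wreg N s ->
  (forall a, addm N (msq s setT) (f a) -> addm I (msq s setT) a) ->
  (forall a, N (f a) -> I a) /\ wreg (addm N (range f)) s.
Proof.
move=> locR; have sf : submodule (range f) := submodule_image f (submodule_setT _).
elim: s I N => [|a s IH] I N ms sI sN IN.
  by rewrite !addm0.
have ma : m a by apply: ms; rewrite mem_head.
rewrite /= => -[rN wN] h; have sNa := submodule_addsc a sN; have sIa := submodule_addsc a sI.
have [|||inj wreg'] := IH (addsc I a) (addsc N a) _ sIa sNa _ wN.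
- by move=> b bs; apply: ms; rewrite inE bs orbT.
- move=> c [u Iu]; exists (f u); rewrite -linearZZ -linearB; exact: IN.
- by move=> c; rewrite -!addm_msq1 //; exact: h.
rewrite addsc_addm //; split; last split=> //.
  pose Z : set R^o := f @^-1` N.
  have sZ : submodule Z := submodule_preimage f sN.
  apply: (Nakayama locR (noeth_ring locR) sI sZ) => c Nc.
  have [u Iu] : addsc I a c by apply: inj; exact: sub_addsc.
  exists (a *: u) => //; apply: mem_smul => //; rewrite /Z /preimage /=.
  apply: rN; rewrite -linearZZ; have := submB sN Nc (IN _ Iu).
  by rewrite -linearB opprB addrC subrK.
move=> y [_ [c _ <-] Nyc].
have [u Iu] : addsc I a c.
  by apply: inj; exists y; apply: eqmem (submN sN Nyc) _; rewrite opprB.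
exists (f u); first by exists u.
apply: rN; apply: eqmem (submD sN Nyc (IN _ Iu)) _.
by rewrite linearB linearZZ; module_eq R B.
Qed.

End WregMaps.

Section Powers.
Variables (R : comNzRingType) (m : set R) (M V : lmodType R) (n : nat).
Variable pr : 'I_n -> {linear V -> M}.
Hypothesis pr_surj : forall w : 'I_n -> M, exists v, forall j, pr j v = w j.
Hypothesis pr_inj : forall v, (forall j, pr j v = 0) -> v = 0.
Implicit Types (N L : set M).

(** V is known through its coordinate maps only, so as to cover both row vectors and finite
    functions. *)
Definition power N : set V := [set v | forall j, N (pr j v)].

Lemma submodule_power N : submodule N -> submodule (power N).
Proof.
move=> sN; split=> [j|a u v Nu Nv j]; first by rewrite linear0; exact: subm0.
by rewrite linearP; apply: submD => //; exact: submZ.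
Qed.

Lemma power0 : power [set 0] = [set 0].
Proof.
apply/seteqP; split=> v; first by move=> /pr_inj.
by move=> -> j; rewrite linear0.
Qed.

Lemma powerT : power setT = setT.
Proof. by apply/seteqP; split. Qed.

Lemma addsc_power N a : addsc (power N) a = power (addsc N a).
Proof.
apply/seteqP; split=> v.
  by move=> [u Nu] j; exists (pr j u); rewrite -linearZZ -linearB.
move=> /choice [w wP]; have [u uw] := pr_surj w.
by exists u => j; rewrite linearB linearZZ uw.
Qed.

Lemma power_msq N s : submodule N ->
  addm (power N) (msq s setT) = power (addm N (msq s setT)).
Proof.
elim: s N => [|a s IH] N sN; first by rewrite !addm0.
rewrite !addm_msq1 //; last exact: submodule_power.
by rewrite addsc_power IH //; exact: submodule_addsc.
Qed.

Lemma msq_power s : msq s [set: V] = power (msq s setT).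
Proof. by rewrite -[LHS]add0m -power0 power_msq ?add0m //; exact: submodule_set0. Qed.

Lemma wreg_power N s : submodule N -> wreg N s -> wreg (power N) s.
Proof.
elim: s N => [//|a s IH] N sN [ra ws]; split.
  by move=> v Nv j; apply: ra; have := Nv j; rewrite linearZZ.
by rewrite addsc_power; apply: IH => //; exact: submodule_addsc.
Qed.

Lemma wreg_power0 s : wreg [set (0 : M)] s -> wreg [set (0 : V)] s.
Proof. by rewrite -power0; exact/wreg_power/submodule_set0. Qed.

Lemma socle_power N : socle m (power N) = power (socle m N).
Proof.
apply/seteqP; split=> v Sv.
  by move=> j a ma; have := Sv a ma j; rewrite linearZZ.
by move=> a ma j; rewrite linearZZ; exact: Sv.
Qed.

Lemma clen_power N L l : clen m N L l -> clen m (power N) (power L) (n * l).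
Proof.
move=> NL; have [sN sL NL'] := clen_submod NL.
(* The first [k] coordinates are allowed in L, the others in N; consecutive quotients are copies of
   L / N. *)
pose W k : set V := [set v | forall j : 'I_n, if (j < k)%N then L (pr j v) else N (pr j v)].
have -> : power N = W 0%N by apply/seteqP; split.
have -> : power L = W n.
  by apply/seteqP; split=> v Lv j; have := Lv j; rewrite ltn_ord.
have sW k : submodule (W k).
  split=> [j|a u v Wu Wv j]; first by rewrite linear0; case: ifP => _; exact: subm0.
  move: (Wu j) (Wv j); rewrite linearP; case: ifP => _ ? ?; apply: submD => //; exact: submZ.
have h k : (k <= n)%N -> clen m (W 0%N) (W k) (k * l).
  elim: k => [|k IH] kn; first by split.
  rewrite mulSn addnC; apply: clen_cat (IH (ltnW kn)) _.
  pose k' := Ordinal kn.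
  have Wk : L `<=` addm N (pr k' @` W k.+1).
    move=> y Ly; have [v vP] := pr_surj (fun j => if j == k' then y else 0).
    exists y; last by rewrite subrr; exact: subm0.
    exists v; last by rewrite vP eqxx.
    move=> j; rewrite vP; case: eqP => [->|_]; first by rewrite ltnSn.
    by case: ifP => _; exact: subm0.
  have := clen_preimage (sW k.+1) Wk NL; congr (clen m _ _ _).
    have ltE j : j != k' -> (j < k.+1)%N = (j < k)%N.
      by move=> jk; rewrite ltnS leq_eqVlt -[k]/(val k') val_eqE (negPf jk).
    apply/seteqP; split=> v.
      move=> [Wv Nv] j; have [->|jk] := eqVneq j k'; first by rewrite /= ltnn.
      by rewrite -(ltE j jk); exact: Wv.
    move=> Wv; split; last by have := Wv k'; rewrite /= ltnn.
    move=> j; have [->|jk] := eqVneq j k'; last by rewrite (ltE j jk); exact: Wv.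
    by rewrite /= ltnSn; apply: NL'; have := Wv k'; rewrite /= ltnn.
  apply/seteqP; split=> v; first by move=> [].
  by move=> Wv; split=> //; have := Wv k'; rewrite ltnSn.
exact: h.
Qed.

End Powers.

(** The binomial counts the monomials of degree [k] in the members of [a :: s], and each contributes
    an image of B / A. The recursion on monomials with or without [a] is Pascal's rule. *)
Lemma iter_msq_le (R : comNzRingType) (m : set R) (M : lmodType R) (A B : set M) a s p k :
  noetherian_local m -> clen m A B p ->
  exists2 r, (r <= p * 'C(k + size s, size s))%N &
    clen m (iter k (msq (a :: s)) A) (iter k (msq (a :: s)) B) r.
Proof.
move=> locR AB; have [sA sB _] := clen_submod AB.
have comm (X Y : set M) : submodule X -> submodule Y -> addm X Y = addm Y X.
  move=> sX sY; apply/seteqP; split; (apply: addm_min; first exact: submodule_addm);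
    by [exact: sub_addml|exact: sub_addmr].
have sa c t j (X : set M) : submodule X -> submodule ( *:%R c @` iter j (msq t) X).
  by move=> sX; exact: (submodule_image ( *:%R c) (submodule_iter_msq t j sX)).
elim: s a k => [|b s IH] a k.
  elim: k => [|k [r rp cr]]; first by exists p; rewrite ?bin0 ?muln1.
  rewrite bin0 muln1 in rp *.
  have E (X : set M) : submodule X -> iter k.+1 (msq [:: a]) X =
      addm [set 0] ( *:%R a @` iter k (msq [:: a]) X).
    by move=> sX; rewrite iter_msq_cons.
  have [r' r'r cr'] := clen_image_le locR ( *:%R a) (submodule_set0 M) cr.
  exists r'; first exact: leq_trans rp.
  by rewrite !E.
elim: k => [|k [r rp cr]]; first by exists p; rewrite ?binn ?muln1.
have [r2 r2p cr2] := IH b k.+1.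
have sS (X : set M) : submodule X -> submodule (iter k.+1 (msq (b :: s)) X).
  exact: submodule_iter_msq.
rewrite !(@iter_msq_cons _ _ a) //.
have [r3 r3r cr3] := clen_image_le locR ( *:%R a) (sS A sA) cr.
have [r4 r4r cr4] := clen_addm_le locR (sa a (a :: b :: s) k B sB) cr2.
exists (r3 + r4)%N.
  apply: leq_trans (leq_add r3r r4r) _; apply: leq_trans (leq_add rp r2p) _.
  by rewrite -mulnDr /= !addnS !addSn [in X in (_ <= X)%N]binS.
apply: clen_cat cr3 _.
have saB := sa a (a :: b :: s) k B sB.
by rewrite (comm _ _ (sS A sA) saB) (comm _ _ (sS B sB) saB).
Qed.

(** * Minimal multiplicity *)

Section Reduced.
Variables (R : comNzRingType) (m : set R) (d n : nat) (x : seq R).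
Hypothesis locR : noetherian_local m.
Hypotheses (dimR : has_dim R^o d) (d_gt0 : (0 < d)%N).
Hypotheses (xd : size x = d) (mx : forall a, a \in x -> m a).
Hypotheses (wR : wreg [set (0 : R^o)] x) (redx : reduction m x n).
Let mpow (k : nat) : set R^o := iter k (@smul R R^o m) setT.
Let J : set R^o := msq x setT.

Lemma mpow1 : mpow 1 = m.
Proof.
apply/seteqP; split.
  apply: smul_min; first exact: ideal_max.
  by move=> a y ma _; rewrite scale_regE mulrC; exact: max_mul.
move=> a ma; have := @mem_smul R R^o m setT a 1 ma Logic.I.
by rewrite scale_regE mulr1.
Qed.

Lemma clen_max : clen m (m : set R^o) setT 1.
Proof.
apply: clen1; exists 1; split; [exact: ideal_max|exact: max_not1| |].
  by move=> a ma; rewrite scale_regE mulr1.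
apply/seteqP; split=> // y _; exists y.
by rewrite scale_regE mulr1 subrr; exact: (subm0 (ideal_max locR)).
Qed.

Lemma submodule_J : submodule J.
Proof. exact: submodule_msq. Qed.

Lemma J_max : J `<=` m.
Proof. exact: msq_sub_max. Qed.

Lemma mpow_J : mpow n.+1 `<=` J.
Proof. by apply: subset_trans redx _; exact: msqS. Qed.

Lemma flen_J : flen m J setT.
Proof.
by apply: (@flen_noeth _ _ R^o _ _ n.+1) => //; [exact: noeth_ring locR|exact:
  submodule_J|exact: mpow_J].
Qed.

Lemma J_neqT : J <> setT.
Proof. by move=> JT; apply: (max_not1 locR); apply: J_max; rewrite JT. Qed.

Lemma socle_neq_J : ~ (socle m J `<=` J).
Proof.
move=> SJ; have [|b [_ Jb mb]] := @socle_exists _ m R^o setT J n.+1 (submodule_setT _)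
  submodule_J mpow_J.
  by move=> JT; apply: J_neqT; apply/seteqP; split.
by apply: Jb; exact: SJ.
Qed.

Lemma submodule_socleJ : submodule (socle m J).
Proof. by apply: submodule_socle; exact: submodule_J. Qed.

Lemma sub_socleJ : J `<=` socle m J.
Proof. by move=> y Jy a _; exact: (submZ a submodule_J). Qed.

(** If 1 were in the socle, J would be m and the socle of R / J would have length one. *)
Lemma socle_sub_max : (1 < len m J (socle m J))%N -> socle m J `<=` m.
Proof.
move=> r1; have [fm fmT lm] := len_add locR flen_J (ideal_max locR) J_max (@subsetT _ _).
have [fS fST lS] := len_add locR flen_J submodule_socleJ sub_socleJ (@subsetT _ _).
have lmT := clen_len locR clen_max.
apply: (ideal_sub_max locR submodule_socleJ) => S1.
have mJ : m `<=` J by move=> a ma; have := S1 a ma; rewrite scale_regE mulr1.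
have JE : J = m by apply/seteqP; split=> //; exact: J_max.
have [_ lmm] := @len_self _ _ locR R^o (m : set R^o) (ideal_max locR).
by move: r1 lS lm; rewrite -JE in lmm lmT *; rewrite lmm lmT; lia.
Qed.

Lemma len_socle_lt : (1 < len m J (socle m J))%N ->
  (len m J (socle m J) < len m J setT)%N.
Proof.
move=> /socle_sub_max Sm; apply: len_lt => //.
- exact: flen_J.
- exact: submodule_socleJ.
- exact: sub_socleJ.
- by move=> TS; apply: (max_not1 locR); apply: Sm; exact: TS.
Qed.

(* [m^2 <= J] says that the socle of [R / J] is [m / J]. *)
Lemma msquare_socle : (1 < len m J (socle m J))%N ->
  mpow 2 `<=` J <-> (len m J setT <= (len m J (socle m J)).+1)%N.
Proof.
move=> r1; have [fS fST lS] := len_add locR flen_J submodule_socleJ sub_socleJ (@subsetT _ _).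
have [fm fmT lm] := len_add locR flen_J (ideal_max locR) J_max (@subsetT _ _).
have lmT := clen_len locR clen_max.
have Sm := socle_sub_max r1.
have [_ fSm lSm] := len_add locR fm submodule_socleJ sub_socleJ Sm.
have mpow2E : mpow 2 `<=` J <-> m `<=` socle m J.
  split=> [m2 a ma b mb|mS].
    by apply: m2; apply: (@mem_smul R R^o m (mpow 1) b a mb); rewrite mpow1.
  rewrite /mpow iterS -/(mpow 1) mpow1; apply: smul_min; first exact: submodule_J.
  by move=> b a mb /mS; apply.
rewrite mpow2E; split=> [mS|le].
  have SE : socle m J = m by apply/seteqP; split.
  by rewrite lm lmT SE addn1.
have lSm0 : len m (socle m J) m = 0%N by move: le lm lSm; rewrite lmT; lia.
by move=> a; rewrite (len0_eq locR fSm lSm0).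
Qed.

Lemma regular_neqT (M : lmodType R) : noeth M -> (exists y : M, y != 0) ->
  msq x [set: M] <> setT.
Proof.
move=> nM [y y0] xT; have s0 := submodule_set0 M.
have : [set: M] `<=` [set 0].
  apply: (Nakayama locR nM s0 (submodule_setT M)).
  rewrite add0m -[X in X `<=` _]xT; apply: msq_min; first exact: submodule_smul.
  by move=> a z /mx ma _; exact: mem_smul.
by move=> /(_ y Logic.I) E; move: y0; rewrite E eqxx.
Qed.

Lemma ulrich_intro (M : lmodType R) : noeth M -> wreg [set (0 : M)] x ->
  (exists y : M, y != 0) -> smul m [set: M] `<=` msq x setT ->
  max_cohen_macaulay m M /\ ulrich m M.
Proof.
move=> nM wM M0 mM; have xT := regular_neqT nM M0.
have fM : fin_gen M.
  by apply/fin_genP; have [s sE] := nM setT (submodule_setT M); exists s.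
have cM := cohen_macaulay_wreg locR dimR fM mx wM xT xd; split=> //; split; first by case: cM.
have dimM := wreg_has_dim locR dimR wM xT xd.
exists (len m (msq x [set: M]) setT); last exact: (multiplicity_ulrich locR xd mx redx nM wM
  dimM xT mM).
apply/(min_gens_len locR nM _ (submodule_setT M)); congr (len m _ _).
apply/seteqP; split=> //; apply: msq_min; first exact: submodule_smul.
by move=> a z /mx ma _; exact: mem_smul.
Qed.

Lemma ulrich_elim (M : lmodType R) : noeth M -> wreg [set (0 : M)] x -> ulrich m M ->
  smul m [set: M] `<=` msq x setT.
Proof.
move=> nM wM [[fM M0 _] [k kg km]]; have xT := regular_neqT nM M0.
have sT := submodule_setT M; have sx := submodule_msq x sT.
have dimM := wreg_has_dim locR dimR wM xT xd.
have kE := multiplicity_len locR xd mx redx nM wM dimM km.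
have kE' := (min_gens_len locR nM k sT).1 kg.
have xm : msq x [set: M] `<=` smul m setT.
  by apply: msq_min => [|a z /mx ma _]; [exact: submodule_smul|exact: mem_smul].
have fx : flen m (msq x [set: M]) setT.
  apply: (@flen_noeth _ _ M _ _ n.+1) => //; rewrite -addn1; exact:
    (@reduction_mod _ _ n x redx M 1).
have [f1 _ e] := len_add locR fx (submodule_smul m _) xm (@subsetT _ _).
have l0 : len m (msq x [set: M]) (smul m setT) = 0%N by lia.
by rewrite (len0_eq locR f1 l0).
Qed.

Hypothesis flag : clen m (mpow 2) (addm (mpow 2) J) d.
Hypothesis Jm2 : J `&` mpow 2 = smul m J.

Let sm2 : submodule (mpow 2).
Proof. exact: submodule_iter_smul. Qed.

(** Compares the series J <= m^2 + J <= m <= R with m^2 <= m^2 + J <= m, where m^2 + J has length d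
    over m^2. Since l(R / J) is the multiplicity and l(m / m^2) is mu(m), minimal multiplicity means
    that the term of m^2 + J over J vanishes. *)
Lemma len_J_max : (len m J setT + d = len m (mpow 2) m + len m J (addm (mpow 2) J) + 1)%N.
Proof.
have sQ : submodule (addm (mpow 2) J) by apply: submodule_addm => //; exact: submodule_J.
have m2m : mpow 2 `<=` m.
  by rewrite -mpow1; apply: smulS.
have Qm : addm (mpow 2) J `<=` m by apply: addm_min => //; [exact: ideal_max|exact: J_max].
have [_ fQT l1] := len_add locR flen_J sQ (sub_addmr sm2) (@subsetT _ _).
have [_ _ l2] := len_add locR fQT (ideal_max locR) Qm (@subsetT _ _).
have [fm _ _] := len_add locR fQT (ideal_max locR) Qm (@subsetT _ _).
have [_ l3] := len_cat locR (ex_intro _ d flag) fm.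
by rewrite l1 l2 (clen_len locR clen_max) l3 (clen_len locR flag); lia.
Qed.

(** The intersection of J and m^2 being mJ, the hypothesis gives m^2 = Jm, hence m^(k+1) = J^k m,
    and the Hilbert function can be computed. *)
Lemma msquare_multiplicity : mpow 2 `<=` J -> has_multiplicity m R^o (len m J setT).
Proof.
move=> m2J; set lam := len m J setT.
have red1 : reduction m x 1.
  rewrite /reduction -/(mpow 2) -/(mpow 1).
  have -> : mpow 2 = smul m J by rewrite -Jm2; apply/seteqP; split=> y; [split; first exact:
    m2J|case].
  have -> : msq x (mpow 1) = smul J (mpow 1).
    by rewrite smul_msq ?smul_setT //; exact: submodule_smul.
  apply: smul_min; first exact: submodule_smul.
  move=> a y ma Jy; rewrite scale_regE mulrC -scale_regE; apply: mem_smul => //.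
  by rewrite mpow1.
have mpowE k : mpow k.+1 = iter k (msq x) (mpow 1).
  apply/seteqP; split; first by rewrite -add1n; exact: (@reduction_iter _ _ x 1 k red1).
  elim: k => [//|k IH]; apply: msq_min; first exact:
    (submodule_iter_smul m k.+2 (submodule_setT R^o)).
  by move=> a y /mx ma /IH ky; exact: (@mem_smul R R^o m (mpow k.+1) a y ma ky).
have [fm _ lm] := len_add locR flen_J (ideal_max locR) J_max (@subsetT _ _).
rewrite (clen_len locR clen_max) in lm.
have cpow k : clen m (@spow R R^o x k.+1) setT (lam * 'C(k + d, d)).
  have := @clen_spow _ R^o m [set 0] x lam k locR (noeth_ring locR) (submodule_set0 _) mx wR.
  rewrite !add0m xd; apply; exact: (flen_clen locR flen_J).
have iter_le p k A B : clen m A B p -> exists2 r, (r <= p * 'C(k + d.-1, d.-1))%N &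
    clen m (iter k (@msq R R^o x) A) (iter k (msq x) B) r.
  have [a [s xE]] : exists a s, x = a :: s.
    by case: (x) xd => [d0|a s _]; [move: d_gt0; rewrite -d0|exists a, s].
  by rewrite -xd xE; exact: iter_msq_le.
(* In J^(k+2) <= J^(k+1) m <= J^(k+1), with c the binomial C(k+d, d-1), the steps have length at
   most (lam - 1)c and c. The total is exactly lam c, so both bounds are attained. *)
have lenE k : len m (mpow k.+2) setT = (lam * 'C(k + d, d) + 'C(k.+1 + d.-1, d.-1))%N.
  have c1 : clen m (mpow 1) [set: R^o] 1 by rewrite mpow1; exact: clen_max.
  have c2 : clen m J (mpow 1) (len m J m) by rewrite mpow1; exact: (flen_clen locR fm).
  have [r1 r1l cr1] := iter_le _ k.+1 _ _ c1.
  have [r2 r2l cr2] := iter_le _ k.+1 _ _ c2.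
  have J'E : iter k.+1 (msq x) J = @spow R R^o x k.+2 by rewrite /spow [RHS]iterSr.
  rewrite -mpowE in cr1 cr2; rewrite J'E in cr2.
  have := clen_uniq locR (clen_cat cr2 (clen_cat cr1 (cpow k))) (cpow k.+1).
  rewrite (clen_len locR (clen_cat cr1 (cpow k))).
  have -> : (k.+1 + d = (k.+1 + d.-1).+1)%N by lia.
  have -> : 'C((k.+1 + d.-1).+1, d) = ('C(k + d, d) + 'C(k.+1 + d.-1, d.-1))%N.
    by have [e ->] : exists e, d = e.+1; [by exists d.-1; lia|rewrite binS addnS addSn].
  move: r1l r2l; rewrite mulnDr mul1n; set c := 'C(_, d.-1) => r1l r2l.
  have -> : (lam * c = len m J m * c + c)%N by rewrite /lam lm addn1 mulSn addnC.
  lia.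
have sQ : (size (binomial_poly d.-1) <= d)%N by rewrite size_binomial_poly prednK.
pose P := lam%:R *: (binomial_poly d \Po ('X + (-1)%:P)) + binomial_poly d.-1.
apply: (@multiplicity_intro _ _ d n x locR redx R^o (noeth_ring locR) dimR J_neqT
  P (binomial_poly d.-1) 1) => //; first by right.
move=> [//|k] _; rewrite lenE /P hornerD hornerZ horner_comp hornerD hornerX hornerC.
rewrite binomial_polyE -[k.+1%:R + -1]/(k.+1%:R - 1%:R) -natrB // subn1 binomial_polyE.
by rewrite natrD natrM.
Qed.

Lemma min_multP : minimal_multiplicity m <-> mpow 2 `<=` J.
Proof.
have sm := ideal_max locR; have nR := noeth_ring locR.
have m2E : @smul R R^o m m = mpow 2 by rewrite -[in LHS]mpow1 {1}mpow1.
split=> [[e [k [d' [eR km dR' E]]]]|m2J].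
  have dd' : d' = d := longest_chain_uniq dR' dimR.
  have le : e = len m J setT.
    exact: (@multiplicity_len _ _ d n x locR xd mx redx R^o nR wR dimR).
  have lk : k = len m (mpow 2) m.
    by apply/esym; have := (min_gens_len locR nR k sm).1 km; rewrite m2E.
  have sQ : submodule (addm (mpow 2) J) by apply: submodule_addm => //; exact: submodule_J.
  have [fQ _ _] := len_add locR flen_J sQ (sub_addmr sm2) (@subsetT _ _).
  have l0 : len m J (addm (mpow 2) J) = 0%N by move: len_J_max E; rewrite -le -lk dd'; lia.
  rewrite (len0_eq locR fQ l0); apply: sub_addml; exact: submodule_J.
exists (len m J setT), (len m (mpow 2) m), d; split=> //.
- exact: msquare_multiplicity.
- by apply/(min_gens_len locR nR _ sm); rewrite m2E.
have JE : addm (mpow 2) J = J.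
  apply/seteqP; split; last exact: sub_addmr.
  by apply: addm_min => //; exact: submodule_J.
have [_ l0] := @len_self _ _ locR R^o J submodule_J.
by move: len_J_max; rewrite JE l0; lia.
Qed.

End Reduced.

(** * The canonical module *)

Section Images.
Variables (R : comNzRingType) (A B : lmodType R) (f : {linear A -> B}).

Lemma image_msq s (L : set A) : f @` msq s L = msq s (f @` L).
Proof.
elim: s => [|a s IH] /=.
  by apply/seteqP; split=> [_ [_ -> <-]|_ ->]; [rewrite linear0|exists 0; rewrite ?linear0].
apply/seteqP; split=> [_ [y [u Lu su] <-]|y [_ [u Lu <-]]].
  exists (f u); first by exists u.
  by rewrite -linearZZ -linearB -IH; exists (y - a *: u).
rewrite -IH => -[z sz fz]; exists (z + a *: u).
  by exists u => //; rewrite addrK.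
by rewrite linearD linearZZ fz subrK.
Qed.

Lemma noeth_injective : noeth B -> injective f -> noeth A.
Proof.
move=> nB f_inj N sN; have [s sE] := nB _ (submodule_image f sN).
have [t tE] : exists t : seq A, s = map f t.
  have : forall v, v \in s -> exists u, v = f u.
    by move=> v /mem_spans; rewrite -sE => -[u _ <-]; exists u.
  elim: (s) => [|v s' IH] h; first by exists [::].
  have [|t ->] := IH; first by move=> w ws; apply: h; rewrite inE ws orbT.
  by have [u ->] := h v (mem_head _ _); exists (u :: t).
have spansE (u : seq A) : f @` spans u = spans (map f u).
  apply/seteqP; split.
    move=> _ [y uy <-]; apply: (spans_min (submodule_preimage f (submodule_spans (map f u))) _
      uy).
    by move=> v vu; apply: mem_spans; exact: map_f.
  apply: spans_min; first exact/submodule_image/submodule_spans.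
  by move=> _ /mapP[v vu ->]; exists v => //; exact: mem_spans.
exists t; apply/seteqP; split=> y Ny.
  have : (f @` N) (f y) by exists y.
  by rewrite sE tE -spansE => -[z tz /f_inj <-].
have : (f @` spans t) (f y) by exists y.
by rewrite spansE -tE -sE => -[z tz /f_inj <-].
Qed.

End Images.

Lemma preimage_msq_ses (R : comNzRingType) (A B C : lmodType R) (f : {linear A -> B})
    (g : {linear B -> C}) s : short_exact f g ->
  g @^-1` (msq s setT) = addm (msq s setT) (range f).
Proof.
move=> [_ gs fg]; have gT : g @` setT = setT.
  by apply/seteqP; split=> // y _; have [z _ <-] := gs y Logic.I; exists z.
apply/seteqP; split=> y.
  rewrite /preimage /= -{1}gT -image_msq => -[z sz gz].
  have /fg [u fu] : g (y - z) = 0 by rewrite linearB gz subrr.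
  exists (f u); first by exists u.
  by rewrite fu opprB addrC subrK.
move=> [_ [u _ <-] yu]; rewrite /preimage /=.
have -> : g y = g (y - f u).
  by rewrite linearB (fg (f u)).2 ?subr0 //; exists u.
by rewrite -gT -image_msq; exists (y - f u).
Qed.

Lemma power_smul (R : comNzRingType) (m : set R) (M V : lmodType R) n
    (pr : 'I_n -> {linear V -> M}) :
  noetherian_local m -> (forall w : 'I_n -> M, exists v, forall j, pr j v = w j) ->
  (forall v, (forall j, pr j v = 0) -> v = 0) ->
  smul m [set: V] = power pr (smul m setT).
Proof.
move=> locR prs pri; have [ms msE] := noeth_ring locR (ideal_max locR).
have E (L : lmodType R) : smul m [set: L] = msq ms setT.
  have h := @smul_msq R L ms setT setT (submodule_setT _) (submodule_setT _).
  by rewrite smul_setT // in h; rewrite {1}msE -msq_spans; exact: h.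
by rewrite !E; exact: msq_power.
Qed.

Lemma clen_residue_dim (R : comNzRingType) (m : set R) (M : lmodType R) (N L : set M) n :
  noetherian_local m -> clen m N L n -> (forall a y, m a -> L y -> N (a *: y)) ->
  has_residue_dim m L N n.
Proof.
move=> locR; elim: n N => [|n IH] N.
  move=> [sN <-] _; exists (fun=> 0); split=> [[]//|z Nz|a _ []//].
  by exists (fun=> 0); rewrite big_ord0 subr0.
move=> [_ [b [sN Nb mb ->]] cl] mL.
have [_ sL NL] := clen_submod cl.
have [v [Lv vgen vfree]] := IH _ cl (fun a y ma Ly => @sub_adj _ _ _ _ _ (mL a y ma Ly)).
pose w (i : 'I_n.+1) := if unlift ord0 i is Some j then v j else b.
have sumw (a : 'I_n.+1 -> R) : \sum_i a i *: w i =
    a ord0 *: b + \sum_j a (lift ord0 j) *: v j.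
  rewrite big_ord_recl /w unlift_none; congr (_ + _).
  by apply: eq_bigr => j _; rewrite liftK.
exists w; split.
- by move=> i; rewrite /w; case: unliftP => [j _|_]; [exact: Lv|apply/NL/mem_adj].
- move=> z /vgen [a [c Nc]].
  exists (fun i => if unlift ord0 i is Some j then a j else c).
  rewrite sumw unlift_none; under eq_bigr => j _ do rewrite liftK.
  by apply: eqmem Nc _; module_eq R M.
move=> a; rewrite sumw => Na.
have free j : m (a (lift ord0 j)).
  apply: (vfree (fun j => a (lift ord0 j))); exists (- a ord0).
  by apply: eqmem Na _; module_eq R M.
have Nb0 : N (a ord0 *: b).
  have Ns : N (\sum_j a (lift ord0 j) *: v j).
    by apply: subm_sum => // j _; apply: mL.
  by apply: eqmem (submB sN Na Ns) _; module_eq R M.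
move=> i; case: (unliftP ord0 i) => [j ->|->]; first exact: free.
by apply: contrapT => ma; apply: Nb; exact: (submZ_unit locR sN ma).
Qed.

Lemma len_preimage_surj (R : comNzRingType) (m : set R) (A B : lmodType R)
    (f : {linear A -> B}) (N : set B) : noetherian_local m -> set_surj setT setT f ->
  flen m N setT -> flen m (f @^-1` N) setT /\ len m (f @^-1` N) setT = len m N setT.
Proof.
move=> locR fs fN; have [sN _ _] := flen_submod fN.
have E : addm N (f @` setT) = setT.
  apply/seteqP; split=> // y _; have [z _ <-] := fs y Logic.I.
  by apply: sub_addmr => //; exists z.
have := @len_preimage R m locR A B f setT N (submodule_setT A) sN.
by rewrite E setTI => -[] // ? ->.
Qed.

Lemma noeth_surj (R : comNzRingType) (A B : lmodType R) (f : {linear A -> B}) :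
  noeth A -> set_surj setT setT f -> noeth B.
Proof.
move=> nA fs L sL; have [s sE] := nA _ (submodule_preimage f sL).
exists (map f s); apply/seteqP; split=> y Ly.
  have [z _ zy] := fs y Logic.I.
  have : (f @^-1` L) z by rewrite /preimage /= zy.
  rewrite sE -zy; apply: (spans_min (submodule_preimage f (submodule_spans (map f s)))).
  by move=> v vs; apply: mem_spans; exact: map_f.
apply: (spans_min sL _ Ly) => _ /mapP[v vs ->].
have : (f @^-1` L) v by rewrite sE; exact: mem_spans.
by [].
Qed.

Section FfunPower.
Variables (R : comNzRingType) (M : lmodType R) (n : nat).

Definition ffun_pr (j : 'I_n) : {linear {ffun 'I_n -> M} -> M} :=
  HB.pack (fun w : {ffun 'I_n -> M} => w j)
    (GRing.isLinear.Build _ _ _ _ (fun w : {ffun 'I_n -> M} => w j)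
       (fun a u v => etrans (ffunE _ j) (congr1 (+%R^~ (v j)) (ffunE _ j)))).

Lemma ffun_pr_surj (w : 'I_n -> M) : exists v, forall j, ffun_pr j v = w j.
Proof. by exists [ffun j => w j] => j; rewrite /= ffunE. Qed.

Lemma ffun_pr_inj v : (forall j, ffun_pr j v = 0) -> v = 0.
Proof. by move=> v0; apply/ffunP => j; rewrite ffunE; exact: v0. Qed.

Lemma ffun_fin_gen : fin_gen M -> fin_gen {ffun 'I_n -> M}.
Proof.
move=> /fin_genP [s sE]; apply/fin_genP.
have il (j : 'I_n) : linear (fun y : M => [ffun k => if k == j then y else 0]).
  by move=> a u v; apply/ffunP => k; rewrite !ffunE; case: eqP => // _; rewrite scaler0 addr0.
pose i (j : 'I_n) : {linear M -> {ffun 'I_n -> M}} :=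
  HB.pack (fun y : M => [ffun k => if k == j then y else 0])
    (GRing.isLinear.Build _ _ _ _ _ (il j)).
pose T : seq {ffun 'I_n -> M} := [seq i j v | j <- enum 'I_n, v <- s].
have sT := submodule_spans T; exists T; apply/seteqP; split=> // w _.
have -> : w = \sum_j i j (w j).
  apply/ffunP => k; rewrite sum_ffunE (bigD1 k) //= ffunE eqxx big1 ?addr0 //.
  by move=> j jk; rewrite ffunE eq_sym (negPf jk).
apply: subm_sum => // j _; have : spans s (w j) by rewrite sE.
apply: (spans_min (submodule_preimage (i j) sT)) => v vs; apply: mem_spans.
by apply/allpairsP; exists (j, v); rewrite mem_enum.
Qed.

End FfunPower.

(** From t(l - r) = k < l and t >= r one gets (r - 1)(l - r - 1) < 1, so l = r + 1 because r > 1;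
    then t = k <= r. Here [k] is the length of m K^t / J K^t, and [q] what the socle of K^t / J K^t
    has beyond that of R / J. *)
Lemma type_arith t r l k q : (1 < r)%N -> (r < l)%N -> (t * l = k + t * r)%N ->
  (k < l)%N -> (t = r + q)%N -> t = r /\ l = r.+1.
Proof.
move=> r1 rl tl kl tr; case: (leqP l r.+1) => lr; last by nia.
have lE : l = r.+1 by apply/eqP; rewrite eqn_leq lr.
by split=> //; subst l; lia.
Qed.

(** * The equivalent conditions in terms of a fixed regular sequence *)

Section Canonical.
Variables (R : comNzRingType) (m : set R) (d : nat) (K : lmodType R).
Hypotheses (locR : noetherian_local m) (cmR0 : cohen_macaulay m R^o).
Hypotheses (dimR : has_dim R^o d) (d_gt0 : (0 < d)%N) (infR : infinite_set (cosets m)).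
Hypotheses (nonGor : ~ gorenstein R) (canK : canonical_module m K).

Lemma cmR : max_cohen_macaulay m R^o.
Proof. by split=> //; exists d. Qed.

Lemma max_cm_noeth (M : lmodType R) : max_cohen_macaulay m M -> noeth M.
Proof. by move=> [[fM _ _] _]; apply: fin_gen_noeth => //; case: locR. Qed.

Lemma max_cm_ext_zero (M : lmodType R) b eps (D : forall i, 'M[R]_(b i.+1, b i)) i :
  max_cohen_macaulay m M -> residue_resolution m eps D -> (i < d)%N ->
  ext_zero D i [set (0 : M)].
Proof.
move=> cM resD id_; have [z [mz wz _ zd]] := depth_wreg dimR cM.
by apply: (wreg_ext_zero locR resD (submodule_set0 _) mz wz); rewrite zd.
Qed.

Section System.
Variables (n : nat) (x : seq R).
Hypotheses (xd : size x = d) (mx : forall a, a \in x -> m a).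
Hypotheses (wR : wreg [set (0 : R^o)] x) (wK : wreg [set (0 : K)] x)
  (redx : reduction m x n).
Let J : set R^o := msq x setT.
Let N : set K := msq x setT.
Let r := len m J (socle m J).
Let l := len m J setT.

Let sJ : submodule J.
Proof. exact: submodule_msq. Qed.

Let sN : submodule N.
Proof. exact: submodule_msq. Qed.

Let fJ : flen m J setT := flen_J locR redx.

Let JN a y : J a -> N (a *: y).
Proof. by move=> Ja; exact: (@msq_setT_mul R x K setT a y (submodule_setT K) Ja Logic.I). Qed.

Let socN : has_residue_dim m (socle m N) N 1.
Proof.
case: canK => cK [s dK [b [eps [D [resD /ext_dim_Defs dimE]]]]] _.
have sd : s = size x.
  case: cK => _ [s' dK' dR']; rewrite (longest_chain_uniq dK dK') xd.
  exact: longest_chain_uniq dR' dimR.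
rewrite sd in dimE; have := (ext_dim_wreg locR resD 1 (submodule_set0 K) mx wK).1 dimE.
by rewrite add0m.
Qed.

Let extN (I : set R^o) b e : submodule I -> J `<=` I -> ~ I b ->
  (forall a, m a -> I (a * b)) -> socle m N e ->
  exists ee, (forall a, I a -> N (a *: ee)) /\ N (b *: ee - e).
Proof.
case: canK => _ _ [n0 [E [eta [D [injE E0 eta_inj ex0 exS]]]]].
have c0 := concentrated0 eta_inj ex0 exS.
have [T] := concentrated_wreg injE exS (submodule_set0 _) (submodule_set0 _) wR wK c0.
rewrite !add0m => cT sI JI Ib mb Se.
apply: (socle_extend locR injE E0 exS sJ (J_max locR mx) (mpow_J redx) cT) => //.
by rewrite addn0 xd.
Qed.

Lemma canonical_len : flen m N setT /\ len m N setT = l.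
Proof. exact: (len_dual locR sJ sN fJ JN socN extN). Qed.

Lemma canonical_faithful a : (forall y, N (a *: y)) -> J a.
Proof. exact: (dual_faithful locR sJ sN fJ JN socN extN). Qed.

Lemma canonical_type : flen m J (socle m J) /\ r = len m (smul m [set: K]) setT.
Proof.
have := len_socle_dual locR sJ sN fJ JN socN extN.
have -> : addm N (smul m setT) = smul m setT => //.
apply/seteqP; split; last exact: sub_addmr.
apply: addm_min => //; first exact: submodule_smul.
by apply: msq_min => [|b z /mx mb _]; [exact: submodule_smul|exact: mem_smul].
Qed.

Lemma canonical_socle : clen m N (socle m N) 1.
Proof. exact: (clen_socle locR sN socN). Qed.

Lemma ring_type : has_cm_type m R^o r.
Proof.
exists d => //; have [b [eps [D resD]]] := residue_resolution_exists locR.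
exists b, eps, D; split=> //; apply/ext_dim_Defs; rewrite -xd.
apply/(ext_dim_wreg locR resD r (submodule_set0 _) mx wR); rewrite add0m.
have [fS _] := canonical_type.
by apply: clen_residue_dim (flen_clen locR fS) _ => // a y ma; apply.
Qed.

(** If r <= 1, K is generated by one element e. The map a |-> ae is injective modulo J by
    faithfulness, hence injective, and an isomorphism from R to K would give R finite injective
    dimension. *)
Lemma type_gt1 : (1 < r)%N.
Proof.
have [[[fK [y0 y00] _] _] _ [n0 [E [eta [D [injE E0 eta_inj ex0 exS]]]]]] := canK.
have nK : noeth K by apply: fin_gen_noeth => //; case: locR.
rewrite ltnNge; apply/negP => r1.
have sT := submodule_setT K.
have [_ rE] := canonical_type.
have [/generated_byP [s ss Ks] _] := (min_gens_len locR nK r sT).2 (esym rE).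
have [e eP] : exists e : K, forall y : K, exists c : R, y = c *: e.
  case: s ss Ks => [|e [|e' s]] ss Ks.
  - exists 0 => y; exists 0; have : [set: K] y by []. rewrite Ks => ->; by rewrite scaler0.
  - exists e => y; have : [set: K] y by []. rewrite Ks => -[c /eqP]; rewrite subr_eq0 => /eqP ->.
    by exists c.
  - by move: r1; rewrite -ss.
have f0l : linear (fun a : R^o => a *: e) by move=> a b c; rewrite scalerDl -scalerA.
pose f : {linear R^o -> K} := HB.pack (fun a : R^o => a *:
  e) (GRing.isLinear.Build _ _ _ _ _ f0l).
have [||inj _] := @wreg_lift R m K f [set 0] [set 0] x locR mx (submodule_set0 _)
    (submodule_set0 _) _ wK.
- by move=> a ->; rewrite linear0.
- move=> c; rewrite !add0m => Nce; apply: canonical_faithful => y.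
  by have [c' ->] := eP y; rewrite scalerA mulrC -scalerA; exact: submZ.
have f_inj : injective f.
  move=> a b fab; apply/eqP; rewrite -subr_eq0; apply/eqP; apply: inj.
  have fB : f (a - b) = f a - f b := raddfB f a b.
  by rewrite /set1 /mkset fB fab subrr.
apply: nonGor; exists n0, E, (eta \o f), D; split=> //.
- by move=> a b /= /eta_inj /f_inj.
move=> y; rewrite ex0; split=> [[z <-]|[a <-]]; last by exists (f a).
by have [c ->] := eP z; exists c.
Qed.

Let mpow k := iter k (@smul R R^o m) setT.

Lemma syzygy_ulrich (O : lmodType R) : first_syzygy m K O -> ulrich m O <-> mpow 2 `<=` J.
Proof.
have r1 := type_gt1; move=> [n0 [i [p [ses kp]]]].
have [i_inj ps pi] := ses; set V : lmodType R := 'rV[R]_n0 in i p ses kp i_inj ps pi *.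
have prl (j : 'I_n0) : linear (fun u : V => u 0 j : R^o) by move=> a u v; rewrite !mxE.
pose pr (j : 'I_n0) : {linear V -> R^o} :=
  HB.pack (fun u : V => u 0 j : R^o) (GRing.isLinear.Build _ _ _ _ _ (prl j)).
have prs (w : 'I_n0 -> R^o) : exists v, forall j, pr j v = w j.
  by exists (\row_j w j) => j; rewrite /= mxE.
have pri (v : V) : (forall j, pr j v = 0) -> v = 0.
  by move=> v0; apply/rowP => j; rewrite mxE; exact: v0.
have wV : wreg [set (0 : V)] x := wreg_power0 prs pri wR.
have [wO msqO] := ses_wreg ses wV wK.
have nO : noeth O := noeth_injective (@rV_noeth _ _ locR n0) i_inj.
have nK : noeth K by apply: max_cm_noeth; case: canK.
have JV := msq_power prs pri x.
have mV : smul m [set: V] = power pr (m : set R^o).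
  by rewrite (power_smul locR prs pri); congr power; exact: mpow1.
have sJV : submodule (msq x [set: V]) := submodule_msq x (submodule_setT V).
have sA : submodule (range i) := submodule_image i (submodule_setT O).
have smV : submodule (smul m [set: V]) := submodule_smul _ _.
have smK : submodule (smul m [set: K]) := submodule_smul _ _.
have kE : p @^-1` smul m setT = smul m setT.
  apply/seteqP; split=> y.
    have : smul m [set: K] `<=` p @` smul m setT.
      apply: smul_min => [|a z ma _]; first exact: submodule_image.
      have [v _ <-] := ps z Logic.I; exists (a *: v); last exact: linearZZ.
      exact: mem_smul.
    move=> h /h [z mz pz]; apply: (submBl smV mz); apply: kp.
    by rewrite /= linearB pz subrr.
  apply: (smul_min (submodule_preimage p smK)) => a z ma _.
  by rewrite /preimage /= linearZZ; exact: mem_smul.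
have [fS rE] := canonical_type.
(* Minimality of the cover identifies V / mV with K / mK, and the latter has length r by duality. *)
have n0r : n0 = r.
  have := (len_preimage_surj locR ps (flen_smul m nK (submodule_setT K))).2.
  rewrite -rE kE => <-; apply/esym/(clen_len locR).
  by have := clen_power prs (clen_max locR); rewrite powerT muln1 -mV.
subst n0.
have [fN lE] := canonical_len.
have [fV lV] : flen m (msq x [set: V]) setT /\ len m (msq x [set: V]) setT = (r * l)%N.
  have := clen_power prs (flen_clen locR fJ); rewrite powerT -JV => c.
  by split; [exists (r * l)%N|exact: (clen_len locR c)].
have pN := preimage_msq_ses x ses.
have := len_preimage_surj locR ps fN; rewrite pN lE => -[fA lA].
set X := addm _ _ in pN fA lA.
have sX : submodule X := submodule_addm sJV sA.
have JX : msq x [set: V] `<=` X := sub_addml sA.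
have AX : range i `<=` X := sub_addmr sJV.
have [fJX _ lJX] := len_add locR fV sX JX (fun _ _ => Logic.I).
have l0 : (r < l)%N := len_socle_lt locR d_gt0 xd mx redx r1.
split.
  move=> ulr; have := ulrich_elim locR dimR d_gt0 xd mx redx nO wO ulr.
  rewrite msqO => mO; apply/(msquare_socle locR d_gt0 xd mx redx r1).
  have [fP lP] : flen m (msq x [set: V]) (power pr (socle m J)) /\
      len m (msq x [set: V]) (power pr (socle m J)) = (r * r)%N.
    have := clen_power prs (flen_clen locR fS); rewrite -JV => c.
    by split; [exists (r * r)%N|exact: (clen_len locR c)].
  have XP : X `<=` power pr (socle m J).
    rewrite -socle_power -JV; apply: addm_min.
    - exact: submodule_socle.
    - by move=> y Jy a _; exact: submZ.
    - move=> _ [y _ <-] a ma; rewrite -linearZZ; apply: mO; exact: mem_smul.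
  (* Otherwise a socle element of R / J would multiply V into the preimage X of JK, hence kill K /
     JK, against faithfulness. *)
  have PX : ~ (power pr (socle m J) `<=` X).
    move=> PX; apply: (socle_neq_J locR mx redx) => a Sa.
    apply: canonical_faithful => y; have [v _ <-] := ps y Logic.I.
    rewrite -linearZZ; have : X (a *: v); last by rewrite -pN.
    apply: PX => j b mb; rewrite /= mxE scale_regE mulrA mulrC.
    by apply: (@submZ R R^o) => //; exact: Sa.
  have := len_lt locR fP sX JX XP PX; rewrite lP => lX.
  (* Now (r - 1) l < r^2, which fails for l >= r + 2 because r >= 2. *)
  rewrite -/J -/r -/l leqNgt; apply/negP => rl.
  case: (r) r1 rl lJX lX lV => // s s1 rl lJX lX lV; rewrite lV lA in lJX.
  by have := leq_mul (leqnn s) rl; nia.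
(* If the syzygy were zero, V / JV and K / JK would have the same length, that is r l = l. *)
move=> m2J; have O0 : exists y : O, y != 0.
  apply: contrapT => O0; have O00 y : i y = 0.
    apply: contrapT => iy; apply: O0; exists y; apply/eqP => y0.
    by apply: iy; rewrite y0 linear0.
  have XE : X = msq x setT.
    by apply: addm_absorb => // _ [y _ <-]; rewrite O00; exact: subm0.
  move: lA; rewrite XE lV; nia.
apply: (ulrich_intro locR dimR xd mx redx nO wO O0 _).2; rewrite msqO.
apply: smul_min; first exact: submodule_preimage.
move=> a y ma _; rewrite /preimage /= linearZZ JV => j; apply: m2J.
have : power pr (m : set R^o) (i y) by rewrite -mV; apply: kp; apply/pi; exists y.
rewrite /= mxE => /(_ j) my; apply: mem_smul => //.
by have := mpow1 locR; rewrite /= => ->.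
Qed.

Lemma len_power t (pr := @ffun_pr R K t) :
  [/\ msq x [set: {ffun 'I_t -> K}] = power pr N,
      flen m (power pr N) setT, len m (power pr N) setT = (t * l)%N
    & len m (power pr (smul m setT)) setT = (t * r)%N].
Proof.
have prs := @ffun_pr_surj R K t; have pri := @ffun_pr_inj R K t.
have nK : noeth K by apply: max_cm_noeth; case: canK.
have [fN lE] := canonical_len; have [_ rE] := canonical_type.
have cN := clen_power prs (flen_clen locR fN).
have cm := clen_power prs (flen_clen locR (flen_smul m nK (submodule_setT K))).
rewrite powerT lE in cN; rewrite powerT -rE in cm.
split; [exact: (msq_power prs pri)|by exists (t * l)%N|exact: (clen_len locR cN)|].
exact: (clen_len locR cm).
Qed.

Lemma len_cokernel t (f : {linear R^o -> {ffun 'I_t -> K}}) (I : set R^o) :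
  J = f @^-1` (msq x setT) -> submodule I -> J `<=` I ->
  len m (msq x setT) (addm (msq x setT) (f @` I)) = len m J I.
Proof.
move=> JE sI JI; have [f1 _ _] := len_add locR fJ sI JI (fun _ _ => Logic.I).
have IJ : I `&` f @^-1` (msq x setT) = J by rewrite -JE; apply/setIidr.
have := @len_image R m locR _ _ f I (msq x setT) sI (submodule_msq x (submodule_setT _)).
by rewrite IJ => /(_ f1) [].
Qed.

Lemma ulrich_cokernel_elim t (D : lmodType R) (f : {linear R^o -> {ffun 'I_t -> K}})
    (g : {linear {ffun 'I_t -> K} -> D}) : short_exact f g -> noeth D ->
  wreg [set (0 : D)] x -> ulrich m D -> mpow 2 `<=` J /\ t = r.
Proof.
have r1 := type_gt1; move=> ses nD wD ulr.
pose pr := @ffun_pr R K t.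
have prs := @ffun_pr_surj R K t; have pri := @ffun_pr_inj R K t.
have wB := wreg_power0 prs pri wK; have [_ JE] := ses_wreg ses wB wD.
have [JB fB lB lmB] := len_power t; rewrite -/pr in JB fB lB lmB.
have sJB : submodule (msq x [set: {ffun 'I_t -> K}]) := submodule_msq x (submodule_setT _).
have mB := power_smul locR prs pri; rewrite -/pr in mB.
have smB : submodule (smul m [set: {ffun 'I_t -> K}]) := submodule_smul _ _.
have JmB : msq x [set: {ffun 'I_t -> K}] `<=` smul m setT.
  by apply: msq_min => [|a z /mx ma _]; [exact: submodule_smul|exact: mem_smul].
have fT : submodule (range f) := submodule_image f (submodule_setT _).
rewrite -JB in fB lB; rewrite -mB in lmB.
have [fm _ lm] := len_add locR fB smB JmB (fun _ _ => Logic.I).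
have lX := len_cokernel JE (submodule_setT _) (fun _ _ => Logic.I).
set X := addm _ _ in lX; have sX : submodule X := submodule_addm sJB fT.
have JX : msq x [set: {ffun 'I_t -> K}] `<=` X := sub_addml fT.
have [fX _ _] := len_add locR fB sX JX (fun _ _ => Logic.I).
have mX : smul m [set: {ffun 'I_t -> K}] `<=` X.
  rewrite /X -(preimage_msq_ses x ses); apply: smul_min => [|a z ma _].
    exact/submodule_preimage/submodule_msq/submodule_setT.
  rewrite /preimage /= linearZZ; apply: (ulrich_elim locR dimR d_gt0 xd mx redx nD wD ulr).
  exact: mem_smul.
(* Otherwise f(1) is in m K^t, so f sends the socle of R / J to zero in K^t / J K^t. As f is
   injective modulo J, that socle would vanish. *)
have Xm : ~ (X `<=` smul m [set: {ffun 'I_t -> K}]).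
  move=> Xm; apply: (socle_neq_J locR mx redx) => a Sa.
  have f1 : smul m [set: {ffun 'I_t -> K}] (f 1) by apply: Xm; apply: sub_addmr => //; exists 1.
  rewrite -/J [J]JE /preimage /=.
  have -> : f a = a *: f 1 by rewrite -linearZZ scale_regE mulr1.
  rewrite JB => j; rewrite linearZZ; move: f1; rewrite mB => /(_ j).
  apply: (@smul_min R K m setT [set y | N (a *: y)]).
    by split=> [|b y z Ny Nz]; [rewrite /mkset scaler0; exact: subm0|
      apply: eqmem (submD sN (submZ b sN Ny) Nz) _; module_eq R K].
  move=> b y mb _; rewrite /mkset scalerA; apply: JN; rewrite mulrC; exact: Sa.
have lmX := len_lt locR fX smB JmB mX Xm; rewrite lX -/l in lmX.
have sS : submodule (socle m J) := submodule_socle m sJ.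
have JS : J `<=` socle m J by move=> y Jy a _; exact: (@submZ R R^o).
have lY := len_cokernel JE sS JS; set Y := addm _ _ in lY.
have cS := clen_power prs canonical_socle; rewrite muln1 -/pr -JB in cS.
have YS : Y `<=` power pr (socle m N).
  rewrite -socle_power -JB; apply: addm_min.
  - exact: submodule_socle.
  - by move=> y Jy a _; exact: submZ.
  - move=> _ [y Sy <-] a ma; rewrite -linearZZ.
    by have := Sy a ma; rewrite -/J [J]JE.
have sY : submodule Y := submodule_addm sJB (submodule_image f sS).
have fS : flen m (msq x [set: {ffun 'I_t -> K}]) (power pr (socle m N)) by exists t.
have [_ _] := len_add locR fS sY (sub_addml (submodule_image f sS)) YS.
rewrite (clen_len locR cS) lY -/r => tr.
have rl : (r < l)%N := len_socle_lt locR d_gt0 xd mx redx r1.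
have [tE lE] : t = r /\ l = r.+1.
  by rewrite lB lmB in lm; exact: type_arith r1 rl lm lmX tr.
by split=> //; apply/(msquare_socle locR d_gt0 xd mx redx r1); rewrite -/l lE.
Qed.

Lemma ulrich_cokernel_intro : mpow 2 `<=` J -> ulrich_cokernel m K r.
Proof.
have r1 := type_gt1 => m2J.
have rl : (r < l)%N := len_socle_lt locR d_gt0 xd mx redx r1.
have lE : l = r.+1.
  by apply/eqP; rewrite eqn_leq rl andbT; exact: (msquare_socle locR d_gt0 xd mx redx r1).1.
have [[[fK _ _] _] _ _] := canK.
have nK : noeth K by apply: max_cm_noeth; case: canK.
have [_ rE] := canonical_type.
have [/generated_byP [s ss Ks] _] := (min_gens_len locR nK r (submodule_setT K)).2 (esym rE).
have fl : linear (fun a : R^o => [ffun j : 'I_r => a *: s`_j]).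
  by move=> a b c; apply/ffunP => j; rewrite !ffunE scalerDl -scalerA.
pose f : {linear R^o -> {ffun 'I_r -> K}} :=
  HB.pack (fun a : R^o => [ffun j : 'I_r => a *: s`_j]) (GRing.isLinear.Build _ _ _ _ _ fl).
pose pr := @ffun_pr R K r.
have prs := @ffun_pr_surj R K r; have pri := @ffun_pr_inj R K r.
have wB := wreg_power0 prs pri wK.
have [JB fB lB lmB] := len_power r; rewrite -/pr in JB fB lB lmB.
have mB := power_smul locR prs pri; rewrite -/pr in mB.
have fJB a : msq x [set: {ffun 'I_r -> K}] (f a) -> J a.
  rewrite JB => fa; apply: canonical_faithful => y.
  have : [set: K] y by []. rewrite Ks.
  apply: (@spans_min R K s [set y | N (a *: y)]).
    split=> [|b u v Nu Nv]; first by rewrite /mkset scaler0; exact: subm0.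
    by apply: eqmem (submD sN (submZ b sN Nu) Nv) _; module_eq R K.
  move=> v /(nthP 0) [j js <-]; rewrite ss in js.
  by have := fa (Ordinal js); rewrite /= ffunE.
have [||inj wf] := @wreg_lift R m _ f [set 0] [set 0] x locR mx (submodule_set0 _)
    (submodule_set0 _) _ wB.
- by move=> a ->; rewrite linear0.
- by move=> c; rewrite !add0m; exact: fJB.
have sf : submodule (range f) := submodule_image f (submodule_setT _).
pose g : {linear {ffun 'I_r -> K} -> quotient sf} := quot_proj sf.
have gs : set_surj setT setT g.
  by move=> y _; exists (quot_repr y) => //; exact: quot_reprK.
have ses : short_exact f g.
  split=> // [a b fab|y].
    apply/eqP; rewrite -subr_eq0; apply/eqP; apply: inj.
    have fB' : f (a - b) = f a - f b := raddfB f a b.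
    by rewrite /set1 /mkset fB' fab subrr.
  by rewrite quot_proj0; split=> [[a _ <-]|[a <-]]; exists a.
have wD : wreg [set (0 : quotient sf)] x.
  apply/(wreg_surj x (submodule_set0 _) gs).
  suff -> : g @^-1` [set 0] = addm [set 0] (range f) by [].
  rewrite add0m; apply/seteqP; split=> y; first by move=> /(quot_proj0 sf).
  by move=> fy; apply/(quot_proj0 sf).
have [_ JE] := ses_wreg ses wB wD.
have nB : noeth {ffun 'I_r -> K}.
  by apply: fin_gen_noeth; [case: locR|exact: ffun_fin_gen].
have nD : noeth (quotient sf) := noeth_surj nB gs.
have sm := ideal_max locR; have Jm := J_max locR mx.
have [f1 _ l1] := len_add locR fJ sm Jm (fun _ _ => Logic.I).
have lm : len m J m = r.
  by move: l1; rewrite (clen_len locR (clen_max locR)) -/l lE; lia.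
have := len_cokernel JE sm Jm; rewrite lm.
set Y := addm _ _ => lY.
have sJB : submodule (msq x [set: {ffun 'I_r -> K}]) := submodule_msq x (submodule_setT _).
have sfm : submodule (f @` m) := submodule_image f sm.
have sY : submodule Y := submodule_addm sJB sfm.
have smB : submodule (smul m [set: {ffun 'I_r -> K}]) := submodule_smul _ _.
have YmB : Y `<=` smul m setT.
  apply: addm_min => //.
    by apply: msq_min => [|a z /mx ma _]; [exact: submodule_smul|exact: mem_smul].
  move=> _ [a ma <-]; have -> : f a = a *: f 1 by rewrite -linearZZ scale_regE mulr1.
  exact: mem_smul.
have JY : msq x setT `<=` Y := sub_addml sfm.
rewrite -JB in fB lB; rewrite -mB in lmB.
have [fmB _ lmB'] := len_add locR fB smB (subset_trans JY YmB) (fun _ _ => Logic.I).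
have [_ fYm lYm] := len_add locR fmB sY JY YmB.
(* Over J K^r, the module Y has the length of m / J, which is r, and m K^r has length r l - r^2,
   which is r as l = r + 1. *)
have YE : Y = smul m setT.
  apply: (len0_eq locR fYm); move: lmB'; rewrite lB lmB lYm lY lE; nia.
have mD : smul m [set: quotient sf] `<=` msq x setT.
  apply: smul_min => [|a z ma _]; first exact/submodule_msq/submodule_setT.
  have [w _ <-] := gs z Logic.I; rewrite -linearZZ.
  suff : (g @^-1` (msq x setT)) (a *: w) by [].
  rewrite (preimage_msq_ses x ses); have : Y (a *: w) by rewrite YE; exact: mem_smul.
  by apply: addm_mono => // _ [b _ <-]; exists b.
(* If the cokernel were zero, f would be onto modulo J, and comparing lengths would give r l = l. *)
have D0 : exists y : quotient sf, y != 0.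
  apply: contrapT => D0; have := len_cokernel JE (submodule_setT _) (fun _ _ => Logic.I).
  rewrite -(preimage_msq_ses x ses).
  have -> : g @^-1` (msq x setT) = setT.
    apply/seteqP; split=> // y _; rewrite /preimage /mkset.
    suff -> : g y = 0 by exact: (subm0 (submodule_msq x (submodule_setT (quotient sf)))).
    by apply: contrapT => gy; apply: D0; exists (g y); apply/eqP.
  by rewrite lB -/l; nia.
have [cD uD] := ulrich_intro locR dimR xd mx redx nD wD D0 mD.
by exists (quotient sf), f, g; split.
Qed.

End System.
End Canonical.

(** * Products of two modules, and the proof of the equivalence *)

Section Products.
Variable R : comNzRingType.

Lemma hom_map_linear (M M' : lmodType R) (h : {linear M -> M'}) p q (A : 'M[R]_(p, q))
    (w : {ffun 'I_q -> M}) : [ffun l => h (hom_map A w l)] = hom_map A [ffun j => h (w j)].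
Proof.
apply/ffunP => l; rewrite !ffunE linear_sum.
by apply: eq_bigr => j _; rewrite linearZZ ffunE.
Qed.

Variables A B : lmodType R.

(** Allows [good_system] to be applied to a product, for which only finite generation and the
    vanishing of Ext below [d] are then to be checked. *)
Lemma ext_zero_prod b (D : forall i, 'M[R]_(b i.+1, b i)) i :
  ext_zero D i [set (0 : A)] -> ext_zero D i [set (0 : B)] -> ext_zero D i [set (0 : A * B)].
Proof.
move=> zA zB w Zw.
have [cA cB] : coB D [set (0 : A)] [ffun j => (w j).1] /\
    coB D [set (0 : B)] [ffun j => (w j).2].
  split; [apply: zA|apply: zB] => j; have := Zw j; rewrite /set1 /mkset => wj.
    by rewrite -(hom_map_linear fst) ffunE wj.
  by rewrite -(hom_map_linear snd) ffunE wj.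
case: i {zA zB Zw} w cA cB => [|i] w cA cB.
  move=> j; have := cA j; have := cB j; rewrite !ffunE /set1 /mkset.
  by case: (w j) => u v /= -> ->.
case: cA cB => [u uA] [v vB]; exists [ffun j => (u j, v j)] => j.
have := uA j; have := vB j; rewrite !ffunE /set1 /mkset.
set S := \sum_j _ => E2 E1.
suff -> : \sum_j0 D i j j0 *: [ffun j1 => (u j1, v j1)] j0 =
    (\sum_j0 D i j j0 *: u j0, \sum_j0 D i j j0 *: v j0).
  by case: (w j) E1 E2 => p q /= E1 E2; congr pair.
by rewrite [LHS]surjective_pairing !raddf_sum; congr pair; apply: eq_bigr => k _;
  rewrite ffunE.
Qed.

Lemma pair_inl_linear : linear (fun a : A => (a, 0) : A * B).
Proof. by move=> a u v; rewrite /GRing.scale /GRing.add /= /add_pair /scale_pair /= scaler0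
  addr0. Qed.

Lemma pair_inr_linear : linear (fun y : B => (0, y) : A * B).
Proof. by move=> a u v; rewrite /GRing.scale /GRing.add /= /add_pair /scale_pair /= scaler0
  addr0. Qed.

Definition pair_inl : {linear A -> (A * B)%type} :=
  HB.pack (fun a : A => (a, 0) : A * B) (GRing.isLinear.Build _ _ _ _ _ pair_inl_linear).

Definition pair_inr : {linear B -> (A * B)%type} :=
  HB.pack (fun y : B => (0, y) : A * B) (GRing.isLinear.Build _ _ _ _ _ pair_inr_linear).

Lemma fin_gen_prod : fin_gen A -> fin_gen B -> fin_gen (A * B)%type.
Proof.
move=> /fin_genP [s sE] /fin_genP [t tE]; apply/fin_genP.
pose T := map pair_inl s ++ map pair_inr t; have sT := submodule_spans T.
exists T; apply/seteqP; split=> // w _.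
have -> : w = pair_inl w.1 + pair_inr w.2.
  by case: w => u v; rewrite /= /GRing.add /= /add_pair /= addr0 add0r.
apply: submD => //.
  have : spans s w.1 by rewrite sE.
  apply: (spans_min (submodule_preimage pair_inl sT)) => v vs; apply: mem_spans.
  by rewrite mem_cat map_f.
have : spans t w.2 by rewrite tE.
apply: (spans_min (submodule_preimage pair_inr sT)) => v vs; apply: mem_spans.
by rewrite mem_cat map_f ?orbT.
Qed.

End Products.

Theorem theorem1p3 (R : comNzRingType) (m : set R) (d : nat)
    (K OmegaK : lmodType R) :
  noetherian_local m ->
  cohen_macaulay m R^o ->
  has_dim R^o d -> (0 < d)%N ->
  infinite_set (cosets m) ->
  ~ gorenstein R ->
  canonical_module m K ->
  first_syzygy m K OmegaK ->
  [<-> minimal_multiplicity m;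
       ulrich m OmegaK;
       exists t : nat, ulrich_cokernel m K t] /\
  (forall t : nat, ulrich_cokernel m K t -> has_cm_type m R^o t).
Proof.
move=> locR cmR0 dimR d0 infR nG canK syz.
have cR := cmR cmR0 dimR; have cK : max_cohen_macaulay m K by case: canK.
have [b [eps [D resD]]] := residue_resolution_exists locR.
have nK := max_cm_noeth locR cK.
have extK i (id_ : (i < d)%N) := max_cm_ext_zero locR dimR cK resD id_.
have [x [n [[xd mx wR wK redx] [flag Jm2]]]] := good_system locR infR dimR cR nK resD extK.
have mmP := min_multP locR dimR d0 xd mx wR redx flag Jm2.
have uP := syzygy_ulrich locR dimR d0 nG canK xd mx wR wK redx syz.
have elim t : ulrich_cokernel m K t -> minimal_multiplicity m /\ has_cm_type m R^o t.
  move=> [D0 [f [g [ses cD uD]]]]; have nD := max_cm_noeth locR cD.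
  (* A sequence generic for the product is regular on both factors. The conclusions, minimal
     multiplicity and the type of R, do not mention the sequence, so a separate choice for each
     cokernel is harmless. *)
  have nP : noeth (K * D0)%type.
    apply: fin_gen_noeth; first by case: locR.
    by apply: fin_gen_prod; [case: cK => -[]|case: cD => -[]].
  have extP i (id_ : (i < d)%N) :=
    ext_zero_prod (extK i id_) (max_cm_ext_zero locR dimR cD resD id_).
  have [y [k [[yd my wRy wP redy] [flag' Jm2']]]] := good_system locR infR dimR cR nP resD extP.
  have wKy : wreg [set (0 : K)] y.
    by apply: (@wreg_retract _ _ _ (pair_inl K D0) fst _ _ _ _ _ _ wP) => // [_ ->|_ ->].
  have wDy : wreg [set (0 : D0)] y.
    by apply: (@wreg_retract _ _ _ (pair_inr K D0) snd _ _ _ _ _ _ wP) => // [_ ->|_ ->].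
  have [m2J ->] := ulrich_cokernel_elim locR dimR d0 nG canK yd my wRy wKy redy ses nD wDy uD.
  split; last exact: (ring_type locR dimR d0 canK yd my wRy wKy redy).
  exact/(min_multP locR dimR d0 yd my wRy redy flag' Jm2').
split; last by move=> t /elim [].
tfae.
- by move=> /mmP /uP.
- move=> /uP m2J; exists (len m (msq x [set: R^o]) (socle m (msq x [set: R^o]))).
  exact: (ulrich_cokernel_intro locR dimR d0 nG canK xd mx wR wK redx m2J).
- by move=> [t /elim []].
Qed.
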